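(* The operator algebra $\mathcal{U}(\mathcal{W}_{3,2})$ is hyperrigid in $C^*_{\mathrm{env}}(\mathcal{U}(\mathcal{W}_{3,2}))=M_2\left(\bigoplus_{k=1}^3\mathcal{B}\right)$, and $\mathcal{W}_{3,2}$ is hyperrigid in $C^*_{\mathrm{env}}(\mathcal{W}_{3,2})=\bigoplus_{k=1}^3\mathcal{B}$.
   Context: $\mathcal{B}=\left\{\begin{bmatrix} a & b \\ b & a \end{bmatrix}:a,b\in\mathbb{C}\right\}\subset M_2(\mathbb{C})$ (a $C^*$-algebra). $\mathcal{W}_{3,2}\subset\bigoplus_{k=1}^3\mathcal{B}\subset M_6(\mathbb{C})$ is the operator system of all matrices $\begin{bmatrix} a & b \\ b & a \end{bmatrix}\oplus\begin{bmatrix} a & c \\ c & a \end{bmatrix}\oplus\begin{bmatrix} a & d \\ d & a \end{bmatrix}$ with $a,b,c,d\in\mathbb{C}$. For an operator space $X\subseteq B(\mathcal{H})$, $\mathcal{U}(X) := \left\{\begin{bmatrix} \lambda & x \\ 0 & \lambda \end{bmatrix} : \lambda\in\mathbb{C},\ x\in X\right\}\subseteq M_2(B(\mathcal{H}))$, a unital operator algebra. With $\mathcal{W}_{3,2}\subset\bigoplus_{k=1}^3\mathcal{B}$ this gives $\mathcal{U}(\mathcal{W}_{3,2})\subset M_2(\bigoplus_{k=1}^3\mathcal{B})$. $C^*_{\mathrm{env}}$ denotes the $C^*$-envelope (of an operator system, or of a unital operator algebra); the equalities are with respect to the given inclusions. An operator system $\mathcal{S}$ generating a unital $C^*$-algebra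 $\mathcal{C}$ is hyperrigid in $\mathcal{C}$ if for every unital $*$-representation $\pi:\mathcal{C}\to B(\mathcal{H})$, $\pi$ is the only unital completely positive map $\mathcal{C}\to B(\mathcal{H})$ extending $\pi|_{\mathcal{S}}$. A unital operator algebra $\mathcal{A}$ generating $\mathcal{C}$ is hyperrigid in $\mathcal{C}$ if for every unital $*$-representation $\pi:\mathcal{C}\to B(\mathcal{H})$, $\pi$ is the only unital completely contractive (equivalently, unital completely positive) map $\mathcal{C}\to B(\mathcal{H})$ extending $\pi|_{\mathcal{A}}$. *)

(* Defs.v *)
From HB Require Import structures.
From mathcomp Require Import all_boot all_order all_algebra.
From mathcomp Require Import complex sesquilinear.
From mathcomp Require Import all_classical all_reals all_analysis.

Set Implicit Arguments.
Unset Strict Implicit.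
Unset Printing Implicit Defensive.

Import Order.TTheory GRing.Theory Num.Theory.
Import numFieldNormedType.Exports.

Local Open Scope classical_set_scope.
Local Open Scope ring_scope.
Local Open Scope complex_scope.

(* The complex field is R[i] for R : realType; norms of vectors are R[i]-valued
   (with real nonnegative values).  Inner products are linear in the first
   argument and conjugate-linear in the second. *)
Record hilbert (R : realType) := Hilbert {
  hsort :> completeNormedModType R[i];
  hdot : {dot hsort for Num.Def.conjC};
  hdot_norm : forall x : hsort, hdot x x = `|x| ^+ 2 }.

Section dotnorm.
Context (R : realType) (U : lmodType R[i]) (f : {dot U for Num.Def.conjC}).

Lemma dot_cs (u v : U) : `|f u v| ^+ 2 <= f u u * f v v.
Proof.
have [->|v0] := eqVneq v 0; first by rewrite !linear0r normr0 expr0n.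
have fv : 0 < f v v by exact: neq0_dnorm_gt0.
pose a := f u v / f v v.
have := dnorm_ge0 f (u - a *: v).
have ou : f (u - a *: v) v = 0.
  by rewrite linearBl linearZl_LR/= divfK ?subrr// gt_eqF.
rewrite linearBr/= linearZr_LR/= ou.
rewrite mulr0 subr0 linearBl linearZl_LR/= (hermC f v u)/= expr0 mul1r.
rewrite subr_ge0 /a mulrAC -normCK => h.
by rewrite -ler_pdivrMr.
Qed.

Definition dnrm (u : U) : R[i] := sqrtC (f u u).

Lemma dnrm_sq u : dnrm u ^+ 2 = f u u. Proof. exact: sqrtCK. Qed.

Lemma dnrm_ge0 u : 0 <= dnrm u. Proof. by rewrite sqrtC_ge0 dnorm_ge0. Qed.

Lemma dnrm_eq0 u : dnrm u = 0 -> u = 0.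
Proof. by move/eqP; rewrite sqrtC_eq0 dnorm_eq0 => /eqP. Qed.

Lemma dnrmZ (a : R[i]) u : dnrm (a *: u) = `|a| * dnrm u.
Proof. by rewrite /dnrm dnormZ rootCMl ?exprn_ge0// sqrCK. Qed.

Lemma dot_le u v : `|f u v| <= dnrm u * dnrm v.
Proof.
rewrite -(ler_pXn2r (n:=2))// ?nnegrE ?mulr_ge0 ?dnrm_ge0//.
by rewrite exprMn !dnrm_sq dot_cs.
Qed.

Lemma dnrmD u v : dnrm (u + v) <= dnrm u + dnrm v.
Proof.
rewrite -(ler_pXn2r (n:=2))// ?nnegrE ?addr_ge0 ?dnrm_ge0//.
rewrite dnrm_sq dnormD/= sqrrD !dnrm_sq [leRHS]addrAC lerD2l.
apply: le_trans (real_ler_norm _) _; first by rewrite CrealE rmorphD/= conjCK addrC.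
apply: le_trans (ler_normD _ _) _; rewrite norm_conjC -mulr2n lerMn2r/=.
exact: dot_le.
Qed.

End dotnorm.

Section hpow.
Context (R : realType) (H : hilbert R) (n : nat).

(* Hilbert space direct sum of n copies of H *)
Definition hpow_sort := {ffun 'I_n -> H}.
HB.instance Definition _ := GRing.Lmodule.copy hpow_sort {ffun 'I_n -> H}.

Definition hpow_dot (x y : hpow_sort) : R[i] := \sum_i hdot H (x i) (y i).

Lemma hpow_dot_bilinear :
  bilinear_for *%R (Num.Def.conjC \; *%R) hpow_dot.
Proof.
split=> [u' a x y | u a x y]; rewrite /= /hpow_dot mulr_sumr -big_split;
  apply: eq_bigr => i _ /=.
  by rewrite !ffunE linearPl.
by rewrite !ffunE linearPr.
Qed.

HB.instance Definition _ := @bilinear_isBilinear.Build R[i] hpow_sort hpow_sort R[i]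
  (GRing.Scale.Law.clone _ _ ( *%R ) _)
  (GRing.Scale.Law.clone _ _ (Num.Def.conjC \; *%R ) _) hpow_dot hpow_dot_bilinear.

Lemma hpow_dot_hermitian x y : hpow_dot x y = (-1) ^+ false * (hpow_dot y x)^*%R.
Proof.
rewrite mul1r rmorph_sum; apply: eq_bigr => i _.
by rewrite (hermC (hdot H)) mul1r.
Qed.

HB.instance Definition _ := @isHermitianSesquilinear.Build R[i] hpow_sort false
  Num.Def.conjC hpow_dot hpow_dot_hermitian.

Lemma hpow_dot_gt0 x : x != 0 -> 0 < hpow_dot x x.
Proof.
move=> x0; rewrite lt_def sumr_ge0 ?andbT; last by move=> i _; exact: dnorm_ge0.
apply: contra x0; rewrite psumr_eq0; last by move=> i _; exact: dnorm_ge0.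
move=> /allP x0; apply/eqP/ffunP => i; rewrite ffunE.
by have := x0 i (mem_index_enum _); rewrite dnorm_eq0 => /eqP.
Qed.

HB.instance Definition _ := @isDotProduct.Build R[i] hpow_sort hpow_dot hpow_dot_gt0.

HB.instance Definition _ := @Lmodule_isNormed.Build R[i] hpow_sort
  (dnrm hpow_dot) (dnrmD hpow_dot) (dnrmZ hpow_dot) (@dnrm_eq0 _ _ hpow_dot).

Lemma hpow_normE (x : hpow_sort) : hpow_dot x x = `|x| ^+ 2.
Proof. exact/esym/dnrm_sq. Qed.

Lemma hpow_norm_sq (x : hpow_sort) : `|x| ^+ 2 = \sum_i `|x i| ^+ 2.
Proof. by rewrite -hpow_normE; apply: eq_bigr => i _; exact: hdot_norm. Qed.

Lemma hpow_norm_proj (x : hpow_sort) i : `|x i| <= `|x|.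
Proof.
rewrite -(ler_pXn2r (n:=2))// ?nnegrE// hpow_norm_sq (bigD1 i)//= lerDl.
by apply: sumr_ge0 => j _; exact: exprn_ge0.
Qed.

Lemma hpow_norm_sum (x : hpow_sort) : `|x| <= \sum_i `|x i|.
Proof.
rewrite -(ler_pXn2r (n:=2))// ?nnegrE ?sumr_ge0//.
rewrite hpow_norm_sq expr2 big_distrl/=.
apply: ler_sum => i _; rewrite expr2 ler_wpM2l// (bigD1 i)//= lerDl.
exact: sumr_ge0.
Qed.

Lemma hpow_complete (F : set_system hpow_sort) :
  ProperFilter F -> cauchy F -> cvg F.
Proof.
move=> FF /cauchy_ballP Fc.
have Fci i : cauchy ((fun x : hpow_sort => x i) @ F).
  apply/(cauchy_ballP ((fun x : hpow_sort => x i) @ F)) => e e0.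
  rewrite near_map2.
  apply: filterS (Fc e e0) => -[x y] /=; rewrite -!ball_normE /=.
  by apply: le_lt_trans; have := hpow_norm_proj (x - y) i; rewrite !ffunE.
have cvF i : cvg ((fun x : hpow_sort => x i) @ F) by exact: cauchy_cvg.
pose l : hpow_sort := [ffun i => lim ((fun x : hpow_sort => x i) @ F)].
apply/cvg_ex; exists l; apply/cvgrPdist_lt => e e0.
have e'0 : 0 < e / n.+1%:R by rewrite divr_gt0.
have Hi i : \forall x \near F, `|l i - (x : hpow_sort) i| < e / n.+1%:R.
  by rewrite ffunE; have /cvgrPdist_lt/(_ _ e'0) := cvF i.
apply: filterS (filter_forall _ Hi) => x xl.
apply: le_lt_trans (hpow_norm_sum _) _.
apply: (@le_lt_trans _ _ (\sum_(i < n) e / n.+1%:R)).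
  by apply: ler_sum => i _; have /ltW := xl i; rewrite !ffunE.
rewrite sumr_const card_ord -[ltLHS]mulr_natr mulrAC ltr_pdivrMr// ltr_pM2l//.
by rewrite ltr_nat.
Qed.

HB.instance Definition _ := Uniform_isComplete.Build hpow_sort hpow_complete.

Definition hpow : hilbert R := Hilbert hpow_normE.

End hpow.

Section Cc.
Context (R : realType).

(* an alias: R[i]^o shares its canonical keys with the real line R^o *)
Definition scal := R[i]^o.
HB.instance Definition _ := NormedModule.copy scal R[i]^o.

Definition cdot (x y : scal) : R[i] := x * (y : R[i])^*%R.

Lemma cdot_bilinear : bilinear_for *%R (Num.Def.conjC \; *%R) cdot.
Proof.
split=> [u' a x y | u a x y]; rewrite /= /cdot.
  by rewrite mulrDl -mulrA.
by rewrite rmorphD rmorphM/= mulrDr mulrCA.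
Qed.

HB.instance Definition _ := @bilinear_isBilinear.Build R[i] scal scal R[i]
  (GRing.Scale.Law.clone _ _ ( *%R ) _)
  (GRing.Scale.Law.clone _ _ (Num.Def.conjC \; *%R ) _) cdot cdot_bilinear.

Lemma cdot_hermitian x y : cdot x y = (-1) ^+ false * (cdot y x)^*%R.
Proof. by rewrite mul1r rmorphM/= conjCK mulrC. Qed.

HB.instance Definition _ := @isHermitianSesquilinear.Build R[i] scal false
  Num.Def.conjC cdot cdot_hermitian.

Lemma cdot_gt0 x : x != 0 -> 0 < cdot x x.
Proof. by move=> x0; rewrite /cdot -normCK exprn_gt0// normr_gt0. Qed.

HB.instance Definition _ := @isDotProduct.Build R[i] scal cdot cdot_gt0.

Lemma C_complete (F : set_system scal) : ProperFilter F -> cauchy F -> cvg F.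
Proof.
move=> FF /cauchy_ballP Fc.
have Fr (g : R[i] -> R) : (forall z, `|g z|%:C <= `|z|) -> {morph g : x y / x - y} ->
    cvg ((fun x : scal => g x) @ F).
  move=> gle gB; apply: cauchy_cvg.
  apply/(cauchy_ballP ((fun x : scal => g x) @ F)) => e e0.
  rewrite near_map2.
  have e0' : 0 < e%:C :> R[i] by rewrite ltcR.
  apply: filterS (Fc _ e0') => -[x y] /=; rewrite -!ball_normE /=.
  by rewrite -gB -ltcR; exact: le_lt_trans.
have cR : cvg ((fun x : scal => complex.Re x) @ F).
  by apply: Fr => [|[a b] [c d]]//; exact: normc_ge_Re.
have cI : cvg ((fun x : scal => complex.Im x) @ F).
  apply: Fr => [[a b]|[a b] [c d]]//=.
  by simpc; rewrite -sqrtr_sqr ler_wsqrtr// lerDr sqr_ge0.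
pose l : scal := (lim ((fun x : scal => complex.Re x) @ F) +i*
                    lim ((fun x : scal => complex.Im x) @ F)).
apply/cvg_ex; exists l; apply/cvgrPdist_lt => e e0.
have [r r0 re] : exists2 r : R, 0 < r & (r + r)%:C = e.
  move: e0; case: e => a b; rewrite ltcE/= => /andP[/eqP-> a0].
  by exists (a / 2); rewrite ?divr_gt0// -splitr.
have HR : \forall x \near F, `|complex.Re l - complex.Re (x : scal)| < r.
  by have /cvgrPdist_lt/(_ _ r0) := cR.
have HI : \forall x \near F, `|complex.Im l - complex.Im (x : scal)| < r.
  by have /cvgrPdist_lt/(_ _ r0) := cI.
apply: filterS2 HR HI => x xR xI; rewrite -re.
have -> : l - x = (complex.Re l - complex.Re x)%:C +
    'i * (complex.Im l - complex.Im x)%:C.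
  by case: (x) => a b; simpc.
apply: le_lt_trans (ler_normD _ _) _; rewrite normrM normCi mul1r.
have nC (z : R) : `|z%:C| = `|z|%:C by rewrite normc_def/= expr0n addr0 sqrtr_sqr.
by rewrite !nC [ltRHS]rmorphD ltrD// ltcR.
Qed.

HB.instance Definition _ := Uniform_isComplete.Build scal C_complete.

Lemma cdot_norm (x : scal) : cdot x x = `|x| ^+ 2.
Proof. by rewrite [RHS]normCK. Qed.

Definition Cc : hilbert R := Hilbert cdot_norm.

End Cc.

Definition ell2 (R : realType) (n : nat) : hilbert R := hpow (Cc R) n.

Record bop (R : realType) (H : hilbert R) := Bop {
  bop_fun :> H -> H;
  bop_linear : linear bop_fun;
  bop_bounded : exists M : R, forall x, `|bop_fun x| <= M%:C * `|x| }.

Section bop_algebra.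
Context (R : realType) (H : hilbert R).
Implicit Types S T : bop H.

HB.instance Definition _ T := GRing.isLinear.Build R[i] H H _ T (bop_linear T).

Lemma bopP S T : (forall x, S x = T x) -> S = T.
Proof.
case: S T => [S lS bS] [T lT bT] /= ST.
have {}ST : S = T by exact/funext.
by subst T; congr Bop; exact: Prop_irrelevance.
Qed.

Lemma bop_boundedW T : exists2 M : R, 0 <= M & forall x, `|T x| <= M%:C * `|x|.
Proof.
have [M TM] := bop_bounded T; exists `|M| => // x.
apply: le_trans (TM x) _; apply: ler_wpM2r => //.
by rewrite lecR ler_norm.
Qed.

Lemma zero_linear : linear (fun _ : H => 0 : H).
Proof. by move=> a x y; rewrite scaler0 addr0. Qed.

Lemma zero_bounded : exists M : R, forall x : H, `|0 : H| <= M%:C * `|x|.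
Proof. by exists 0 => x; rewrite normr0 mul0r. Qed.

Definition bop_zero := Bop zero_linear zero_bounded.

Lemma one_linear : linear (fun x : H => x).
Proof. by []. Qed.

Lemma one_bounded : exists M : R, forall x : H, `|x| <= M%:C * `|x|.
Proof. by exists 1 => x; rewrite mul1r. Qed.

Definition bop_one := Bop one_linear one_bounded.

Lemma add_linear S T : linear (fun x => S x + T x).
Proof. by move=> a x y; rewrite !linearP scalerDr addrACA. Qed.

Lemma add_bounded S T : exists M : R, forall x, `|S x + T x| <= M%:C * `|x|.
Proof.
have [M SM] := bop_bounded S; have [N TN] := bop_bounded T.
exists (M + N) => x; rewrite rmorphD mulrDl.
exact: le_trans (ler_normD _ _) (lerD (SM x) (TN x)).
Qed.

Definition bop_add S T := Bop (add_linear S T) (add_bounded S T).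

Lemma scale_linear (a : R[i]) T : linear (fun x => a *: T x).
Proof. by move=> b x y; rewrite linearP scalerDr !scalerA mulrC. Qed.

Lemma scale_bounded (a : R[i]) T :
  exists M : R, forall x, `|a *: T x| <= M%:C * `|x|.
Proof.
have [M TM] := bop_bounded T; have ra := RRe_real (normr_real a).
exists (complex.Re `|a| * M) => x.
by rewrite normrZ rmorphM/= ra -mulrA ler_wpM2l.
Qed.

Definition bop_scale a T := Bop (scale_linear a T) (scale_bounded a T).

Lemma mul_linear S T : linear (fun x => S (T x)).
Proof. by move=> a x y; rewrite !linearP. Qed.

Lemma mul_bounded S T : exists M : R, forall x, `|S (T x)| <= M%:C * `|x|.
Proof.
have [M M0 SM] := bop_boundedW S; have [N TN] := bop_bounded T.
exists (M * N) => x; rewrite rmorphM -mulrA.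
by apply: le_trans (SM _) _; rewrite ler_wpM2l// lecR.
Qed.

Definition bop_mul S T := Bop (mul_linear S T) (mul_bounded S T).

HB.instance Definition _ := gen_eqMixin (bop H).
HB.instance Definition _ := gen_choiceMixin (bop H).

Lemma bop_addA : associative bop_add.
Proof. by move=> S T V; apply: bopP => x /=; rewrite addrA. Qed.

Lemma bop_addC : commutative bop_add.
Proof. by move=> S T; apply: bopP => x /=; rewrite addrC. Qed.

Lemma bop_add0 : left_id bop_zero bop_add.
Proof. by move=> T; apply: bopP => x /=; rewrite add0r. Qed.

Lemma bop_addN : left_inverse bop_zero (bop_scale (-1)) bop_add.
Proof. by move=> T; apply: bopP => x /=; rewrite scaleN1r addNr. Qed.

HB.instance Definition _ :=
  GRing.isZmodule.Build (bop H) bop_addA bop_addC bop_add0 bop_addN.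

Lemma bop_scaleA a b T : bop_scale a (bop_scale b T) = bop_scale (a * b) T.
Proof. by apply: bopP => x /=; rewrite scalerA. Qed.

Lemma bop_scale1 : left_id 1 bop_scale.
Proof. by move=> T; apply: bopP => x /=; rewrite scale1r. Qed.

Lemma bop_scaleDr : right_distributive bop_scale +%R.
Proof. by move=> a S T; apply: bopP => x /=; rewrite scalerDr. Qed.

Lemma bop_scaleDl T : {morph bop_scale^~ T : a b / a + b}.
Proof. by move=> a b; apply: bopP => x /=; rewrite scalerDl. Qed.

HB.instance Definition _ := GRing.Zmodule_isLmodule.Build R[i] (bop H)
  bop_scaleA bop_scale1 bop_scaleDr bop_scaleDl.

Lemma bop_mulA : associative bop_mul.
Proof. by move=> S T V; apply: bopP. Qed.

Lemma bop_mul1 : left_id bop_one bop_mul.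
Proof. by move=> T; apply: bopP. Qed.

Lemma bop_mulr1 : right_id bop_one bop_mul.
Proof. by move=> T; apply: bopP. Qed.

Lemma bop_mulDl : left_distributive bop_mul +%R.
Proof. by move=> S T V; apply: bopP. Qed.

Lemma bop_mulDr : right_distributive bop_mul +%R.
Proof. by move=> S T V; apply: bopP => x /=; rewrite linearD. Qed.

HB.instance Definition _ := GRing.Zmodule_isPzRing.Build (bop H)
  bop_mulA bop_mul1 bop_mulr1 bop_mulDl bop_mulDr.

Definition opnorm T : R := sup [set complex.Re `|T x| | x in [set x | `|x| <= 1]].

Definition adjoint S T := forall x y, hdot H (S x) y = hdot H x (T y).

Definition positive_op T := forall x, 0 <= hdot H (T x) x.

End bop_algebra.

(* the identification of M_n(B(H)) with B(H^n) *)
Section opmx.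
Context (R : realType) (H : hilbert R) (n : nat) (A : 'M[bop H]_n).

Definition opmx_fun (v : hpow H n) : hpow H n :=
  [ffun i => \sum_j A i j ((v : hpow_sort H n) j)].

Lemma opmx_linear : linear opmx_fun.
Proof.
move=> a x y; apply/ffunP => i; rewrite !ffunE scaler_sumr -big_split.
by apply: eq_bigr => j _; rewrite !ffunE linearP.
Qed.

Lemma opmx_bounded : exists M : R, forall v, `|opmx_fun v| <= M%:C * `|v|.
Proof.
pose M i j := projT1 (cid2 (bop_boundedW (A i j))).
have M0 i j : 0 <= M i j by rewrite /M; case: cid2.
have AM i j x : `|A i j x| <= (M i j)%:C * `|x| by rewrite /M; case: cid2.
exists (\sum_i \sum_j M i j) => v; apply: le_trans (hpow_norm_sum _) _.
rewrite rmorph_sum mulr_suml; apply: ler_sum => i _.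
rewrite ffunE rmorph_sum mulr_suml; apply: le_trans (ler_norm_sum _ _ _) _.
apply: ler_sum => j _; apply: le_trans (AM _ _ _) _.
by rewrite ler_wpM2l ?lecR//; exact: hpow_norm_proj.
Qed.

Definition opmx : bop (hpow H n) := Bop opmx_linear opmx_bounded.

End opmx.

(* M_n(C) acting on ell2(n), through B(C) = C *)
Definition mxop (R : realType) (n : nat) (A : 'M[R[i]]_n) : bop (ell2 R n) :=
  opmx (map_mx (fun a => a *: (1 : bop (Cc R))) A).

(* Maps defined on a set X of operators are represented by total functions,
   whose values outside X are irrelevant. *)
Section maps.
Context (R : realType) (H K : hilbert R).
Implicit Types (X A : set (bop H)) (phi : bop H -> bop K).

Definition linear_on X phi := forall (a : R[i]) S T,
  X S -> X T -> phi (a *: S + T) = a *: phi S + phi T.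

Definition multiplicative_on X phi := forall S T,
  X S -> X T -> phi (S * T) = phi S * phi T.

Definition mx_in n X (M : 'M[bop H]_n) := forall i j, X (M i j).

Definition completely_positive_on X phi := forall n (M : 'M[bop H]_n),
  mx_in X M -> positive_op (opmx M) -> positive_op (opmx (map_mx phi M)).

Definition completely_contractive_on X phi := forall n (M : 'M[bop H]_n),
  mx_in X M -> opnorm (opmx (map_mx phi M)) <= opnorm (opmx M).

Definition completely_isometric_on X phi := forall n (M : 'M[bop H]_n),
  mx_in X M -> opnorm (opmx (map_mx phi M)) = opnorm (opmx M).

Definition complete_order_embedding_on X phi := forall n (M : 'M[bop H]_n),
  mx_in X M -> (positive_op (opmx (map_mx phi M)) <-> positive_op (opmx M)).

Definition ucp A phi :=
  [/\ linear_on A phi, phi 1 = 1 & completely_positive_on A phi].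

Definition ucc A phi :=
  [/\ linear_on A phi, phi 1 = 1 & completely_contractive_on A phi].

Definition unital_star_hom A phi :=
  [/\ linear_on A phi, phi 1 = 1, multiplicative_on A phi &
      forall S T, A S -> A T -> adjoint S T -> adjoint (phi S) (phi T)].

(* embeddings of operator systems *)
Definition system_embedding X phi :=
  [/\ linear_on X phi, phi 1 = 1 & complete_order_embedding_on X phi].

(* embeddings of unital operator algebras *)
Definition algebra_embedding X phi :=
  [/\ linear_on X phi, phi 1 = 1, multiplicative_on X phi &
      completely_isometric_on X phi].

End maps.

Section subalgebras.
Context (R : realType) (H : hilbert R).

Definition norm_closed (A : set (bop H)) := forall T,
  (forall e : R, 0 < e -> exists2 S, A S & opnorm (T - S) < e) -> A T.

Definition unital_cstar_subalgebra (A : set (bop H)) :=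
  [/\ A 1,
      forall (a : R[i]) S T, A S -> A T -> A (a *: S + T),
      forall S T, A S -> A T -> A (S * T),
      forall S T, A S -> adjoint S T -> A T &
      norm_closed A].

Definition cstar_gen (X : set (bop H)) : set (bop H) :=
  \bigcap_(A in [set A | unital_cstar_subalgebra A /\ X `<=` A]) A.

End subalgebras.

(* (A, iota) is a C*-envelope of X, in the category whose embeddings are given
   by emb: iota embeds X in the C*-algebra A that it generates, and every other
   embedding j of X has a *-homomorphism from C*(j X) onto A sending j to iota.
   Every C*-algebra being faithfully represented, it is enough to consider
   embeddings in B(K) for Hilbert spaces K. *)
Definition is_cstar_envelope (R : realType)
    (emb : forall H K : hilbert R, set (bop H) -> (bop H -> bop K) -> Prop)
    (H E : hilbert R) (X : set (bop H)) (iota : bop H -> bop E)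
    (A : set (bop E)) : Prop :=
  [/\ emb H E X iota,
      cstar_gen (iota @` X) = A &
      forall (K : hilbert R) (j : bop H -> bop K), emb H K X j ->
        exists pi : bop K -> bop E,
          [/\ unital_star_hom (cstar_gen (j @` X)) pi,
              pi @` cstar_gen (j @` X) = A &
              forall x, X x -> pi (j x) = iota x]].

Definition system_hyperrigid (R : realType) (H : hilbert R)
    (X A : set (bop H)) : Prop :=
  cstar_gen X = A /\
  forall (K : hilbert R) (pi : bop H -> bop K), unital_star_hom A pi ->
    forall phi : bop H -> bop K, ucp A phi ->
      (forall x, X x -> phi x = pi x) -> forall a, A a -> phi a = pi a.

Definition algebra_hyperrigid (R : realType) (H : hilbert R)
    (X A : set (bop H)) : Prop :=
  cstar_gen X = A /\
  forall (K : hilbert R) (pi : bop H -> bop K), unital_star_hom A pi ->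
    forall phi : bop H -> bop K, ucc A phi ->
      (forall x, X x -> phi x = pi x) -> forall a, A a -> phi a = pi a.

Definition mx2 (T : Type) (a b c d : T) : 'M[T]_2 :=
  \matrix_(i, j) if i == 0 then (if j == 0 then a else b)
                           else (if j == 0 then c else d).

Section concrete.
Context (R : realType).

(* M_n(X), as operators on H^n *)
Definition mx_over (H : hilbert R) (n : nat) (X : set (bop H)) :
    set (bop (hpow H n)) :=
  @opmx R H n @` [set M | mx_in X M].

Definition calU (H : hilbert R) (X : set (bop H)) : set (bop (hpow H 2)) :=
  [set T | exists (l : R[i]) (x : bop H),
    X x /\ T = opmx (mx2 (l *: (1 : bop H)) x 0 (l *: (1 : bop H)))].

Definition calB : set 'M[R[i]]_2 := [set A | exists a b : R[i], A = mx2 a b b a].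

Definition dsum3 (A1 A2 A3 : 'M[R[i]]_2) : 'M[R[i]]_6 :=
  block_mx A1 0 0 (block_mx A2 0 0 A3).

Definition sumB : set (bop (ell2 R 6)) :=
  [set T | exists A1 A2 A3,
    [/\ calB A1, calB A2, calB A3 & T = mxop (dsum3 A1 A2 A3)]].

Definition W32 : set (bop (ell2 R 6)) :=
  [set T | exists a b c d : R[i],
    T = mxop (dsum3 (mx2 a b b a) (mx2 a c c a) (mx2 a d d a))].

End concrete.

Arguments mx_over {R H} n X.
Arguments sumB R : clear implicits.
Arguments W32 R : clear implicits.

(* Main.v *)
Require Import Defs.
From HB Require Import structures.
From mathcomp Require Import all_boot all_order all_algebra.
From mathcomp Require Import complex sesquilinear.
From mathcomp Require Import all_classical all_reals all_analysis.
From mathcomp Require Import ring lra.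

(**
Each block [a b; b a] has the eigenvalues a + b and a - b, with eigenvectors that do not
depend on a and b. Diagonalising, the direct sum of three copies of B becomes C^6, its six
coordinates being the vertices +e_k and -e_k of an octahedron, and W32 becomes the space of
affine functions on the octahedron, restricted to its vertices. Every vertex p is exposed:
the affine function gap p vanishes at p and is at least 1 at the other vertices. The theorem
rests on this. Likewise M_2 over the direct sum is a sum of six copies of M_2, in which U(W)
consists of the scalars plus the elements f e_01 with f affine. Both algebras are handled as
algebras of block operators on an orthonormal basis ([blk], [blocks_cstar]), and both are
generated algebraically ([W32_generates], [calU_generates]), since a point mass is a
quadratic polynomial in one coordinate function.

Hyperrigidity ([sumB_hyperrigid], [calU_hyperrigid]). Let phi agree with the representation
pi on W, and let v be in the range of the projection of pi at the vertex p. The images under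
phi of the point masses are positive and sum to 1, and their differences along the diagonals
of the octahedron are known. Evaluating at v, a sum of nonnegative numbers with sum zero
appears, and all the images other than the one at p vanish at v. For U(W), a unital complete
contraction is completely positive ([ucc_completely_positive]), and the same argument is
applied to the positive 2 x 2 matrices formed by the images of the matrix units of each block,
evaluated at (v, - w), where v is the image of w under e_01.

Envelopes ([sumB_envelope], [calU_envelope]). Given an embedding j, one has to find a star
homomorphism from the C*-algebra generated by the image of j that inverts j. It is assembled
from six limit representations, one for each vertex ([blocks_quotient]), and each of these is
obtained from unit vectors w running along a filter. For the system, w is taken in the
approximate kernel of j (gap p). If g is affine and vanishes at p then |g|^2 is at most a
multiple of gap p; this is a positivity statement about a 2 x 2 matrix over W, which j
preserves, and it follows that j g w tends to 0 ([embedding_schwarz], [system_act]). So w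
becomes in the limit a joint eigenvector with the eigenvalue f p for every f. For the
algebra, w is taken where Y = j ((2 - gap p) e_01) almost attains its norm 2, and the norms of
columns and rows with entries in the corner e_01 play the role of positivity ([J_column],
[J_row]); the vectors Y w / 2 and w then carry in the limit the representation of M_2 at p.
The matrices of limits form a star homomorphism because the operators that are asymptotically
reduced by such vectors form a C*-algebra ([reduced_cstar]). Adjoints of operators, which
enter there, exist by the Riesz representation theorem ([riesz]).
*)

Set Implicit Arguments.
Unset Strict Implicit.
Unset Printing Implicit Defensive.

Import Order.TTheory GRing.Theory Num.Theory.
Import numFieldNormedType.Exports.

Local Open Scope classical_set_scope.
Local Open Scope ring_scope.

Local Notation "[< x , y >]" := (hdot _ x y) (at level 0, format "[< x ,  y >]").
Local Notation "r %:C" := (real_complex _ r) (format "r %:C").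

(** * Inner products, positive operators and operator norms *)

Section inner_product.
Context (R : realType) (H : hilbert R).
Implicit Types (x y z : H) (a b : R[i]).

Lemma dotC x y : [<x, y>] = [<y, x>]^*.
Proof. by rewrite (hermC (hdot H)) expr0 mul1r. Qed.

Lemma dotDl x y z : [<x + y, z>] = [<x, z>] + [<y, z>].
Proof. exact: linearDl. Qed.

Lemma dotDr x y z : [<z, x + y>] = [<z, x>] + [<z, y>].
Proof. exact: linearDr. Qed.

Lemma dotBl x y z : [<x - y, z>] = [<x, z>] - [<y, z>].
Proof. exact: linearBl. Qed.

Lemma dotBr x y z : [<z, x - y>] = [<z, x>] - [<z, y>].
Proof. exact: linearBr. Qed.

Lemma dotNl x z : [<- x, z>] = - [<x, z>].
Proof. exact: linearNl. Qed.

Lemma dotNr x z : [<z, - x>] = - [<z, x>].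
Proof. exact: linearNr. Qed.

Lemma dot0l x : [<0, x>] = 0.
Proof. exact: linear0l. Qed.

Lemma dot0r x : [<x, 0>] = 0.
Proof. exact: linear0r. Qed.

Lemma dotZl a x y : [<a *: x, y>] = a * [<x, y>].
Proof. by rewrite linearZl_LR. Qed.

Lemma dotZr a x y : [<x, a *: y>] = a^* * [<x, y>].
Proof. by rewrite linearZr_LR. Qed.

Lemma dot_suml (I : Type) (r : seq I) (P : pred I) (f : I -> H) y :
  [<\sum_(i <- r | P i) f i, y>] = \sum_(i <- r | P i) [<f i, y>].
Proof. by apply: (big_morph (fun x => [<x, y>])) => [u v|]; [exact: dotDl|exact: dot0l]. Qed.

Lemma dot_sumr (I : Type) (r : seq I) (P : pred I) (f : I -> H) y :
  [<y, \sum_(i <- r | P i) f i>] = \sum_(i <- r | P i) [<y, f i>].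
Proof. by apply: (big_morph (fun x => [<y, x>])) => [u v|]; [exact: dotDr|exact: dot0r]. Qed.

Lemma dotxx x : [<x, x>] = `|x| ^+ 2.
Proof. exact: hdot_norm. Qed.

Lemma dotxx_ge0 x : 0 <= [<x, x>].
Proof. by rewrite dotxx exprn_ge0. Qed.

Lemma dotxx_eq0 x : ([<x, x>] == 0) = (x == 0).
Proof. by rewrite dotxx expf_eq0/= normr_eq0. Qed.

Lemma dot_inj x y : (forall z, [<x, z>] = [<y, z>]) -> x = y.
Proof.
move=> xy; apply/eqP; rewrite -subr_eq0 -dotxx_eq0 dotBl xy subrr//.
Qed.

Lemma cauchy_schwarz x y : `|[<x, y>]| <= `|x| * `|y|.
Proof.
rewrite -(ler_pXn2r (n := 2))// ?nnegrE ?mulr_ge0// exprMn -!dotxx.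
exact: dot_cs.
Qed.

Lemma norm_le_sq x y a : 0 <= a -> (`|x| <= a * `|y|) = ([<x, x>] <= a ^+ 2 * [<y, y>]).
Proof.
by move=> a0; rewrite !dotxx -exprMn ler_pXn2r ?nnegrE ?mulr_ge0.
Qed.

(** By polarisation: the real numbers f (x + y) (x + y) and f (x + i y) (x + i y)
    determine the imaginary and real parts of f y x - f x y. *)
Lemma form_hermitian (f : H -> H -> R[i]) :
    (forall a x y z, f (a *: x + y) z = a * f x z + f y z) ->
    (forall a x y z, f z (a *: x + y) = a^* * f z x + f z y) ->
    (forall x, f x x \is Num.real) -> forall x y, f y x = (f x y)^*.
Proof.
move=> fl fr fR x y.
have h a : a^* * f x y + a * f y x \is Num.real.
  have -> : a^* * f x y + a * f y x =
      f (a *: y + x) (a *: y + x) - `|a| ^+ 2 * f y y - f x x.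
    by rewrite fl !fr normCK; ring.
  by rewrite !rpredB// rpredM ?rpredX ?normr_real.
move: (h 1) (h 'i); rewrite !CrealE !rmorphD !rmorphM/= !conjCK conjCi rmorph1.
rewrite !mul1r => /eqP h1 /eqP hi.
apply/eqP; rewrite -subr_eq0.
have h2 : 2 * 'i * (f y x - (f x y)^*) = 0 :> R[i].
  move/eqP: h1; rewrite -subr_eq0 => /eqP h1; move/eqP: hi; rewrite -subr_eq0 => /eqP hi.
  move: h1 hi; set p := f y x; set q := f x y => h1 hi.
  transitivity (- 'i * (q^* + p^* - (q + p)) - ('i * q^* + - 'i * p^* - (- 'i * q + 'i * p))).
    by ring.
  by rewrite h1 hi mulr0 subr0.
by move/eqP: h2; rewrite !mulf_eq0 (negbTE (neq0Ci _)) pnatr_eq0.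
Qed.

(** The form may be degenerate, so that no inner product is at hand: it is used for
    the forms attached to positive operators. *)
Lemma form_cauchy_schwarz (f : H -> H -> R[i]) :
    (forall a x y z, f (a *: x + y) z = a * f x z + f y z) ->
    (forall a x y z, f z (a *: x + y) = a^* * f z x + f z y) ->
    (forall x, 0 <= f x x) -> forall x y, `|f x y| ^+ 2 <= f x x * f y y.
Proof.
move=> fl fr f0 x y.
have fC := form_hermitian fl fr (fun x => ger0_real (f0 x)).
pose q := `|f x y| ^+ 2.
have q0 : 0 <= q by exact: exprn_ge0.
have key t : t \is Num.real -> 0 <= f x x - 2 * t * q + t ^+ 2 * q * f y y.
  move=> /CrealP tR; have := f0 (- (t * f x y) *: y + x).
  rewrite fl !fr rmorphN rmorphM/= tR (fC x y) /q normCK.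
  by congr (_ <= _); ring.
have [fy0|fy0] := eqVneq (f y y) 0; last first.
  have fy : 0 < f y y by rewrite lt_def fy0 f0.
  have := key (f y y)^-1; rewrite rpredV ger0_real// => /(_ isT).
  have -> : f x x - 2 * (f y y)^-1 * q + (f y y)^-1 ^+ 2 * q * f y y =
      (f x x * f y y - q) / f y y by field.
  by rewrite pmulr_lge0 ?invr_gt0// subr_ge0.
(* when f y y = 0 the parabola is a line, and a large t makes it negative *)
rewrite fy0 mulr0 -/q; rewrite real_leNgt ?ger0_real//; apply/negP => q1.
have := key ((f x x + 1) / (2 * q)); rewrite fy0 mulr0 addr0 ger0_real; last first.
  by rewrite divr_ge0 ?addr_ge0// mulr_ge0// ltW.
move=> /(_ isT); have -> : f x x - 2 * ((f x x + 1) / (2 * q)) * q = - 1.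
  by field; rewrite gt_eqF.
by rewrite oppr_ge0 ler10.
Qed.

End inner_product.

Section operators.
Context (R : realType) (H : hilbert R).
Implicit Types (x y z : H) (a b : R[i]) (S T : bop H).

Lemma bop_sumE (I : Type) (r : seq I) (P : pred I) (F : I -> bop H) x :
  (\sum_(i <- r | P i) F i) x = \sum_(i <- r | P i) F i x.
Proof. exact: (big_morph (fun T : bop H => T x)). Qed.

Lemma bopN T x : (- T) x = - T x.
Proof. by rewrite /GRing.opp/= scaleN1r. Qed.

Lemma bopB S T x : (S - T) x = S x - T x.
Proof. by rewrite -bopN. Qed.

Lemma normcR (V : normedZmodType R[i]) (a : V) : (complex.Re `|a|)%:C = `|a|.
Proof. exact: RRe_real (normr_real a). Qed.

Lemma opnorm_has_sup T : has_sup [set complex.Re `|T x| | x in [set x | `|x| <= 1]].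
Proof.
have [M M0 TM] := bop_boundedW T.
split; first by exists (complex.Re `|T 0|), 0 => //=; rewrite normr0.
exists M => _ [x /= x1 <-]; rewrite -lecR normcR.
by rewrite (le_trans (TM x))// -[leRHS]mulr1 ler_wpM2l ?lecR.
Qed.

Lemma opnorm_ge0 T : 0 <= opnorm T.
Proof.
apply: (@le_trans _ _ (complex.Re `|T 0|)); first by rewrite linear0 normr0.
by apply: (ub_le_sup (opnorm_has_sup T).2); exists 0 => //=; rewrite normr0.
Qed.

Lemma opnorm_bound T x : `|T x| <= (opnorm T)%:C * `|x|.
Proof.
have [->|x0] := eqVneq x 0; first by rewrite linear0 !normr0 mulr0.
have nx : 0 < `|x| by rewrite normr_gt0.
rewrite -ler_pdivrMr//.
have -> : `|T x| / `|x| = `|T (`|x|^-1 *: x)|.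
  by rewrite linearZ normrZ normfV normr_id mulrC.
rewrite -normcR lecR; apply: (ub_le_sup (opnorm_has_sup T).2).
by exists (`|x|^-1 *: x) => //=; rewrite normrZ normfV normr_id mulVf ?gt_eqF.
Qed.

Lemma opnorm_le T (c : R) : 0 <= c -> (forall x, `|T x| <= c%:C * `|x|) ->
  opnorm T <= c.
Proof.
move=> c0 Tc; apply: (ge_sup (opnorm_has_sup T).1) => _ [x /= x1 <-].
rewrite -lecR normcR (le_trans (Tc x))// -[leRHS]mulr1 ler_wpM2l// lecR//.
Qed.

Lemma pos_adj T : positive_op T -> adjoint T T.
Proof.
move=> T0 x y; have := @form_hermitian R H (fun x y => [<T x, y>]).
move=> /(_ _ _ _ y x) /= ->.
- by rewrite -dotC.
- by move=> a u v w; rewrite linearP dotDl dotZl.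
- by move=> a u v w; rewrite dotDr dotZr.
- by move=> u; exact: ger0_real (T0 u).
Qed.

Lemma pos_cauchy_schwarz T x y : positive_op T ->
  `|[<T x, y>]| ^+ 2 <= [<T x, x>] * [<T y, y>].
Proof.
move=> T0; apply: (form_cauchy_schwarz (f := fun x y => [<T x, y>])).
- by move=> a u v w; rewrite linearP dotDl dotZl.
- by move=> a u v w; rewrite dotDr dotZr.
- exact: T0.
Qed.

Lemma pos_dot_eq0 T x : positive_op T -> [<T x, x>] = 0 -> T x = 0.
Proof.
move=> T0 Tx; have := pos_cauchy_schwarz x (T x) T0; rewrite Tx mul0r.
rewrite real_exprn_even_le0//= normr_eq0 dotxx_eq0 => /eqP//.
Qed.

Lemma adjoint_sym S T : adjoint S T -> adjoint T S.
Proof. by move=> ST x y; rewrite dotC -ST -dotC. Qed.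

Lemma adjoint_uniq S T T' : adjoint S T -> adjoint S T' -> T = T'.
Proof.
move=> ST ST'; apply: bopP => x; apply: dot_inj => z.
by rewrite dotC [RHS]dotC -ST -ST'.
Qed.

Lemma adjoint_lin a S T S' T' : adjoint S S' -> adjoint T T' ->
  adjoint (a *: S + T) (a^* *: S' + T').
Proof.
move=> SS TT x y; rewrite dotDl dotZl dotDr dotZr SS TT conjCK//.
Qed.

Lemma adjoint_mul S T S' T' : adjoint S S' -> adjoint T T' ->
  adjoint (S * T) (T' * S').
Proof. by move=> SS TT x y; rewrite SS TT. Qed.

Lemma adjoint_bound S T (c : R[i]) : 0 <= c -> adjoint S T ->
  (forall x, `|S x| <= c * `|x|) -> forall x, `|T x| <= c * `|x|.
Proof.
move=> c0 ST Sc x; have [->|Tx] := eqVneq (T x) 0.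
  by rewrite normr0 mulr_ge0.
rewrite -(ler_pM2r (x := `|T x|)) ?normr_gt0// -expr2 -dotxx -ST.
apply: le_trans (real_ler_norm _) _.
  by rewrite ST; exact: ger0_real (dotxx_ge0 _).
apply: le_trans (cauchy_schwarz _ _) _.
by rewrite mulrAC ler_wpM2r.
Qed.

End operators.

(** * Existence of adjoints *)

Section riesz.
Context (R : realType) (H : hilbert R).
Implicit Types (x y z h : H) (a b : R[i]) (S T : bop H).

(** The functional f is represented by the minimiser of J x = |x|^2 - 2 Re f x. Points
    where J is nearly minimal nearly satisfy the Euler equation f h = <h, x>; hence they
    are close to one another, and they converge by completeness. *)
Lemma riesz (f : H -> R[i]) (M : R[i]) : 0 <= M ->
    (forall a x y, f (a *: x + y) = a * f x + f y) ->
    (forall x, `|f x| <= M * `|x|) ->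
  exists y, forall x, f x = [<x, y>].
Proof.
move=> M0 fl fM.
pose J x := [<x, x>] - (f x + (f x)^*).
have JR x : (complex.Re (J x))%:C = J x.
  apply: RRe_real; rewrite rpredB//; first exact: ger0_real (dotxx_ge0 _).
  by rewrite CrealE rmorphD/= conjCK addrC.
have Jlb x : - M ^+ 2 <= J x.
  rewrite /J dotxx; apply: (@le_trans _ _ (`|x| ^+ 2 - (M * `|x| + M * `|x|))).
    rewrite -subr_ge0.
    have -> : `|x| ^+ 2 - (M * `|x| + M * `|x|) - - M ^+ 2 = (`|x| - M) ^+ 2 by ring.
    by apply: real_exprn_even_ge0; rewrite ?rpredB ?ger0_real.
  rewrite lerD2l lerN2; apply: le_trans (real_ler_norm _) _.
    by rewrite CrealE rmorphD/= conjCK addrC.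
  by apply: le_trans (ler_normD _ _) _; rewrite norm_conjC lerD.
pose rJ := [set complex.Re (J x) | x in setT].
have rJ_inf : has_inf rJ.
  split; first by exists (complex.Re (J 0)), 0.
  exists (complex.Re (- M ^+ 2)) => _ [x _ <-].
  by rewrite -lecR JR RRe_real// rpredN rpredX// ger0_real.
pose m := inf rJ.
have mJ x : m%:C <= J x.
  by rewrite -JR lecR; apply: (ge_inf rJ_inf.2); exists x.
pose V (e : R) := [set x | J x <= (m + e ^+ 2)%:C].
have V0 e : 0 < e -> V e !=set0.
  move=> e0; have e20 : 0 < e ^+ 2 by rewrite exprn_gt0.
  have [_ [x _ <-] xm] := inf_adherent e20 rJ_inf.
  by exists x; rewrite /V /= -JR lecR ltW.
(* compare J x with its value at the minimum of J on the line through x directed by h *)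
have almost x e h : 0 < e -> V e x -> `|f h - [<h, x>]| <= e%:C * `|h|.
  move=> e0; rewrite /V /= => xe; set g := f h - [<h, x>].
  have [h0|h0] := eqVneq h 0.
    have f0 : f 0 = 0.
      by have := fM 0; rewrite normr0 mulr0 normr_le0 => /eqP.
    by rewrite /g h0 f0 dot0l subrr !normr0 mulr0.
  have N0 : 0 < `|h| ^+ 2 by rewrite exprn_gt0 ?normr_gt0.
  have eC : 0 <= e%:C by rewrite lecR ltW.
  rewrite -(ler_pXn2r (n := 2))// ?nnegrE ?mulr_ge0//.
  rewrite exprMn -ler_pdivrMr//.
  have E : J (g^* / `|h| ^+ 2 *: h + x) = J x - `|g| ^+ 2 / `|h| ^+ 2; last first.
    have := mJ (g^* / `|h| ^+ 2 *: h + x); rewrite E lerBrDr => mq.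
    rewrite -(lerD2l m%:C) (le_trans mq)// (le_trans xe)//.
    by rewrite rmorphD rmorphXn.
  rewrite /J fl dotDl !dotDr !dotZl !dotZr dotxx.
  rewrite (dotC x h).
  have -> : f h = g + [<h, x>] by rewrite /g subrK.
  move: g => g.
  have nR : (`|h|^-1)^* = `|h|^-1 by apply/CrealP; rewrite rpredV normr_real.
  rewrite !(rmorphD, rmorphM, rmorphN)/= !conjCK fmorphV rmorphXn/= (CrealP (normr_real _)).
  by rewrite normCK; field; rewrite normr_eq0.
have VV x x' e : 0 < e -> V e x -> V e x' -> `|x - x'| <= (e + e)%:C.
  move=> e0 xe x'e; have [->|h0] := eqVneq (x - x') 0.
    by rewrite normr0 lecR addr_ge0// ltW.
  rewrite -(ler_pM2r (x := `|x - x'|)) ?normr_gt0// -expr2 -dotxx dotBr.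
  have -> : [<x - x', x>] - [<x - x', x'>] =
    (f (x - x') - [<x - x', x'>]) - (f (x - x') - [<x - x', x>]) by ring.
  apply: le_trans (real_ler_norm _) _.
    suff -> : f (x - x') - [<x - x', x'>] - (f (x - x') - [<x - x', x>]) =
      [<x - x', x - x'>] by exact: ger0_real (dotxx_ge0 _).
    by rewrite dotBr; ring.
  apply: le_trans (ler_normB _ _) _.
  by rewrite rmorphD mulrDl lerD// almost.
pose F : set_system H := filter_from [set e : R | 0 < e] V.
have FF : ProperFilter F.
  apply: filter_from_proper; last exact: V0.
  apply: filter_from_filter; first by exists 1; exact: ltr01.
  move=> e e' /= e0 e'0; exists (Num.min e e'); first by rewrite /= lt_min e0.
  have m0 : 0 <= Num.min e e' by rewrite le_min !ltW.
  move=> x; rewrite /V /= => xe; split; apply: (le_trans xe); rewrite lecR lerD2l.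
    by rewrite ler_pXn2r// ?nnegrE ?ge_min ?lexx// ltW.
  by rewrite ler_pXn2r// ?nnegrE ?ge_min ?lexx ?orbT// ltW.
have Fcvg : cvg F.
  apply: cauchy_cvg; apply: cauchy_exP => e e0.
  have e4 : 0 < complex.Re e / 4 by rewrite divr_gt0//; move: e0; rewrite ltcE => /andP[].
  have [x xV] := V0 _ e4; exists x; exists (complex.Re e / 4) => // x' x'V.
  rewrite -ball_normE /=; apply: le_lt_trans (VV _ _ _ e4 xV x'V) _.
  rewrite -{3}(RRe_real (gtr0_real e0)) ltcR.
  have : 0 < complex.Re e by move: e0; rewrite ltcE => /andP[].
  by move: (complex.Re e) => r r0; lra.
have /cvg_ex[y Fy] := Fcvg.
exists y => h; apply/eqP; rewrite -subr_eq0 -normr_le0; apply/ler_addgt0Pr => e e0.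
rewrite add0r; pose d : R[i] := e / (2 * (`|h| + 1)).
have d0 : 0 < d by rewrite divr_gt0// mulr_gt0// ltr_wpDl.
have dR : (complex.Re d)%:C = d by rewrite RRe_real// gtr0_real.
have rd0 : 0 < complex.Re d by rewrite -ltcR dR.
have Vd : F (V (complex.Re d)) by exists (complex.Re d).
have /cvgrPdist_le/(_ _ d0) yd : id @ F --> y by [].
have [x [xV xy]] := filter_ex (filterI Vd yd).
have -> : f h - [<h, y>] = f h - [<h, x>] - [<h, y - x>] by rewrite dotBr; ring.
apply: le_trans (ler_normB _ _) _.
apply: (@le_trans _ _ (d * `|h| + d * `|h|)).
  apply: lerD; first by rewrite -{1}dR; exact: almost.
  by apply: le_trans (cauchy_schwarz _ _) _; rewrite mulrC ler_wpM2r.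
rewrite -mulrDl -mulr2n -[_ *+ 2]mulr_natl /d mulrCA mulrAC ?mulrA.
rewrite ler_pdivrMr ?mulr_gt0 ?ltr_wpDl//.
by rewrite -subr_ge0 (_ : _ - _ = 2 * e) ?mulr_ge0 ?ltW//; ring.
Qed.

Lemma adjoint_exists T : exists T', adjoint T T'.
Proof.
have [M M0 TM] := bop_boundedW T.
have /choice[g gP] : forall y, exists z, forall x, [<T x, y>] = [<x, z>].
  move=> y; apply: (@riesz _ (M%:C * `|y|)).
  - by rewrite mulr_ge0 ?lecR.
  - by move=> a u v; rewrite linearP dotDl dotZl.
  - move=> x; apply: le_trans (cauchy_schwarz _ _) _.
    by rewrite mulrAC ler_wpM2r.
have glin : linear g.
  move=> a u v; apply: dot_inj => x; rewrite dotC [RHS]dotC; congr (_^*).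
  by rewrite -gP dotDr dotZr dotDr dotZr -!gP.
have gbnd : exists M : R, forall x, `|g x| <= M%:C * `|x|.
  exists M => x; have [->|gx] := eqVneq (g x) 0.
    by rewrite normr0 mulr_ge0 ?lecR.
  rewrite -(ler_pM2r (x := `|g x|)) ?normr_gt0// -expr2 -dotxx -gP.
  apply: le_trans (real_ler_norm _) _.
    by rewrite gP; exact: ger0_real (dotxx_ge0 _).
  apply: le_trans (cauchy_schwarz _ _) _.
  by rewrite mulrAC ler_wpM2r.
by exists (Bop glin gbnd).
Qed.

Definition adj T : bop H := sval (cid (adjoint_exists T)).

Lemma adjP T : adjoint T (adj T).
Proof. exact: (svalP (cid (adjoint_exists T))). Qed.

Lemma adjE S T : adjoint S T -> adj S = T.
Proof. by move=> ST; apply: adjoint_uniq ST; exact: adjP. Qed.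

Lemma adj_lin a S T : adj (a *: S + T) = a^* *: adj S + adj T.
Proof. by apply: adjE; apply: adjoint_lin; exact: adjP. Qed.

Lemma adj_mul S T : adj (S * T) = adj T * adj S.
Proof. by apply: adjE; apply: adjoint_mul; exact: adjP. Qed.

Lemma adj_one : adj 1 = 1 :> bop H. Proof. exact: adjE. Qed.

Lemma adj_zero : adj 0 = 0 :> bop H.
Proof. by apply: adjE => x y; rewrite /= dot0l dot0r. Qed.

Lemma adjK T : adj (adj T) = T.
Proof. by apply: adjE; apply: adjoint_sym; exact: adjP. Qed.

Lemma dot_adjl T x y : [<adj T x, y>] = [<x, T y>].
Proof. exact: (adjoint_sym (adjP T)). Qed.

Lemma dot_adjr T x y : [<x, adj T y>] = [<T x, y>].
Proof. by rewrite adjP. Qed.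

End riesz.

(** * Generated C*-algebras *)

Section generated.
Context (R : realType) (H : hilbert R).
Implicit Types (X Y A : set (bop H)).

(** A unital C*-algebra without the condition that it be norm closed: the images of
    C*-algebras handled below have no reason to be closed a priori. *)
Definition star_closed Y :=
  [/\ Y 1,
      forall (a : R[i]) S T, Y S -> Y T -> Y (a *: S + T),
      forall S T, Y S -> Y T -> Y (S * T) &
      forall S T, Y S -> adjoint S T -> Y T].

Lemma star_closed_scale Y a T : star_closed Y -> Y T -> Y (a *: T).
Proof.
move=> [Y1 Yl _ _] YT; have Y0 : Y 0.
  by have := Yl (-1) 1 1 Y1 Y1; rewrite scaleN1r addNr.
by have := Yl a T 0 YT Y0; rewrite addr0.
Qed.

Lemma star_closed_sum Y (I : Type) (r : seq I) (F : I -> bop H) :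
  star_closed Y -> (forall i, Y (F i)) -> Y (\sum_(i <- r) F i).
Proof.
move=> Yc YF; have [Y1 Yl _ _] := Yc; elim: r => [|i r IH].
  by rewrite big_nil -(scale0r (1 : bop H)); exact: star_closed_scale.
by rewrite big_cons -[F i]scale1r; exact: Yl.
Qed.

Lemma cstar_star_closed A : unital_cstar_subalgebra A -> star_closed A.
Proof. by case=> ? ? ? ? ?; split. Qed.

Lemma cstar_gen_cstar X : unital_cstar_subalgebra (cstar_gen X).
Proof.
split.
- by move=> A [[]].
- by move=> a S T XS XT A AX; have [[_ Al _ _ _] _] := AX; apply: Al; [exact: XS|exact: XT].
- by move=> S T XS XT A AX; have [[_ _ Am _ _] _] := AX; apply: Am; [exact: XS|exact: XT].
- by move=> S T XS ST A AX; have [[_ _ _ Aa _] _] := AX; apply: Aa ST; exact: XS.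
- move=> T XT A AX; have [[_ _ _ _ Ac] _] := AX; apply: Ac => e /XT[S XS Se].
  by exists S => //; exact: XS.
Qed.

Lemma sub_cstar_gen X : X `<=` cstar_gen X.
Proof. by move=> x Xx A [_]; apply. Qed.

Lemma cstar_gen_sub X A : unital_cstar_subalgebra A -> X `<=` A -> cstar_gen X `<=` A.
Proof. by move=> cA XA T; apply; split. Qed.

(** For finite-dimensional A, which is generated algebraically, this avoids any closure. *)
Lemma cstar_gen_eq X A : unital_cstar_subalgebra A -> X `<=` A ->
  (forall Y, star_closed Y -> X `<=` Y -> A `<=` Y) -> cstar_gen X = A.
Proof.
move=> cA XA gen; rewrite eqEsubset; split; first exact: cstar_gen_sub.
by apply: gen; [exact/cstar_star_closed/cstar_gen_cstar|exact: sub_cstar_gen].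
Qed.

End generated.

(** * Direct sums of matrix algebras on an orthonormal basis *)

Section rank_one.
Context (R : realType) (H : hilbert R) (x y : H).

Lemma rk1_linear : linear (fun z : H => [<z, y>] *: x).
Proof. by move=> a u v; rewrite dotDl dotZl scalerDl scalerA. Qed.

Lemma rk1_bounded : exists M : R, forall z : H, `|[<z, y>] *: x| <= M%:C * `|z|.
Proof.
exists (complex.Re (`|x| * `|y|)) => z.
rewrite RRe_real ?rpredM ?normr_real// normrZ.
apply: le_trans (ler_wpM2r _ (cauchy_schwarz _ _)) _ => //.
by rewrite le_eqVlt; apply/orP; left; apply/eqP; ring.
Qed.

Definition rk1 : bop H := Bop rk1_linear rk1_bounded.

End rank_one.

Section blocks.
Context (R : realType) (E : hilbert R) (P : finType) (n : nat) (xi : P -> 'I_n -> E).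
Implicit Types (c d : P -> 'M[R[i]]_n) (S T : bop E).

(** A basis indexed by a block p and a position i in that block. *)
Definition orthonormal_basis :=
  (forall p i q j, [<xi p i, xi q j>] = ((p == q) && (i == j))%:R) /\
  (forall x, x = \sum_p \sum_i [<x, xi p i>] *: xi p i).

(** The block diagonal operator acting as the matrix c p on the span of the xi p i; these
    operators form a copy of the direct sum over p of the algebras M_n. *)
Definition blk c : bop E :=
  \sum_p \sum_i \sum_j c p i j *: rk1 (xi p i) (xi p j).

Hypothesis onb : orthonormal_basis.

Lemma xi_dot p i q j : [<xi p i, xi q j>] = ((p == q) && (i == j))%:R.
Proof. exact: onb.1. Qed.

Lemma xi_expand x : x = \sum_p \sum_i [<x, xi p i>] *: xi p i.
Proof. exact: onb.2. Qed.

Lemma onb_ext S T : (forall p i, S (xi p i) = T (xi p i)) -> S = T.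
Proof.
move=> ST; apply: bopP => x; rewrite (xi_expand x) !linear_sum.
apply: eq_bigr => p _; rewrite !linear_sum.
by apply: eq_bigr => i _; rewrite !linearZ/= ST.
Qed.

Lemma blkEx c x : blk c x = \sum_p \sum_i (\sum_j c p i j * [<x, xi p j>]) *: xi p i.
Proof.
rewrite /blk bop_sumE; apply: eq_bigr => p _; rewrite bop_sumE.
apply: eq_bigr => i _; rewrite bop_sumE scaler_suml; apply: eq_bigr => j _ /=.
by rewrite scalerA.
Qed.

Lemma blkE c q k : blk c (xi q k) = \sum_i c q i k *: xi q i.
Proof.
rewrite blkEx (bigD1 q)//= [X in _ + X]big1 ?addr0 => [|p pq].
  apply: eq_bigr => i _; congr (_ *: _); rewrite (bigD1 k)//= xi_dot !eqxx mulr1.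
  by rewrite big1 ?addr0// => j jk; rewrite xi_dot eqxx/= eq_sym (negbTE jk) mulr0.
apply: big1 => i _; rewrite big1 ?scale0r// => j _.
by rewrite xi_dot eq_sym (negbTE pq) mulr0.
Qed.

Lemma blk_coef c p i q k : [<blk c (xi q k), xi p i>] = (q == p)%:R * c q i k.
Proof.
rewrite blkE dot_suml (bigD1 i)//= big1 ?addr0 => [|j ji].
  by rewrite dotZl xi_dot eqxx andbT mulrC.
by rewrite dotZl xi_dot (negbTE ji) andbF mulr0.
Qed.

Lemma blk_lin a c d : a *: blk c + blk d = blk (fun p => a *: c p + d p).
Proof.
apply: onb_ext => q k; rewrite [LHS]/= [X in _ *: X + _]blkE [X in _ + X]blkE [RHS]blkE.
rewrite scaler_sumr -big_split; apply: eq_bigr => i _ /=.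
by rewrite !mxE scalerDl scalerA.
Qed.

Lemma blk_mul c d : blk c * blk d = blk (fun p => c p *m d p).
Proof.
apply: onb_ext => q k; rewrite [LHS]/= [X in blk c X]blkE linear_sum [RHS]blkE.
under eq_bigr do rewrite linearZ/= blkE scaler_sumr.
rewrite exchange_big; apply: eq_bigr => i _; rewrite !mxE scaler_suml.
by apply: eq_bigr => j _; rewrite scalerA mulrC.
Qed.

Lemma blk_scalar a : blk (fun=> a%:M) = a *: (1 : bop E).
Proof.
apply: onb_ext => q k; rewrite blkE (bigD1 k)//= mxE eqxx big1 ?addr0// => i ik.
by rewrite mxE (negbTE ik) scale0r.
Qed.

Lemma blk1 : blk (fun=> 1%:M) = 1.
Proof. by rewrite blk_scalar scale1r. Qed.

Lemma blk_adj c : adjoint (blk c) (blk (fun p => map_mx Num.conj (c p)^T)).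
Proof.
move=> x y; rewrite !blkEx dot_suml dot_sumr; apply: eq_bigr => p _.
rewrite dot_suml dot_sumr.
transitivity (\sum_i \sum_j c p i j * [<x, xi p j>] * [<xi p i, y>]).
  by apply: eq_bigr => i _; rewrite dotZl mulr_suml.
rewrite exchange_big; apply: eq_bigr => j _.
rewrite dotZr rmorph_sum mulr_suml; apply: eq_bigr => i _.
by rewrite !mxE rmorphM/= conjCK -(dotC _ y); ring.
Qed.

(** Block diagonality is expressed by the vanishing of matrix coefficients, which are
    norm continuous; this is why the block algebra is closed. *)
Lemma in_blocks T : (forall p q i k, q != p -> [<T (xi q k), xi p i>] = 0) ->
  T = blk (fun p => \matrix_(i, k) [<T (xi p k), xi p i>]).
Proof.
move=> T0; apply: onb_ext => q k; rewrite blkE [LHS]xi_expand (bigD1 q)//=.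
rewrite [X in _ + X]big1 ?addr0 => [|p pq].
  by apply: eq_bigr => i _; rewrite mxE.
by apply: big1 => i _; rewrite T0 ?scale0r// eq_sym.
Qed.

Lemma norm_xi p i : `|xi p i| = 1.
Proof.
apply/eqP; rewrite -(eqrXn2 (n := 2))// -dotxx xi_dot !eqxx expr1n//.
Qed.

Lemma blocks_cstar : unital_cstar_subalgebra (range blk).
Proof.
split.
- by exists (fun=> 1%:M) => //; exact: blk1.
- by move=> a _ _ [c _ <-] [d _ <-]; rewrite blk_lin; exists (fun p => a *: c p + d p).
- by move=> _ _ [c _ <-] [d _ <-]; rewrite blk_mul; exists (fun p => c p *m d p).
- move=> _ T [c _ <-] cT.
  by exists (fun p => map_mx Num.conj (c p)^T) => //; apply: adjoint_uniq cT; exact: blk_adj.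
move=> T Tc; exists (fun p => \matrix_(i, k) [<T (xi p k), xi p i>]) => //.
apply/esym/in_blocks => p q i k qp.
apply/eqP; rewrite -normr_le0; apply/ler_addgt0Pr => e e0; rewrite add0r.
have e0' : 0 < complex.Re e by move: e0; rewrite ltcE => /andP[].
have [_ [d _ <-] dT] := Tc _ e0'.
have -> : [<T (xi q k), xi p i>] = [<(T - blk d) (xi q k), xi p i>].
  by rewrite bopB dotBl blk_coef (negbTE qp) mul0r subr0.
apply: le_trans (cauchy_schwarz _ _) _; rewrite norm_xi mulr1.
apply: le_trans (opnorm_bound _ _) _; rewrite norm_xi mulr1.
by rewrite -(RRe_real (gtr0_real e0)) lecR ltW.
Qed.

Lemma parseval x : [<x, x>] = \sum_p \sum_i `|[<x, xi p i>]| ^+ 2.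
Proof.
rewrite {1}(xi_expand x) dot_suml; apply: eq_bigr => p _; rewrite dot_suml.
by apply: eq_bigr => i _; rewrite dotZl (dotC (xi p i)) -normCK.
Qed.

End blocks.

(** * Asymptotically reducing families of vectors *)

Section vanish.
Context (R : realType) (X : Type) (F : set_system X).
Implicit Types (V W : normedZmodType R[i]).

(** Convergence to zero, stated with norms because it is needed both for vectors and for
    complex numbers. *)
Definition vanish V (f : X -> V) :=
  forall e : R[i], 0 < e -> \forall t \near F, `|f t| <= e.

Context {FF : ProperFilter F}.

Lemma vanish0 V : vanish (fun=> 0 : V).
Proof. by move=> e e0; apply: nearW => t; rewrite normr0 ltW. Qed.

Lemma vanish_le V W (f : X -> V) (g : X -> W) (C : R[i]) : 0 <= C ->
  (\forall t \near F, `|g t| <= C * `|f t|) -> vanish f -> vanish g.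
Proof.
move=> C0 gf f0 e e0; have e'0 : 0 < e / (C + 1) by rewrite divr_gt0// ltr_wpDl.
apply: filterS2 gf (f0 _ e'0) => t gft ft; apply: le_trans gft _.
apply: (@le_trans _ _ ((C + 1) * `|f t|)); first by rewrite ler_wpM2r// lerDl.
by rewrite mulrC -ler_pdivlMr// ltr_wpDl.
Qed.

Lemma vanish_sqr_le V (d : X -> R[i]) (g : X -> V) (C : R[i]) : 0 <= C ->
  (\forall t \near F, `|g t| ^+ 2 <= C * `|d t|) -> vanish d -> vanish g.
Proof.
move=> C0 gd d0 e e0.
have : vanish (fun t => `|g t| ^+ 2 : R[i]).
  by apply: vanish_le C0 _ d0; apply: filterS gd => t; rewrite normrX normr_id.
move=> /(_ (e ^+ 2)); rewrite exprn_gt0// => /(_ isT); apply: filterS => t.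
by rewrite normrX normr_id ler_pXn2r// nnegrE// ltW.
Qed.

Lemma eq_vanish V (f g : X -> V) : f =1 g -> vanish f -> vanish g.
Proof. by move=> fg f0 e /f0; apply: filterS => t; rewrite fg. Qed.

Lemma vanishD V (f g : X -> V) : vanish f -> vanish g -> vanish (fun t => f t + g t).
Proof.
move=> f0 g0 e e0; have e2 : 0 < e / 2 by rewrite divr_gt0.
apply: filterS2 (f0 _ e2) (g0 _ e2) => t ft gt; apply: le_trans (ler_normD _ _) _.
by rewrite [leRHS]splitr lerD.
Qed.

Lemma vanishN V (f : X -> V) : vanish f -> vanish (fun t => - f t).
Proof. by move=> f0 e /f0; apply: filterS => t; rewrite normrN. Qed.

Lemma vanishB V (f g : X -> V) : vanish f -> vanish g -> vanish (fun t => f t - g t).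
Proof. by move=> f0 g0; apply: vanishD => //; exact: vanishN. Qed.

Lemma vanish_sum V (I : Type) (r : seq I) (f : I -> X -> V) :
  (forall i, vanish (f i)) -> vanish (fun t => \sum_(i <- r) f i t).
Proof.
move=> f0; elim: r => [|i r IH].
  by apply: eq_vanish (@vanish0 V) => t; rewrite big_nil.
by apply: eq_vanish (vanishD (f0 i) IH) => t; rewrite big_cons.
Qed.

Lemma vanish_cst V (a : V) : vanish (fun=> a) -> a = 0.
Proof.
move=> a0; apply/eqP; rewrite -normr_le0; apply/ler_addgt0Pr => e /a0.
by move=> /filter_ex[t]; rewrite add0r.
Qed.

Context (K : hilbert R).

Lemma vanishZ a (f : X -> K) : vanish f -> vanish (fun t => a *: f t).
Proof.
by move=> f0; apply: (vanish_le (normr_ge0 a)) f0; apply: nearW => t; rewrite normrZ.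
Qed.

Lemma vanish_bop (T : bop K) (f : X -> K) : vanish f -> vanish (fun t => T (f t)).
Proof.
move=> f0; apply: (vanish_le _) f0; last by apply: nearW => t; exact: opnorm_bound.
by rewrite lecR opnorm_ge0.
Qed.

Lemma vanish_dotl (f g : X -> K) : (\forall t \near F, `|g t| <= 1) ->
  vanish f -> vanish (fun t => [<f t, g t>]).
Proof.
move=> g1; apply: (vanish_le ler01); apply: filterS g1 => t gt.
by apply: le_trans (cauchy_schwarz _ _) _; rewrite mulrC ler_wpM2r.
Qed.

Lemma vanish_dotr (f g : X -> K) : (\forall t \near F, `|g t| <= 1) ->
  vanish f -> vanish (fun t => [<g t, f t>]).
Proof.
move=> g1 /(vanish_dotl g1) fg e /fg; apply: filterS => t.
by rewrite dotC norm_conjC.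
Qed.

End vanish.

Section asymptotic.
Context (R : realType) (K : hilbert R) (X : Type) (F : set_system X).
Context {FF : ProperFilter F} (n : nat) (u : 'I_n -> X -> K).
Implicit Types (S T : bop K) (M N : 'M[R[i]]_n).

Hypothesis u_le1 : forall i, \forall t \near F, `|u i t| <= 1.
Hypothesis u_gram : forall i j, vanish F (fun t => [<u i t, u j t>] - (i == j)%:R).

(** In the limit along F, the vectors u_i span an invariant subspace of T, on which
    T has the matrix M. *)
Definition act T M :=
  forall i, vanish F (fun t => T (u i t) - \sum_k M k i *: u k t).

Lemma act_lin a S T M N : act S M -> act T N -> act (a *: S + T) (a *: M + N).
Proof.
move=> SM TN i; apply: eq_vanish (vanishD (vanishZ a (SM i)) (TN i)) => t /=.
rewrite scalerBr addrACA -opprD scaler_sumr -big_split; congr (_ - _).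
by apply: eq_bigr => k _; rewrite !mxE scalerDl scalerA.
Qed.

Lemma act_scale a T M : act T M -> act (a *: T) (a *: M).
Proof.
move=> TM i; apply: eq_vanish (vanishZ a (TM i)) => t /=; rewrite scalerBr scaler_sumr.
by congr (_ - _); apply: eq_bigr => k _; rewrite mxE scalerA.
Qed.

Lemma act1 : act 1 1%:M.
Proof.
move=> i; apply: eq_vanish (@vanish0 _ _ F _ K) => t /=.
rewrite (bigD1 i)//= mxE eqxx scale1r big1 ?addr0 ?subrr// => k ki.
by rewrite mxE (negbTE ki) scale0r.
Qed.

Lemma act_mul S T M N : act S M -> act T N -> act (S * T) (M *m N).
Proof.
move=> SM TN i.
apply: eq_vanish (vanishD (vanish_bop S (TN i))
  (vanish_sum (index_enum 'I_n) (fun k => vanishZ (N k i) (SM k)))) => t /=; rewrite linearB linear_sum/=.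
under [X in _ + X = _]eq_bigr do rewrite scalerBr.
under [X in _ - X + _ = _]eq_bigr do rewrite linearZ/=.
rewrite sumrB addrA subrK; congr (_ - _).
under [LHS]eq_bigr do rewrite scaler_sumr.
rewrite exchange_big; apply: eq_bigr => l _; rewrite mxE scaler_suml.
by apply: eq_bigr => k _; rewrite scalerA mulrC.
Qed.

Lemma act_dot T M i k : act T M -> vanish F (fun t => [<T (u i t), u k t>] - M k i).
Proof.
move=> TM.
have G l : vanish F (fun t => M l i * ([<u l t, u k t>] - (l == k)%:R)).
  by apply: vanish_le (normr_ge0 (M l i)) _ (u_gram l k); apply: nearW => t; rewrite normrM.
apply: eq_vanish (vanishD (vanish_dotl (u_le1 k) (TM i)) (vanish_sum (index_enum 'I_n) G)) => t /=.
rewrite dotBl dot_suml -addrA; congr (_ + _).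
under [X in - X + _]eq_bigr do rewrite dotZl.
under [X in _ + X]eq_bigr do rewrite mulrBr.
rewrite sumrB addrA addNr add0r (bigD1 k)//= eqxx mulr1 big1 ?addr0// => l lk.
by rewrite (negbTE lk) mulr0.
Qed.

(** The matrix is recovered as the limit of the coefficients of T between the u_i. *)
Lemma act_uniq T M N : act T M -> act T N -> M = N.
Proof.
move=> TM TN; apply/matrixP => k i; apply/eqP; rewrite -subr_eq0; apply/eqP.
suff : vanish F (fun=> M k i - N k i) by exact: vanish_cst.
apply: eq_vanish (vanishB (act_dot i k TN) (act_dot i k TM)) => t /=.
by rewrite opprB addrC addrA subrK.
Qed.

Lemma act_adj S T M N : adjoint S T -> act S M -> act T N -> N = map_mx Num.conj M^T.
Proof.
move=> ST SM TN; apply/matrixP => k i; rewrite !mxE; apply/eqP; rewrite -subr_eq0; apply/eqP.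
suff : vanish F (fun=> N k i - (M i k)^*) by exact: vanish_cst.
have SC : vanish F (fun t => [<T (u i t), u k t>] - (M i k)^*).
  move=> e /(act_dot k i SM); apply: filterS => t.
  have -> : [<T (u i t), u k t>] - (M i k)^* = ([<S (u k t), u i t>] - M i k)^*.
    by rewrite rmorphB/= ST -dotC.
  by rewrite norm_conjC.
apply: eq_vanish (vanishB SC (act_dot i k TN)) => t /=.
by rewrite opprB addrC addrA subrK.
Qed.

(** The matrices of operators near T form a Cauchy family, because they are limits of
    coefficients; the limit of the coefficients of T exists by completeness of C, and it
    is the matrix with which T acts. *)
Lemma act_norm_closed T : (forall e : R, 0 < e -> exists2 S, (exists M, act S M) & opnorm (T - S) < e) ->
  exists M, act T M.
Proof.
move=> TS.
have near_dot i k e : 0 < e -> exists S M, [/\ act S M, opnorm (T - S) < e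
    & \forall t \near F, `|[<T (u i t), u k t>] - M k i| <= (real_complex R e) *+ 2].
  move=> e0; have [S [M SM] Se] := TS _ e0; exists S, M; split => //.
  have e0' : 0 < real_complex R e by rewrite ltcR.
  apply: filterS3 (act_dot i k SM e0') (u_le1 i) (u_le1 k) => t St ui uk.
  have -> : [<T (u i t), u k t>] - M k i = ([<S (u i t), u k t>] - M k i) + [<(T - S) (u i t), u k t>].
    by rewrite bopB dotBl; ring.
  apply: le_trans (ler_normD _ _) _; rewrite mulr2n lerD//.
  apply: le_trans (cauchy_schwarz _ _) _; rewrite -[leRHS]mulr1 ler_pM//.
  apply: le_trans (opnorm_bound _ _) _; rewrite -[leRHS]mulr1 ler_pM// ?lecR ?opnorm_ge0//.
  exact: ltW.
have L_ex i k : exists l : R[i], vanish F (fun t => [<T (u i t), u k t>] - l).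
  pose g t : scal R := [<T (u i t), u k t>].
  have : cvg (g @ F).
    apply: cauchy_cvg; apply: cauchy_exP => e e0.
    have e4 : 0 < complex.Re e / 4 by rewrite divr_gt0//; move: e0; rewrite ltcE => /andP[].
    have [S [M [_ _ SM]]] := near_dot i k _ e4; exists (M k i : scal R).
    apply: filterS SM => t; rewrite /= -ball_normE /= distrC => /le_lt_trans; apply.
    rewrite -rmorphMn -[ltRHS](RRe_real (gtr0_real e0)) ltcR.
    by move: (complex.Re e) e4 => r r4; lra.
  move=> /cvg_ex[l /cvgrPdist_le gl]; exists l => e /gl; apply: filterS => t.
  by rewrite distrC.
have /choice[L LP] : forall ik : 'I_n * 'I_n, exists l : R[i], vanish F (fun t => [<T (u ik.1 t), u ik.2 t>] - l).
  by move=> [i k]; exact: L_ex.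
exists (\matrix_(k, i) L (i, k)) => i e e0.
pose C : R[i] := 2 + n%:R *+ 2.
have C0 : 0 < C by rewrite ltr_wpDr ?mulrn_wge0.
pose d : R[i] := e / C.
have d0 : 0 < d by rewrite divr_gt0.
have dR : real_complex R (complex.Re d) = d by rewrite RRe_real// gtr0_real.
have rd0 : 0 < complex.Re d by rewrite -ltcR dR.
have [S [M SM] Sd] := TS _ rd0.
have TSd t : `|u i t| <= 1 -> `|(T - S) (u i t)| <= d.
  move=> ui; apply: le_trans (opnorm_bound _ _) _.
  by rewrite -[leRHS]mulr1 ler_pM// ?lecR ?opnorm_ge0// -dR lecR ltW.
have ML k : `|M k i - L (i, k)| <= d *+ 2.
  have d2 : 0 < d / 2 by rewrite divr_gt0.
  have [t [[St Lt] [ui uk]]] :=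
    filter_ex (filterI (filterI (act_dot i k SM d2) (LP (i, k) _ d2)) (filterI (u_le1 i) (u_le1 k))).
  have -> : M k i - L (i, k) = - ([<S (u i t), u k t>] - M k i) +
      ([<T (u i t), u k t>] - L (i, k)) - [<(T - S) (u i t), u k t>].
    by rewrite bopB dotBl; ring.
  apply: le_trans (ler_normB _ _) _; rewrite mulr2n lerD//.
    by apply: le_trans (ler_normD _ _) _; rewrite normrN [leRHS]splitr lerD.
  apply: le_trans (cauchy_schwarz _ _) _; rewrite -[leRHS]mulr1 ler_pM// TSd//.
have u_le : \forall t \near F, forall k, `|u k t| <= 1 by exact: filter_forall.
apply: filterS2 u_le (SM i _ d0) => t ut St.
have -> : T (u i t) - \sum_k (\matrix_(k, i) L (i, k)) k i *: u k t =
    (T - S) (u i t) + (S (u i t) - \sum_k M k i *: u k t) + \sum_k (M k i - L (i, k)) *: u k t.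
  rewrite bopB addrA subrK -addrA; congr (_ + _); rewrite addrC -sumrB -sumrN.
  by apply: eq_bigr => k _; rewrite mxE scalerBl addrAC subrr add0r.
have -> : e = d + d + (n%:R *+ 2) * d by rewrite /d /C; field; rewrite -/C gt_eqF.
apply: le_trans (ler_normD _ _) _; apply: lerD.
  by apply: le_trans (ler_normD _ _) _; rewrite lerD// TSd.
apply: le_trans (ler_norm_sum _ _ _) _.
apply: (@le_trans _ _ (\sum_(k < n) d *+ 2)).
  by apply: ler_sum => k _; rewrite normrZ -[leRHS]mulr1 ler_pM.
by rewrite sumr_const card_ord mulrnAl mulr_natl mulrnAC.
Qed.

(** The span of the u_i is asymptotically invariant under T and under its adjoint. On this
    C*-algebra, sending T to its limit matrix is a unital star homomorphism to M_n. *)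
Definition reduced : set (bop K) :=
  [set T | (exists M, act T M) /\ (exists N, act (adj T) N)].

Lemma reduced_cstar : unital_cstar_subalgebra reduced.
Proof.
split.
- by rewrite /reduced /= adj_one; split; exists 1%:M; exact: act1.
- move=> a S T [[M SM] [M' SM']] [[N TN] [N' TN']]; split.
    by exists (a *: M + N); exact: act_lin.
  by rewrite adj_lin; exists (a^* *: M' + N'); exact: act_lin.
- move=> S T [[M SM] [M' SM']] [[N TN] [N' TN']]; split.
    by exists (M *m N); exact: act_mul.
  by rewrite adj_mul; exists (N' *m M'); exact: act_mul.
- move=> S T [[M SM] [M' SM']] /adjE <-; split; first by exists M'.
  by exists M; rewrite adjK.
move=> T Tc; split; apply: act_norm_closed => e /Tc[S [SM SM'] Se]; first by exists S.
exists (adj S) => //; apply: le_lt_trans Se.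
apply: opnorm_le; first exact: opnorm_ge0.
apply: adjoint_bound (opnorm_bound (T - S)); first by rewrite lecR opnorm_ge0.
have -> : adj T - adj S = adj (T - S).
  have -> : T - S = (-1) *: S + T by rewrite scaleN1r addrC.
  by rewrite adj_lin rmorphN rmorph1 scaleN1r addrC.
exact: adjP.
Qed.

End asymptotic.

(** * Approximate kernels, and representations assembled from limits *)

Section approximate_kernel.
Context (R : realType) (K : hilbert R) (D : bop K).

(** Unit vectors on which a positive operator D is arbitrarily small: the filter of
    approximate eigenvectors for the bottom of its spectrum. *)
Definition approx_ker : set_system K :=
  filter_from [set e : R | 0 < e] (fun e => [set w | `|w| = 1 /\ [<D w, w>] <= e%:C]).

Hypothesis D0 : positive_op D.

Lemma approx_ker_unit : \forall w \near approx_ker, `|w| = 1.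
Proof. by exists 1 => [/=|w []//]; exact: ltr01. Qed.

Lemma approx_ker_vanish : vanish approx_ker (fun w => [<D w, w>]).
Proof.
move=> e e0; exists (complex.Re e) => [/=|w [_ /=]].
  by move: e0; rewrite ltcE => /andP[].
by rewrite ger0_norm// RRe_real// gtr0_real.
Qed.

Hypothesis D_sharp : forall e : R, 0 < e -> ~ positive_op (D - e%:C *: (1 : bop K)).

(** That no D - e is positive says that the bottom of the spectrum of D is 0. *)
Lemma approx_ker_proper : ProperFilter approx_ker.
Proof.
apply: filter_from_proper => [|e /= e0].
  apply: filter_from_filter; first by exists 1; exact: ltr01.
  move=> e e' /= e0 e'0; exists (Num.min e e'); first by rewrite /= lt_min e0.
  move=> w [w1 wD]; split; split => //; apply: (le_trans wD); rewrite lecR ge_min lexx//.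
  by rewrite orbT.
have [x xD] : exists x, ~ 0 <= [<(D - e%:C *: (1 : bop K)) x, x>] by exact/existsNP/D_sharp.
have {}xD : [<D x, x>] < e%:C * `|x| ^+ 2.
  move: xD; rewrite bopB dotBl /= dotZl dotxx => /negP; rewrite subr_ge0.
  rewrite real_leNgt ?negbK//; last exact: ger0_real (D0 _).
  by rewrite rpredM ?rpredX ?normr_real// ger0_real// lecR ltW.
have x0 : `|x| != 0.
  apply/eqP => x0; move: xD; rewrite x0 expr0n mulr0.
  by rewrite real_ltNge ?rpred0 ?ger0_real ?D0.
have xp : 0 < `|x| by rewrite lt_def x0/=.
exists (`|x|^-1 *: x); split; first by rewrite normrZ normfV normr_id mulVf.
rewrite dotZr linearZ/= dotZl mulrA [X in X * _]mulrC -normCK normfV normr_id.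
by rewrite mulrC exprVn ler_pdivrMr ?exprn_gt0// ltW.
Qed.

End approximate_kernel.

Section assembly.
Context (R : realType) (E K : hilbert R) (P : finType) (n : nat).
Context (xi : P -> 'I_n -> E) (onb : orthonormal_basis xi).
Context (X : set (bop E)) (j : bop E -> bop K).
Context (F : P -> set_system K) (u : P -> 'I_n -> K -> K).

(** How a homomorphism from the C*-algebra generated by j X onto the block algebra is
    found: the filter F p, with the vectors u p i, gives a limit representation on C^n, and
    the direct sum of these over p, read on the basis xi, sends j x back to x. It is onto
    because its range is star closed and contains X. *)
Lemma blocks_quotient :
    (forall p, ProperFilter (F p)) ->
    (forall p i, \forall w \near F p, `|u p i w| <= 1) ->
    (forall p i k, vanish (F p) (fun w => [<u p i w, u p k w>] - (i == k)%:R)) ->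
    (forall Y, star_closed Y -> X `<=` Y -> range (blk xi) `<=` Y) ->
    (forall x, X x -> exists2 c, x = blk xi c & forall p,
       act (F p) (u p) (j x) (c p) /\ exists N, act (F p) (u p) (adj (j x)) N) ->
  exists pi : bop K -> bop E,
    [/\ unital_star_hom (cstar_gen (j @` X)) pi,
        pi @` cstar_gen (j @` X) = range (blk xi) &
        forall x, X x -> pi (j x) = x].
Proof.
move=> FF u1 ug gen Xact; set A := cstar_gen (j @` X).
have cA : unital_cstar_subalgebra A by exact: cstar_gen_cstar.
have [A1 Al Am Aa Ac] := cA.
have Ared p : A `<=` reduced (F p) (u p).
  apply: cstar_gen_sub; first exact: reduced_cstar.
  move=> _ [x /Xact[c xc cact] <-]; have [? ?] := cact p.
  by split => //; exists (c p).
pose chi T p := xget 0 [set M | act (F p) (u p) T M].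
have chiP T p : A T -> act (F p) (u p) T (chi T p).
  move=> /(Ared p)[[M TM] _].
  by have := xgetPex (0 : 'M[R[i]]_n) (ex_intro _ M TM).
have chiE T p M : act (F p) (u p) T M -> A T -> chi T p = M.
  by move=> TM AT; apply: act_uniq TM => //; exact: chiP.
pose pi T := blk xi (chi T).
have piE T c : A T -> (forall p, act (F p) (u p) T (c p)) -> pi T = blk xi c.
  by move=> AT Tc; congr blk; apply/funext => p; exact: chiE.
have pi_hom : unital_star_hom A pi.
  split.
  - move=> a S T AS AT; rewrite blk_lin//; apply: piE; first exact: Al.
    by move=> p; apply: act_lin; exact: chiP.
  - by rewrite -(blk1 onb); apply: piE => // p; exact: act1.
  - move=> S T AS AT; rewrite blk_mul//; apply: piE; first exact: Am.
    by move=> p; apply: act_mul; exact: chiP.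
  - move=> S T AS AT ST.
    have -> : pi T = blk xi (fun p => map_mx Num.conj (chi S p)^T).
      congr blk; apply/funext => p.
      by apply: (act_adj (u1 p) (ug p) ST); exact: chiP.
    exact: blk_adj.
have pij x : X x -> pi (j x) = x.
  move=> Xx; have [c xc cact] := Xact _ Xx; rewrite [RHS]xc; apply: piE.
    by apply: sub_cstar_gen; exists x.
  by move=> p; have [] := cact p.
exists pi; split=> //; rewrite eqEsubset; split; first by move=> _ [T _ <-]; exists (chi T).
have [pil pi1 pim pia] := pi_hom.
apply: gen; last first.
  by move=> x Xx; exists (j x); [apply: sub_cstar_gen; exists x|exact: pij].
split.
- by exists 1.
- by move=> a _ _ [S AS <-] [T AT <-]; exists (a *: S + T); [exact: Al|rewrite pil].
- by move=> _ _ [S AS <-] [T AT <-]; exists (S * T); [exact: Am|rewrite pim].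
- move=> _ T' [S AS <-] ST'; have AS' : A (adj S) by apply: Aa AS _; exact: adjP.
  by exists (adj S) => //; apply: adjoint_uniq ST'; apply: pia => //; exact: adjP.
Qed.

End assembly.

(** * Diagonalisation of the algebra B *)

Section amplification.
Context (R : realType) (E : hilbert R) (P : finType) (n : nat) (xi : P -> 'I_1 -> E).

(** The basis of the direct sum of n copies of E made of the copies of xi. *)
Definition copies (p : P) (i : 'I_n) : hpow E n :=
  [ffun k => if k == i then xi p ord0 else 0].

Lemma hpow_dotE (x y : hpow E n) :
  [<x, y>] = \sum_i [<(x : hpow_sort E n) i, (y : hpow_sort E n) i>].
Proof. by []. Qed.

Lemma dot_copies (x : hpow E n) p i : [<x, copies p i>] = [<(x : hpow_sort E n) i, xi p ord0>].
Proof.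
rewrite hpow_dotE (bigD1 i)//= big1 ?addr0 => [|k ki]; rewrite ffunE ?eqxx//.
by rewrite (negbTE ki) dot0r.
Qed.

Hypothesis onb : orthonormal_basis xi.

Lemma copies_onb : orthonormal_basis copies.
Proof.
split=> [p i q j|x].
  rewrite dot_copies ffunE eq_sym; case: eqVneq => _; last by rewrite dot0l andbF.
  by rewrite xi_dot// eqxx.
apply/ffunP => k; rewrite sum_ffunE; under eq_bigr do rewrite sum_ffunE.
rewrite {1}[(x : hpow_sort E n) k](xi_expand onb); apply: eq_bigr => p _.
rewrite big_ord1 (bigD1 k)//= big1 ?addr0 => [|i ik].
  by rewrite ffunE/= ffunE eqxx dot_copies.
by rewrite ffunE/= ffunE eq_sym (negbTE ik) scaler0.
Qed.

Lemma opmx_blk (d : 'I_n -> 'I_n -> P -> 'M[R[i]]_1) (M : 'M[bop E]_n) :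
  (forall i k, M i k = blk xi (d i k)) ->
  opmx M = blk copies (fun p => \matrix_(i, k) d i k p ord0 ord0).
Proof.
move=> MD; apply: (onb_ext copies_onb) => q k; rewrite (blkE copies_onb).
apply/ffunP => i; rewrite !ffunE sum_ffunE (bigD1 k)//= big1 ?addr0 => [|l lk]; last first.
  by rewrite ffunE (negbTE lk) linear0.
rewrite (bigD1 i)//= big1 ?addr0 => [|l li]; last first.
  by rewrite !ffunE eq_sym (negbTE li) scaler0.
by rewrite !ffunE !eqxx MD (blkE onb) big_ord1 mxE.
Qed.

Lemma mx_over_blocks : mx_over n (range (blk xi)) = range (blk copies).
Proof.
rewrite eqEsubset; split=> [_ [M MX <-]|_ [c _ <-]].
  have /choice[d dM] : forall ik : 'I_n * 'I_n, exists d, M ik.1 ik.2 = blk xi d.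
    by move=> ik; have [d _ <-] := MX ik.1 ik.2; exists d.
  rewrite (opmx_blk (d := fun i k => d (i, k))) => [|i k]; last exact: dM (i, k).
  by exists (fun p => \matrix_(i, k) d (i, k) p ord0 ord0).
exists (\matrix_(i, k) blk xi (fun p => (c p i k)%:M)).
  by move=> i k; rewrite mxE; exists (fun p => (c p i k)%:M).
rewrite (opmx_blk (d := fun i k p => (c p i k)%:M)) => [|i k]; last by rewrite mxE.
by congr blk; apply/funext => p; apply/matrixP => i k; rewrite !mxE eqxx mulr1n.
Qed.

End amplification.

Section concrete_basis.
Context (R : realType).

(** The vertices of the octahedron: (k, s) stands for (-1)^s e_k. They index the characters
    of the direct sum of three copies of B, the vertex (k, s) giving a + (-1)^s b on the
    k-th block. *)
Definition vertex := ('I_3 * bool)%type.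

Lemma sum_vertex (V : nmodType) (f : vertex -> V) :
  \sum_p f p = \sum_k (f (k, false) + f (k, true)).
Proof.
transitivity (\sum_k \sum_s f (k, s)); first by rewrite pair_bigA; apply: eq_bigr => -[].
by apply: eq_bigr => k _; rewrite big_bool addrC.
Qed.

Definition rsqrt2 : R[i] := (sqrtC 2)^-1.

Lemma rsqrt2_sqr : rsqrt2 * rsqrt2 = 2^-1.
Proof. by rewrite -expr2 exprVn sqrtCK. Qed.

Lemma rsqrt2_conj : rsqrt2^* = rsqrt2.
Proof. by apply/CrealP; rewrite rpredV ger0_real// sqrtC_ge0. Qed.

(** The common eigenvectors (e_2k + (-1)^s e_2k+1) / sqrt 2 of the direct sum of three
    copies of B. *)
Definition xiB (p : vertex) (_ : 'I_1) : ell2 R 6 :=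
  [ffun i : 'I_6 => (if i./2 == p.1 then (-1) ^+ (p.2 && odd i) * rsqrt2 else 0) : scal R].

Lemma ell2_dotE n (x y : ell2 R n) :
  [<x, y>] = \sum_i (x : hpow_sort (Cc R) n) i * ((y : hpow_sort (Cc R) n) i : R[i])^*.
Proof. by []. Qed.

Definition coord (x : ell2 R 6) (m : nat) : R[i] := (x : hpow_sort (Cc R) 6) (inord m).

Lemma coordE (x : ell2 R 6) (i : 'I_6) : (x : hpow_sort (Cc R) 6) i = coord x i.
Proof. by rewrite /coord inord_val. Qed.

Lemma coordZ (a : R[i]) x m : coord (a *: x) m = a * coord x m.
Proof. exact: ffunE. Qed.

Lemma coord_sum (I : Type) (r : seq I) (f : I -> ell2 R 6) m :
  coord (\sum_(i <- r) f i) m = \sum_(i <- r) coord (f i) m.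
Proof. by apply: (big_morph (coord^~ m)) => [x y|]; exact: ffunE. Qed.

Lemma coord_xiB p i m : (m < 6)%N ->
  coord (xiB p i) m = if m./2 == p.1 then (-1) ^+ (p.2 && odd m) * rsqrt2 else 0.
Proof. by move=> m6; rewrite /coord ffunE inordK. Qed.

Lemma dot_coord (x y : ell2 R 6) : [<x, y>] =
  coord x 0 * (coord y 0)^* + coord x 1 * (coord y 1)^* + coord x 2 * (coord y 2)^* +
  coord x 3 * (coord y 3)^* + coord x 4 * (coord y 4)^* + coord x 5 * (coord y 5)^*.
Proof.
rewrite ell2_dotE; under eq_bigr do rewrite !coordE.
by rewrite !big_ord_recl big_ord0 addr0 /= /bump/= !addn1 !addrA.
Qed.

Lemma dot_xiB x (k : 'I_3) s i :
  [<x, xiB (k, s) i>] = (coord x k.*2 + (-1) ^+ s * coord x k.*2.+1) * rsqrt2.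
Proof.
rewrite dot_coord !coord_xiB//=; case: k => -[|[|[|//]]] k3 /=;
  rewrite !(andbF, andbT) !(rmorph0, mulr0, addr0, add0r) !rmorphM/= !rsqrt2_conj;
  rewrite !rmorphXn/= !rmorphN !rmorph1; ring.
Qed.

Lemma coord_component x (k : 'I_3) s m : (m < 6)%N ->
  coord (\sum_i [<x, xiB (k, s) i>] *: xiB (k, s) i) m =
  (coord x k.*2 + (-1) ^+ s * coord x k.*2.+1) * rsqrt2 *
    (if m./2 == k then (-1) ^+ (s && odd m) * rsqrt2 else 0).
Proof.
move=> m6; rewrite coord_sum big_ord_recl big_ord0 addr0 coordZ dot_xiB.
by rewrite coord_xiB.
Qed.

Lemma xiB_onb : orthonormal_basis xiB.
Proof.
split=> [[k s] i [l t] j|x].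
  have l6 : (l.*2.+1 < 6)%N by rewrite -[6%N]/(3.*2) ltn_Sdouble.
  rewrite dot_xiB !coord_xiB ?(ltnW l6)//=.
  rewrite doubleK uphalf_double odd_double/= andbT andbF (ord1 i) (ord1 j) eqxx andbT xpair_eqE.
  have -> : (k == l) = (l == k :> nat) by rewrite eq_sym.
  case: (_ == _ :> nat); last by rewrite mulr0 addr0 mul0r.
  rewrite expr0 mul1r mulrDl -!mulrA !rsqrt2_sqr.
  by case: s; case: t; rewrite /= ?expr0 ?expr1; field.
apply/ffunP => i; rewrite !coordE coord_sum sum_vertex.
pose c (k : 'I_3) (s : bool) := (coord x k.*2 + (-1) ^+ s * coord x k.*2.+1) * rsqrt2 *
    (if i./2 == k then (-1) ^+ (s && odd i) * rsqrt2 else 0).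
rewrite (eq_bigr (fun k => c k false + c k true)) => [|k _]; last first.
  by congr (_ + _); exact: coord_component.
rewrite /c.
have i3 : (i./2 < 3)%N by rewrite -ltn_double (leq_ltn_trans _ (ltn_ord i))// -{2}(odd_double_half i) leq_addl.
rewrite (bigD1 (Ordinal i3))//= eqxx big1 => [|k]; last first.
  by rewrite -val_eqE/= eq_sym => /negbTE ->; rewrite !mulr0 addr0.
rewrite addr0 -{1}(odd_double_half i).
move: (odd i) (i./2) => [] m; rewrite !(add0n, add1n) expr0 expr1.
  transitivity (coord x m.*2.+1 * (rsqrt2 * rsqrt2 * 2)); last by ring.
  by rewrite rsqrt2_sqr mulVf ?mulr1.
transitivity (coord x m.*2 * (rsqrt2 * rsqrt2 * 2)); last by ring.
by rewrite rsqrt2_sqr mulVf ?mulr1.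
Qed.

(** Entry (i, j) of the block diagonal matrix with 2 x 2 blocks A 0, A 1, ... *)
Let entry (A : nat -> 'M[R[i]]_2) (i j : nat) :=
  if i./2 == j./2 then A i./2 (inord (odd i)) (inord (odd j)) else 0.

Let entry1 (A : nat -> 'M[R[i]]_2) (i j : 'I_2) : A 0%N i j = entry A i j.
Proof.
have half2 (k : 'I_2) : k./2 = 0%N by case: k => -[|[|]].
have ord2 (k : 'I_2) : inord (odd k) = k.
  by apply/val_inj; case: k => -[|[|//]] k2; rewrite /= inordK.
by rewrite /entry !half2 !ord2 eqxx.
Qed.

Let entryS m (C : 'M[R[i]]_m) (A : nat -> 'M[R[i]]_2) :
    (forall i j, C i j = entry (fun k => A k.+1) i j) ->
  forall i j : 'I_(2 + m), block_mx (A 0%N) 0 0 C i j = entry A i j.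
Proof.
move=> CA i j; have half2 (k : 'I_2) : k./2 = 0%N by case: k => -[|[|]].
case: (split_ordP i) => i' ->; case: (split_ordP j) => j' ->.
- by rewrite block_mxEul entry1.
- by rewrite block_mxEur mxE /entry/= half2.
- by rewrite block_mxEdl mxE /entry/= half2.
- by rewrite block_mxEdr CA /entry/= !negbK eqSS.
Qed.

Lemma dsum3E (A : nat -> 'M[R[i]]_2) (i j : 'I_6) :
  dsum3 (A 0%N) (A 1%N) (A 2) i j =
    if i./2 == j./2 then A i./2 (inord (odd i)) (inord (odd j)) else 0.
Proof.
apply: (@entryS 4 (block_mx (A 1%N) 0 0 (A 2))) => {}i {}j.
apply: (@entryS 2 (A 2) (fun k => A k.+1)) => {}i {}j.
exact: (entry1 (fun k => A k.+2)).
Qed.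

Definition sgn_fun (a b : 'I_3 -> R[i]) (p : vertex) : R[i] := a p.1 + (-1) ^+ p.2 * b p.1.

Lemma mxopE n (A : 'M[R[i]]_n) (x : ell2 R n) i :
  (mxop A x : hpow_sort (Cc R) n) i = \sum_j A i j * (x : hpow_sort (Cc R) n) j.
Proof. by rewrite ffunE; apply: eq_bigr => j _; rewrite mxE. Qed.

Lemma mxop_blk (a b : nat -> R[i]) (A := fun k => mx2 (a k) (b k) (b k) (a k)) :
  mxop (dsum3 (A 0%N) (A 1%N) (A 2))
  = blk xiB (fun p => (sgn_fun (fun k => a k) (fun k => b k) p)%:M).
Proof.
apply: (onb_ext xiB_onb) => -[k s] o; rewrite (blkE xiB_onb) big_ord1 (ord1 o) mxE eqxx.
apply/ffunP => i; rewrite mxopE.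
have mx2E (x y : R[i]) (e f : bool) :
    mx2 x y y x (inord e) (inord f) = if e == f then x else y.
  by rewrite mxE -!val_eqE/= !inordK; [case: e; case: f|case: f|case: e].
under eq_bigr do rewrite dsum3E coordE coord_xiB// mx2E.
rewrite !big_ord_recl big_ord0 !ffunE /sgn_fun.
have scaleC (u v : R[i]) : u *: (v : scal R) = u * v by [].
rewrite scaleC; case: i => -[|[|[|[|[|[|//]]]]]] i6; case: k => -[|[|[|//]]] k3;
  by case: s; rewrite /= /bump/= ?expr0 ?expr1 ?mulr1n; ring.
Qed.

Lemma sumB_blocks : sumB R = range (blk xiB).
Proof.
rewrite eqEsubset; split=> [_ [_ [_ [_ [[a1 [b1 ->]] [a2 [b2 ->]] [a3 [b3 ->]] ->]]]]|_ [c _ <-]].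
  rewrite (mxop_blk (nth 0 [:: a1; a2; a3]) (nth 0 [:: b1; b2; b3])).
  by eexists.
pose a k := (c (inord k, false) ord0 ord0 + c (inord k, true) ord0 ord0) / 2.
pose b k := (c (inord k, false) ord0 ord0 - c (inord k, true) ord0 ord0) / 2.
have -> : blk xiB c = blk xiB (fun p => (sgn_fun (fun k => a k) (fun k => b k) p)%:M).
  congr blk; apply/funext => -[k s]; rewrite [LHS]mx11_scalar; congr (_%:M).
  by rewrite /sgn_fun /a /b/= inord_val; case: s; rewrite ?expr0 ?expr1; field.
rewrite -mxop_blk; do 3!eexists; split; last reflexivity.
- by exists (a 0%N), (b 0%N).
- by exists (a 1%N), (b 1%N).
- by exists (a 2), (b 2).
Qed.

(** Restrictions to the vertices of affine functions on the octahedron: this is what W32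
    becomes once the algebra is diagonalised. *)
Definition affine_fun (a : R[i]) (b : 'I_3 -> R[i]) (p : vertex) : R[i] :=
  a + (-1) ^+ p.2 * b p.1.

Lemma W32P T : W32 R T <-> exists a b, T = blk xiB (fun p => (affine_fun a b p)%:M).
Proof.
split=> [[a [b [c [d ->]]]]|[a [b ->]]].
  exists a, (fun k => nth 0 [:: b; c; d] k).
  by rewrite (mxop_blk (fun=> a) (nth 0 [:: b; c; d])).
exists a, (b (inord 0)), (b (inord 1)), (b (inord 2)).
rewrite (mxop_blk (fun=> a) (fun k => b (inord k))); congr blk; apply/funext => p.
by rewrite /sgn_fun /affine_fun inord_val.
Qed.

(** With two copies of xiB, M_2 over the diagonal algebra is a sum of six copies of M_2. *)
Definition xiU := copies (n := 2) xiB.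

Lemma xiU_onb : orthonormal_basis xiU.
Proof. exact: copies_onb xiB_onb. Qed.

Lemma mx_over_sumB : mx_over 2 (sumB R) = range (blk xiU).
Proof. by rewrite sumB_blocks; exact: mx_over_blocks xiB_onb. Qed.

Lemma calUP T : calU (W32 R) T <->
  exists l a b, T = blk xiU (fun p => mx2 l (affine_fun a b p) 0 l).
Proof.
have UE l a b : opmx (mx2 (l *: (1 : bop (ell2 R 6))) (blk xiB (fun p => (affine_fun a b p)%:M))
    0 (l *: (1 : bop (ell2 R 6)))) = blk xiU (fun p => mx2 l (affine_fun a b p) 0 l).
  pose d (i j : 'I_2) : vertex -> 'M[R[i]]_1 :=
    if i == 0 then if j == 0 then fun=> l%:M else fun p => (affine_fun a b p)%:M
    else if j == 0 then fun=> 0%:M else fun=> l%:M.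
  rewrite (opmx_blk xiB_onb (d := d)) => [|i j].
    congr blk; apply/funext => p; apply/matrixP => i j; rewrite !mxE /d.
    by do !case: ifP => _; rewrite mxE eqxx mulr1n.
  rewrite /d mxE.
  have b0 : 0 = blk xiB (fun=> 0%:M) by rewrite (blk_scalar xiB_onb) scale0r.
  by do !case: ifP => _ //; rewrite (blk_scalar xiB_onb).
split=> [[l [x [/W32P[a [b ->]] ->]]]|[l [a [b ->]]]]; first by exists l, a, b.
exists l, (blk xiB (fun p => (affine_fun a b p)%:M)); split; last by rewrite UE.
by apply/W32P; exists a, b.
Qed.

End concrete_basis.

(** * Generation of the block algebras *)

Lemma ord2P (i : 'I_2) : i = 0 \/ i = 1.
Proof. by case: i => -[|[|//]] i2; [left|right]; exact/val_inj. Qed.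

Section generation.
Context (R : realType).

Lemma rk1_blk (E : hilbert R) (P : finType) n (xi : P -> 'I_n -> E) p i j :
  orthonormal_basis xi ->
  rk1 (xi p i) (xi p j) = blk xi (fun q => (q == p)%:R *: delta_mx i j).
Proof.
move=> onb; apply: (onb_ext onb) => q k; rewrite (blkE onb) /= xi_dot//.
rewrite (bigD1 i)//= !mxE eqxx/= big1 ?addr0 => [|l li]; last first.
  by rewrite !mxE (negbTE li) mulr0 scale0r.
by have [->|] := eqVneq q p; rewrite ?mul1r// !mul0r !scale0r.
Qed.

Lemma star_closed_blocks (E : hilbert R) (P : finType) n (xi : P -> 'I_n -> E) Y :
  star_closed Y -> (forall p i j, Y (rk1 (xi p i) (xi p j))) -> range (blk xi) `<=` Y.
Proof.
move=> cY Yrk _ [c _ <-]; apply: star_closed_sum => // p; apply: star_closed_sum => // i.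
by apply: star_closed_sum => // j; exact: star_closed_scale.
Qed.

Definition axis (k : 'I_3) : vertex -> R[i] := affine_fun 0 (fun l => (l == k)%:R).

Lemma axisE k p : axis k p = (p.1 == k)%:R * (-1) ^+ p.2.
Proof. by rewrite /axis /affine_fun add0r mulrC. Qed.

(** The affine functions separate the vertices multiplicatively: each point mass is
    a quadratic polynomial in one coordinate function. *)
Lemma point_mass (p q : vertex) :
  (q == p)%:R = 2^-1 * (axis p.1 q * axis p.1 q) + (2^-1 * (-1) ^+ p.2) * axis p.1 q :> R[i].
Proof.
case: p q => [k s] [l t]; rewrite !axisE xpair_eqE /=; case: (l == k) => /=; last by ring.
by case: s; case: t; rewrite /= ?expr0 ?expr1; field.
Qed.

Section elementary.
Context (E : hilbert R) (P : finType) (n : nat) (xi : P -> 'I_n -> E).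
Hypothesis onb : orthonormal_basis xi.
Context (Y : set (bop E)) (cY : star_closed Y).
Implicit Types (f g : P -> R[i]) (M N : 'M[R[i]]_n).

(** The elementary tensor of f and M in the tensor product of C^P with M_n. *)
Definition tensor f M : bop E := blk xi (fun p => f p *: M).

Lemma tensor_lin a f g M : a *: tensor f M + tensor g M = tensor (fun p => a * f p + g p) M.
Proof.
rewrite /tensor blk_lin//; congr blk; apply/funext => p.
by rewrite scalerA -scalerDl.
Qed.

Lemma tensor_scale a f M : a *: tensor f M = tensor (fun p => a * f p) M.
Proof.
have T0 : tensor (fun=> 0) M = 0.
  have -> : tensor (fun=> 0) M = blk xi (fun=> 0%:M).
    by congr blk; apply/funext => p; rewrite scale0r raddf0.
  by rewrite blk_scalar// scale0r.
by rewrite -[LHS]addr0 -T0 tensor_lin; congr tensor; apply/funext => p; rewrite addr0.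
Qed.

Lemma tensor_mul f g M N : tensor f M * tensor g N = tensor (fun p => f p * g p) (M *m N).
Proof.
rewrite /tensor blk_mul//; congr blk; apply/funext => p.
by rewrite -scalemxAl -scalemxAr scalerA.
Qed.

Lemma tensor_adj f M : adjoint (tensor f M) (tensor (fun p => (f p)^*) (map_mx Num.conj M^T)).
Proof.
have := blk_adj xi (fun p => f p *: M); congr adjoint; congr blk; apply/funext => p.
by rewrite linearZ/= map_mxZ.
Qed.

Lemma tensor_rk1 p i j : rk1 (xi p i) (xi p j) = tensor (fun q => (q == p)%:R) (delta_mx i j).
Proof. exact: rk1_blk. Qed.

End elementary.

Lemma W32_tensor a b : W32 R (tensor (@xiB R) (affine_fun a b) 1%:M).
Proof.
by apply/W32P; exists a, b; congr blk; apply/funext => p; rewrite scalemx1.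
Qed.

Lemma W32_generates Y : star_closed Y -> W32 R `<=` Y -> range (blk (@xiB R)) `<=` Y.
Proof.
move=> cY WY; have [Y1 Yl Ym Ya] := cY; apply: star_closed_blocks => // p i j.
set t := tensor (@xiB R).
have Yt : Y (t (axis p.1) 1%:M) by apply: WY; exact: W32_tensor.
have -> : rk1 (xiB R p i) (xiB R p j) =
    2^-1 *: (t (axis p.1) 1%:M * t (axis p.1) 1%:M) + (2^-1 * (-1) ^+ p.2) *: t (axis p.1) 1%:M.
  rewrite (tensor_rk1 (@xiB_onb R)) /t (tensor_mul (@xiB_onb R)) mul1mx.
  rewrite [X in _ + X](tensor_scale (@xiB_onb R)) (tensor_lin (@xiB_onb R)).
  have -> : delta_mx i j = 1%:M :> 'M[R[i]]_1.
    by apply/matrixP => a b; rewrite !mxE !ord1.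
  by congr tensor; apply/funext => q; exact: point_mass.
by apply: Yl; [exact: Ym|exact: star_closed_scale].
Qed.

Lemma calU_tensor a b : calU (W32 R) (tensor (@xiU R) (affine_fun a b) (delta_mx 0 1)).
Proof.
apply/calUP; exists 0, a, b; congr blk; apply/funext => p.
apply/matrixP => i j; rewrite !mxE.
by case: i => -[|[|//]] i2; case: j => -[|[|//]] j2; rewrite /= ?mulr1 ?mulr0.
Qed.

(** U(W) only contains f e_01 with f affine, and one must reach point masses in all four
    corners. With its adjoint, f e_01 gives (f e_01)(f e_10) e_01 = f^2 e_01, hence the
    point masses in the corner e_01, hence those in the other corners. *)
Lemma calU_generates Y : star_closed Y -> calU (W32 R) `<=` Y -> range (blk (@xiU R)) `<=` Y.
Proof.
move=> cY UY; have [Y1 Yl Ym Ya] := cY; have onb := @xiU_onb R.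
pose t f i j := tensor (@xiU R) f (delta_mx i j).
have t_adj f i j : (forall p, (f p)^* = f p) -> Y (t f i j) -> Y (t f j i).
  move=> fR Yt; apply: Ya Yt _; have := tensor_adj (@xiU R) f (delta_mx i j).
  congr adjoint; rewrite /t; congr tensor; first exact/funext.
  by rewrite trmx_delta map_delta_mx.
have t_mul f g i j k : Y (t f i j) -> Y (t g j k) -> Y (t (fun p => f p * g p) i k).
  move=> Yf Yg; have := Ym _ _ Yf Yg; rewrite /t tensor_mul//.
  by rewrite mul_delta_mx.
have axisR k p : (axis k p)^* = axis k p :> R[i].
  by rewrite axisE rmorphM/= rmorph_nat rmorphXn/= rmorphN rmorph1.
have Yaxis k : Y (t (axis k) 0 1) by apply: UY; exact: calU_tensor.
have Ydelta p : Y (t (fun q => (q == p)%:R) 0 1).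
  have -> : t (fun q => (q == p)%:R) 0 1 =
      2^-1 *: t (fun q => axis p.1 q * axis p.1 q) 0 1 + (2^-1 * (-1) ^+ p.2) *: t (axis p.1) 0 1.
    rewrite /t [X in _ + X](tensor_scale onb) (tensor_lin onb).
    by congr tensor; apply/funext => q; exact: point_mass.
  apply: Yl; last exact: star_closed_scale.
  have Yaxis' := t_adj _ _ _ (axisR p.1) (Yaxis p.1).
  have Y1s : Y (t (fun=> 1) 0 1).
    have -> : (fun=> 1) = affine_fun 1 (fun=> 0) :> (vertex -> R[i]).
      by apply/funext => q; rewrite /affine_fun mulr0 addr0.
    by apply: UY; exact: calU_tensor.
  have -> : (fun q => axis p.1 q * axis p.1 q) = (fun q => (axis p.1 q * axis p.1 q) * 1 : R[i]).
    by apply/funext => q; rewrite mulr1.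
  exact: t_mul (t_mul _ _ _ _ _ (Yaxis p.1) Yaxis') Y1s.
have deltaR p q : ((q == p)%:R)^* = (q == p :> vertex)%:R :> R[i] by rewrite rmorph_nat.
have deltaM p : (fun q => (q == p)%:R * (q == p)%:R) = (fun q => (q == p :> vertex)%:R : R[i]).
  by apply/funext => q; case: (q == p); rewrite ?mulr1 ?mulr0.
have Ydelta' p := t_adj _ _ _ (deltaR p) (Ydelta p).
apply: star_closed_blocks => // p i j; rewrite (tensor_rk1 onb).
have Y00 := t_mul _ _ _ _ _ (Ydelta p) (Ydelta' p).
have Y11 := t_mul _ _ _ _ _ (Ydelta' p) (Ydelta p).
rewrite deltaM in Y00; rewrite deltaM in Y11.
case: (ord2P i) => ->; case: (ord2P j) => ->; [exact: Y00|exact: Ydelta|exact: Ydelta'|exact: Y11].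
Qed.

Lemma cstar_gen_W32 : cstar_gen (W32 R) = sumB R.
Proof.
rewrite sumB_blocks; apply: cstar_gen_eq; [exact: blocks_cstar (@xiB_onb R)| |exact: W32_generates].
by move=> _ /W32P[a [b ->]]; exists (fun p => (affine_fun a b p)%:M).
Qed.

Lemma cstar_gen_calU : cstar_gen (calU (W32 R)) = mx_over 2 (sumB R).
Proof.
rewrite mx_over_sumB; apply: cstar_gen_eq; [exact: blocks_cstar (@xiU_onb R)| |exact: calU_generates].
by move=> _ /calUP[l [a [b ->]]]; exists (fun p => mx2 l (affine_fun a b p) 0 l).
Qed.

End generation.

(** * Operator matrices *)

Section operator_matrices.
Context (R : realType) (H : hilbert R).
Implicit Types (x y z : H).

Lemma opmx_dot n (M : 'M[bop H]_n) (x y : hpow H n) :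
  [<opmx M x, y>] = \sum_i \sum_j [<M i j ((x : hpow_sort H n) j), (y : hpow_sort H n) i>].
Proof.
rewrite hpow_dotE; apply: eq_bigr => i _.
by rewrite ffunE dot_suml.
Qed.

Lemma rk1_dot x y z z' : [<rk1 x y z, z'>] = [<z, y>] * [<x, z'>].
Proof. exact: dotZl. Qed.

(** This matrix is the rank-one operator defined by the vector (x_i). *)
Lemma rk1_mx_pos n (x : 'I_n -> H) : positive_op (opmx (\matrix_(i, j) rk1 (x i) (x j))).
Proof.
move=> z; rewrite opmx_dot.
have -> : \sum_i \sum_j [<(\matrix_(i, j) rk1 (x i) (x j)) i j ((z : hpow_sort H n) j),
    (z : hpow_sort H n) i>] = `|\sum_j [<(z : hpow_sort H n) j, x j>]| ^+ 2.
  rewrite normCK rmorph_sum mulr_sumr; apply: eq_bigr => i _; rewrite mulr_suml.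
  by apply: eq_bigr => j _; rewrite mxE rk1_dot; congr (_ * _); exact: dotC.
exact: exprn_ge0.
Qed.

Definition single x : hpow H 1 := [ffun=> x].

Lemma opmx1_dot (M : 'M[bop H]_1) (x y : hpow H 1) :
  [<opmx M x, y>] = [<M 0 0 ((x : hpow_sort H 1) 0), (y : hpow_sort H 1) 0>].
Proof. by rewrite opmx_dot !big_ord1. Qed.

Lemma opmx1_pos (M : 'M[bop H]_1) : positive_op (opmx M) <-> positive_op (M 0 0).
Proof.
split=> M0 x; last by rewrite opmx1_dot; exact: M0.
by have := M0 (single x); rewrite opmx1_dot ffunE.
Qed.

Definition vec2 x y : hpow H 2 := [ffun i => if i == 0 then x else y].

Lemma vec2_dot x y x' y' : [<vec2 x y, vec2 x' y'>] = [<x, x'>] + [<y, y'>].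
Proof. by rewrite hpow_dotE !big_ord_recl big_ord0 addr0 !ffunE. Qed.

Lemma vec2_inj x y x' y' : vec2 x y = vec2 x' y' -> x = x' /\ y = y'.
Proof.
move=> /ffunP e; split; first by have := e 0; rewrite !ffunE.
by have := e 1; rewrite !ffunE.
Qed.

Lemma vec2P (z : hpow H 2) : exists x y, z = vec2 x y.
Proof.
exists ((z : hpow_sort H 2) 0), ((z : hpow_sort H 2) 1); apply/ffunP => i; rewrite ffunE.
by case: i => -[|[|//]] i2 /=; congr (_ _); apply/val_inj.
Qed.

Lemma opmx2 (M : 'M[bop H]_2) x y :
  opmx M (vec2 x y) = vec2 (M 0 0 x + M 0 1 y) (M 1 0 x + M 1 1 y).
Proof.
have o1 : lift ord0 ord0 = 1 :> 'I_2 by exact/val_inj.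
apply/ffunP => i; rewrite !ffunE !big_ord_recl big_ord0 addr0 !ffunE/= o1.
by case: i => -[|[|//]] i2 /=; congr (M _ _ _ + M _ _ _); apply/val_inj.
Qed.

Section positive2.
Context (M : 'M[bop H]_2) (M0 : positive_op (opmx M)).

Lemma pos2_diag0 : positive_op (M 0 0).
Proof. by move=> x; have := M0 (vec2 x 0); rewrite opmx2 vec2_dot dot0r addr0 linear0 addr0. Qed.

Lemma pos2_diag1 : positive_op (M 1 1).
Proof. by move=> x; have := M0 (vec2 0 x); rewrite opmx2 vec2_dot dot0r add0r linear0 add0r. Qed.

Lemma pos2_ker0 x : M 0 0 x = 0 -> M 1 0 x = 0.
Proof.
move=> Mx; have : opmx M (vec2 x 0) = 0.
  apply: pos_dot_eq0 => //.
  by rewrite opmx2 vec2_dot Mx !(dot0r, linear0, addr0, dot0l).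
rewrite opmx2 !linear0 !addr0 => /ffunP/(_ 1).
by rewrite !ffunE.
Qed.

Lemma pos2_ker1 x : M 1 1 x = 0 -> M 0 1 x = 0.
Proof.
move=> Mx; have : opmx M (vec2 0 x) = 0.
  apply: pos_dot_eq0 => //.
  by rewrite opmx2 vec2_dot Mx !(dot0r, linear0, addr0, dot0l).
rewrite opmx2 !linear0 !add0r => /ffunP/(_ 0).
by rewrite !ffunE.
Qed.

Lemma pos2_offdiag x y : [<M 1 0 x, y>] = [<M 0 1 y, x>]^*.
Proof.
have := pos_adj M0 (vec2 0 y) (vec2 x 0).
by rewrite !opmx2 !vec2_dot !(dot0r, dot0l, linear0, add0r, addr0) => ->; exact: dotC.
Qed.

End positive2.

End operator_matrices.

Section linear_maps.
Context (R : realType) (H K : hilbert R) (A : set (bop H)) (phi : bop H -> bop K).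
Hypothesis (cA : star_closed A) (lin : linear_on A phi).

Lemma linear_on_scale a T : A T -> phi (a *: T) = a *: phi T.
Proof.
have A0 : A 0 by rewrite -(scale0r (1 : bop H)); apply: star_closed_scale => //; case: cA.
have p0 : phi 0 = 0.
  by have := lin 1 A0 A0; rewrite !scale1r addr0 -[X in X = _]addr0 => /addrI.
by move=> AT; rewrite -[a *: T]addr0 lin// p0 addr0.
Qed.

Lemma linear_on_sum (I : Type) (r : seq I) (F : I -> bop H) : (forall i, A (F i)) ->
  phi (\sum_(i <- r) F i) = \sum_(i <- r) phi (F i).
Proof.
move=> AF; elim: r => [|i r IH].
  have A1 : A 1 by case: cA.
  by rewrite !big_nil -(scale0r (1 : bop H)) linear_on_scale// scale0r.
rewrite !big_cons -[F i]scale1r lin ?scale1r ?IH//.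
exact: star_closed_sum.
Qed.

End linear_maps.

(** * Matrix units *)

Section matrix_units.
Context (R : realType) (E K : hilbert R) (P : finType) (n : nat) (xi : P -> 'I_n -> E).
Hypothesis onb : orthonormal_basis xi.

Let A := range (blk xi).

Definition munit p i j : bop E := rk1 (xi p i) (xi p j).

Lemma blocks_star_closed : star_closed A.
Proof. exact: cstar_star_closed (blocks_cstar onb). Qed.

Lemma munit_blocks p i j : A (munit p i j).
Proof. by rewrite /munit rk1_blk//; exists (fun q => (q == p)%:R *: delta_mx i j). Qed.

Lemma munit_mul p i j q k l :
  munit p i j * munit q k l = ((p == q) && (j == k))%:R *: munit p i l.
Proof.
apply: bopP => x /=; rewrite dotZl xi_dot// [q == p]eq_sym [k == j]eq_sym scalerA mulrC.
by have [->|] := eqVneq p q; rewrite // !mul0r.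
Qed.

Lemma munit_adj p i j : adjoint (munit p i j) (munit p j i).
Proof. by move=> x y; rewrite rk1_dot dotZr -dotC mulrC. Qed.

Lemma sum_munit : \sum_p \sum_i munit p i i = 1.
Proof.
apply: bopP => x; rewrite bop_sumE [RHS](xi_expand onb); apply: eq_bigr => p _.
by rewrite bop_sumE.
Qed.

Lemma linear_on_munit (phi psi : bop E -> bop K) : linear_on A phi -> linear_on A psi ->
  (forall p i j, phi (munit p i j) = psi (munit p i j)) -> forall a, A a -> phi a = psi a.
Proof.
move=> phil psil pq _ [c _ <-]; have cA := blocks_star_closed.
have cM p i j : A (c p i j *: munit p i j).
  exact: star_closed_scale (munit_blocks _ _ _).
have cMi p i : A (\sum_j c p i j *: munit p i j) by exact: star_closed_sum.
have cMp p : A (\sum_i \sum_j c p i j *: munit p i j) by exact: star_closed_sum.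
rewrite /blk (linear_on_sum cA phil)// (linear_on_sum cA psil)//; apply: eq_bigr => p _.
rewrite (linear_on_sum cA phil)// (linear_on_sum cA psil)//; apply: eq_bigr => i _.
rewrite (linear_on_sum cA phil)// (linear_on_sum cA psil)//; apply: eq_bigr => j _.
by rewrite (linear_on_scale cA phil)// ?(linear_on_scale cA psil)// ?pq//; exact: munit_blocks.
Qed.

Lemma tensor_munit f i j : tensor xi f (delta_mx i j) = \sum_p f p *: munit p i j.
Proof.
apply: (onb_ext onb) => q k; rewrite (blkE onb) bop_sumE (bigD1 i)//= big1 => [|l li].
  rewrite (bigD1 q)//= big1 => [|p pq]; rewrite ?addr0 /=.
    by rewrite xi_dot// !mxE !eqxx/= scalerA [k == j]eq_sym.
  by rewrite xi_dot// eq_sym (negbTE pq) scale0r scaler0.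
by rewrite !mxE (negbTE li) mulr0 scale0r.
Qed.

Lemma tensor_dot f g i k x y :
  [<tensor xi f (delta_mx i k) x, tensor xi g (delta_mx i k) y>] =
  \sum_p (f p * [<x, xi p k>]) * (g p * [<y, xi p k>])^*.
Proof.
have tE h z : tensor xi h (delta_mx i k) z = \sum_p (h p * [<z, xi p k>]) *: xi p i.
  by rewrite tensor_munit bop_sumE; apply: eq_bigr => p _ /=; rewrite scalerA.
rewrite !tE dot_suml; apply: eq_bigr => p _; rewrite dot_sumr (bigD1 p)//= big1 => [|q qp].
  by rewrite dotZl dotZr xi_dot// !eqxx mulr1 addr0.
by rewrite dotZl dotZr xi_dot// eq_sym (negbTE qp) !mulr0.
Qed.

Lemma bessel x k : \sum_p `|[<x, xi p k>]| ^+ 2 <= [<x, x>].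
Proof.
rewrite (parseval onb x); apply: ler_sum => p _; rewrite (bigD1 k)//= lerDl.
by apply: sumr_ge0 => i _; exact: exprn_ge0.
Qed.

Lemma tensor_column f g i k c x : 0 <= c -> (forall p, `|f p| ^+ 2 + `|g p| ^+ 2 <= c) ->
  [<tensor xi f (delta_mx i k) x, tensor xi f (delta_mx i k) x>] +
  [<tensor xi g (delta_mx i k) x, tensor xi g (delta_mx i k) x>] <= c * [<x, x>].
Proof.
move=> c0 fgc; apply: le_trans (ler_wpM2l c0 (bessel x k)).
rewrite !tensor_dot -big_split mulr_sumr; apply: ler_sum => p _ /=.
by rewrite -!normCK !normrM !exprMn -mulrDl ler_wpM2r ?exprn_ge0.
Qed.

Lemma tensor_row f g i k c x y : 0 <= c -> (forall p, `|f p| ^+ 2 + `|g p| ^+ 2 <= c) ->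
  [<tensor xi f (delta_mx i k) x + tensor xi g (delta_mx i k) y,
    tensor xi f (delta_mx i k) x + tensor xi g (delta_mx i k) y>] <= c * ([<x, x>] + [<y, y>]).
Proof.
move=> c0 fgc; apply: le_trans (ler_wpM2l c0 (lerD (bessel x k) (bessel y k))).
rewrite !dotDl !dotDr !tensor_dot -!big_split mulr_sumr; apply: ler_sum => p _ /=.
set a := [<x, _>]; set b := [<y, _>].
rewrite [X in X <= _](_ : _ = `|f p * a + g p * b| ^+ 2); last first.
  by rewrite normCK rmorphD/=; ring.
have h : `|f p * a + g p * b| <= `|f p| * `|a| + `|g p| * `|b|.
  by rewrite -!normrM; exact: ler_normD.
apply: le_trans (lerXn2r 2 _ _ h) _; rewrite ?nnegrE ?addr_ge0 ?mulr_ge0//.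
apply: le_trans (ler_wpM2r _ (fgc p)); last by rewrite addr_ge0 ?exprn_ge0.
rewrite -subr_ge0 [X in 0 <= X](_ : _ = (`|f p| * `|b| - `|g p| * `|a|) ^+ 2); last by ring.
by apply: real_exprn_even_ge0; rewrite ?rpredB ?rpredM ?normr_real.
Qed.

Lemma linear_on_tensor (phi : bop E -> bop K) f i j : linear_on A phi ->
  phi (tensor xi f (delta_mx i j)) = \sum_p f p *: phi (munit p i j).
Proof.
move=> phil; have cA := blocks_star_closed.
rewrite tensor_munit (linear_on_sum cA phil) => [|p].
  by apply: eq_bigr => p _; rewrite (linear_on_scale cA phil)//; exact: munit_blocks.
exact: star_closed_scale (munit_blocks _ _ _).
Qed.

Lemma sum_linear_munit (phi : bop E -> bop K) x : linear_on A phi -> phi 1 = 1 ->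
  \sum_p \sum_i phi (munit p i i) x = x.
Proof.
move=> phil phi1; have cA := blocks_star_closed.
have : phi (\sum_p \sum_i munit p i i) = 1 by rewrite sum_munit.
rewrite (linear_on_sum cA phil) => [|p]; last first.
  by apply: star_closed_sum => // i; exact: munit_blocks.
under eq_bigr => p _ do (rewrite (linear_on_sum cA phil); last by move=> i; exact: munit_blocks).
move=> /(congr1 (fun T : bop K => T x)); rewrite bop_sumE => e.
transitivity ((1 : bop K) x) => //; rewrite -e.
by apply: eq_bigr => p _; rewrite bop_sumE.
Qed.

Context (pi : bop E -> bop K) (pi_hom : unital_star_hom A pi).

Lemma hom_munit_mul p i j q k l x : pi (munit p i j) (pi (munit q k l) x) =
  ((p == q) && (j == k))%:R *: pi (munit p i l) x.
Proof.
have [pil _ pim _] := pi_hom.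
rewrite -[LHS]/((pi (munit p i j) * pi (munit q k l)) x) -pim; try exact: munit_blocks.
by rewrite munit_mul (linear_on_scale blocks_star_closed pil)//; exact: munit_blocks.
Qed.

Lemma sum_hom_munit x : \sum_p \sum_i pi (munit p i i) x = x.
Proof. by case: pi_hom => pil pi1 _ _; exact: sum_linear_munit. Qed.

Lemma hom_munit_adj p i j : adjoint (pi (munit p i j)) (pi (munit p j i)).
Proof.
by have [_ _ _ pia] := pi_hom; apply: pia (munit_adj _ _ _); exact: munit_blocks.
Qed.

End matrix_units.

(** * Hyperrigidity of the operator system *)

Section system.
Context (R : realType).

Definition opposite (p : vertex) : vertex := (p.1, ~~ p.2).

Lemma opposite_neq p : opposite p != p.
Proof. by case: p => k [] /=; rewrite xpair_eqE andbF. Qed.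

(** A coordinate function is 1 and -1 at two opposite vertices and 0 elsewhere. *)
Lemma sum_axis (V : lmodType R[i]) (f : vertex -> V) (p : vertex) :
  (-1) ^+ p.2 *: (\sum_q axis R p.1 q *: f q) = f p - f (opposite p).
Proof.
rewrite (bigD1 p)//= (bigD1 (opposite p)) ?opposite_neq//= big1 => [|q /andP[qp qo]].
  rewrite addr0 scalerDr !scalerA !axisE eqxx !mul1r /= -!signr_addb addbb addbN addbb.
  by rewrite expr0 expr1 scale1r scaleN1r.
rewrite axisE; suff -> : q.1 == p.1 = false by rewrite mul0r scale0r.
apply: contraNF qo => /eqP qp1; move: qp; case: q qp1 => k s /= ->; case: p => l t.
by rewrite !xpair_eqE eqxx /=; case: s; case: t.
Qed.

(** Let phi be a unital completely positive map that agrees with pi on W, and let D q and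
    Q q be the images of the point mass at q under phi and pi. The D q are positive with sum
    1, and D r - D r' = Q r - Q r' for opposite vertices r and r'. For v in the range of Q r
    this gives sum_q D q v + D r v - D r' v = 2 v, so that the numbers <D q v, v>, q != r,
    are nonnegative with a vanishing combination with positive weights. *)
Lemma sumB_hyperrigid : system_hyperrigid (W32 R) (sumB R).
Proof.
split; first exact: cstar_gen_W32.
rewrite sumB_blocks => K pi pi_hom phi [phil phi1 phicp] agree.
have onb := @xiB_onb R; have [pil pi1 _ _] := pi_hom.
have cA := blocks_star_closed onb.
apply: (linear_on_munit onb phil pil) => p i j; rewrite (ord1 i) (ord1 j) {i j}.
pose D p := phi (munit (@xiB R) p 0 0); pose Q p := pi (munit (@xiB R) p 0 0).
have D0 q : positive_op (D q).
  have := phicp 1 (\matrix_(i, j) munit (@xiB R) q i j).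
  have mp : positive_op (opmx (\matrix_(i, j) munit (@xiB R) q i j)) by exact: rk1_mx_pos.
  move=> /(_ _ mp); rewrite opmx1_pos !mxE; apply.
  by move=> i j; rewrite mxE; exact: munit_blocks.
have affDQ a b : \sum_q affine_fun a b q *: D q = \sum_q affine_fun a b q *: Q q.
  rewrite -!(linear_on_tensor onb)//; apply: agree; have := @W32_tensor R a b.
  congr W32; congr tensor; apply/matrixP => i j.
  by rewrite !mxE (ord1 i) (ord1 j).
have sumD x : \sum_q D q x = x.
  have := affDQ 1 (fun=> 0); under eq_bigr do rewrite /affine_fun mulr0 addr0 scale1r.
  under [RHS]eq_bigr do rewrite /affine_fun mulr0 addr0 scale1r.
  move=> /(congr1 (fun T : bop K => T x)); rewrite !bop_sumE => ->.
  by rewrite -[RHS](sum_hom_munit onb pi_hom); apply: eq_bigr => q _; rewrite big_ord1.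
have diffD q x : D q x - D (opposite q) x = Q q x - Q (opposite q) x.
  rewrite -!bopB -!sum_axis; congr (_ *: _); congr bop_fun; exact: affDQ.
have QQ q r x : Q q (Q r x) = (q == r)%:R *: Q q x.
  by rewrite /Q hom_munit_mul// andbT.
have DQ q r x : D q (Q r x) = (q == r)%:R *: Q q x.
  set v := Q r x.
  have Qv s : Q s v = (s == r)%:R *: v.
    by rewrite /v QQ; have [->//|] := eqVneq s r; rewrite !scale0r.
  have dN : [<D (opposite r) v, v>] *+ 2 + \sum_(s | (s != r) && (s != opposite r)) [<D s v, v>] = 0.
    have := sumD v; rewrite (bigD1 r)//= (bigD1 (opposite r)) ?opposite_neq//=.
    have := diffD r v; rewrite !Qv eqxx (negbTE (opposite_neq r)) scale1r scale0r subr0.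
    move=> /(congr1 (fun y => y + D (opposite r) v)); rewrite subrK => ->.
    rewrite -addrA -[X in _ = X]addr0 => /addrI /(congr1 (fun y => [<y, v>])).
    by rewrite dot0l !dotDl dot_suml mulr2n addrA.
  have d0 s : 0 <= [<D s v, v>] by exact: D0.
  move/eqP: dN; rewrite paddr_eq0 ?mulrn_wge0//; last by apply: sumr_ge0.
  rewrite mulrn_eq0/= psumr_eq0// => /andP[/eqP dop /allP doth].
  have Dv s : s != r -> D s v = 0.
    move=> sr; apply: pos_dot_eq0 => //; have [->//|so] := eqVneq s (opposite r).
    by have := doth s (mem_index_enum _); rewrite sr so => /eqP.
  have [->|/Dv->] := eqVneq q r; last by rewrite scale0r.
  rewrite scale1r -[RHS]/v -{2}(sumD v) (bigD1 r)//= big1 ?addr0// => s; exact: Dv.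
apply: bopP => x; rewrite -[x in LHS](sum_hom_munit onb pi_hom) linear_sum.
rewrite (eq_bigr (fun q => (p == q)%:R *: Q p x)) => [|q _]; last by rewrite big_ord1; exact: DQ.
rewrite (bigD1 p)//= eqxx scale1r big1 ?addr0// => q qp.
by rewrite eq_sym (negbTE qp) scale0r.
Qed.

End system.

(** * Unital complete contractions are completely positive *)

Section contractive_positive.
Context (R : realType).

(** A positive T of norm at most 2 Re c lies in the ball of centre c and radius |c|,
    because |T x|^2 <= |T| <T x, x>. *)
Lemma shift_norm_le (H : hilbert R) (T : bop H) (c : R[i]) : positive_op T ->
  (opnorm T)%:C <= c + c^* -> opnorm (T - c *: (1 : bop H)) <= complex.Re `|c|.
Proof.
move=> T0 Tc.
apply: opnorm_le; first by rewrite -lecR normcR; exact: normr_ge0.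
move=> x; rewrite normcR norm_le_sq// bopB /= dotBl !dotBr !dotZl !dotZr.
rewrite -(pos_adj T0 x x) normCK.
have TT : [<T x, T x>] <= (c + c^*) * [<T x, x>].
  have tx0 : 0 <= [<T x, x>] := T0 x.
  have := pos_cauchy_schwarz x (T x) T0.
  have [->|Tx] := eqVneq (T x) 0; first by rewrite !dot0l mulr0.
  rewrite (ger0_norm (dotxx_ge0 _)) => h.
  have Tx2 : 0 < [<T x, T x>] by rewrite lt_def dotxx_eq0 Tx dotxx_ge0.
  rewrite -(ler_pM2r Tx2) -expr2 (le_trans h)// [_ * [<T x, x>]]mulrC -mulrA ler_wpM2l//.
  apply: le_trans (real_ler_norm _) _; first exact: ger0_real (T0 _).
  apply: le_trans (cauchy_schwarz _ _) _.
  apply: le_trans (ler_wpM2r _ (opnorm_bound _ _)) _ => //.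
  by rewrite -mulrA -expr2 -dotxx ler_wpM2r// ?dotxx_ge0.
rewrite -subr_ge0.
have -> : c * c^* * [<x, x>] - ([<T x, T x>] - c^* * [<T x, x>] -
   (c * [<T x, x>] - c * (c^* * [<x, x>]))) = (c + c^*) * [<T x, x>] - [<T x, T x>] by ring.
by rewrite subr_ge0.
Qed.

(** The discs of centre c N through 0, for all c with large real part, have no common point
    off the half-line of nonnegative numbers: a large imaginary part of c excludes the
    points that are not real. *)
Lemma disc_nonneg (z b N : R[i]) : 0 <= N -> 0 <= b ->
  (forall c, b <= c + c^* -> `|z - c * N| <= `|c| * N) -> 0 <= z.
Proof.
move=> N0 b0 disc.
have sq c : b <= c + c^* -> `|z| ^+ 2 <= N * (z * c^* + z^* * c).
  move=> /disc; rewrite -(ler_pXn2r (n := 2)) ?nnegrE ?mulr_ge0// exprMn !normCK.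
  rewrite rmorphB rmorphM/= (CrealP (ger0_real N0)) -subr_ge0.
  have -> : c * c^* * N ^+ 2 - (z - c * N) * (z^* - c^* * N) =
    N * (z * c^* + z^* * c) - z * z^* by ring.
  by rewrite subr_ge0.
have bR : b^* = b by apply/CrealP; exact: ger0_real.
have [NE|Nn] := eqVneq N 0.
  have : b <= b + b^* by rewrite bR lerDl.
  move=> /sq; rewrite NE mul0r real_exprn_even_le0// normr_eq0 => /eqP ->.
  exact: lexx.
have Np : 0 < N by rewrite lt_def Nn.
have zR : z^* = z.
  apply/eqP; rewrite eq_sym -subr_eq0; apply/negPn/negP => d0; set d := z - z^*.
  have dp : 0 < `|d| ^+ 2 by rewrite exprn_gt0 ?normr_gt0.
  have dC : d^* = - d by rewrite /d rmorphB/= conjCK opprB.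
  have zzR : (z + z^*)^* = z + z^* by rewrite rmorphD/= conjCK addrC.
  pose s := b * (z + z^*) / `|d| ^+ 2 + 1.
  have sR : s^* = s.
    have ddR : (`|d| ^+ 2)^* = `|d| ^+ 2 := CrealP (gtr0_real dp).
    by rewrite /s rmorphD rmorph1 rmorphM fmorphV/= ddR rmorphM/= bR zzR.
  have := sq (b - s * d); rewrite rmorphB rmorphM/= sR dC bR mulrN opprK.
  rewrite [_ + (b + _)]addrACA addNr addr0 lerDl => /(_ b0).
  have -> : z * (b + s * d) + z^* * (b - s * d) = b * (z + z^*) - s * `|d| ^+ 2.
    by rewrite normCK dC /d; ring.
  have -> : b * (z + z^*) - s * `|d| ^+ 2 = - `|d| ^+ 2.
    by rewrite /s mulrDl divfK ?gt_eqF// mul1r opprD addrA subrr add0r.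
  rewrite mulrN => /(le_trans (exprn_ge0 _ (normr_ge0 _))); rewrite oppr_ge0.
  by rewrite real_leNgt ?ger0_real ?mulr_ge0 ?exprn_ge0// mulr_gt0.
have bR1 : (b + 1)^* = b + 1 by rewrite rmorphD/= rmorph1 bR.
have := sq (b + 1); rewrite bR1 zR.
have -> : b <= b + 1 + (b + 1) by rewrite -addrA lerDl !addr_ge0.
move=> /(_ isT) /(le_trans (exprn_ge0 _ (normr_ge0 _))).
by rewrite -mulr2n pmulr_rge0// pmulrn_lge0// pmulr_lge0// ltr_wpDl.
Qed.

Context (H K : hilbert R) (A : set (bop H)) (phi : bop H -> bop K).

(** A positive T lies in every ball of radius |c| around a scalar c with large real part;
    phi fixes c and contracts, so that the numerical range of phi T lies in the
    corresponding discs. *)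
Lemma ucc_completely_positive : star_closed A -> ucc A phi -> completely_positive_on A phi.
Proof.
move=> cA [phil phi1 phic] n M AM M0 x; have [A1 Al _ _] := cA.
set T := opmx M.
apply: (@disc_nonneg _ (opnorm T)%:C [<x, x>]).
- exact: dotxx_ge0.
- by rewrite lecR opnorm_ge0.
move=> c Tc.
pose Mc := \matrix_(i, j) (M i j - (c * (i == j)%:R) *: (1 : bop H)).
have AMc : mx_in A Mc.
  move=> i j; rewrite mxE addrC -scaleNr -[X in _ + X]scale1r.
  by rewrite [_ + _]addrC; apply: Al => //; exact: star_closed_scale.
have shift (L : hilbert R) (N N' : 'M[bop L]_n) :
    (forall i j, N' i j = N i j - (c * (i == j)%:R) *: (1 : bop L)) ->
    opmx N' = opmx N - c *: (1 : bop (hpow L n)).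
  move=> NN; apply: bopP => y; rewrite bopB; apply/ffunP => i; rewrite !ffunE.
  under eq_bigr do rewrite NN bopB /=.
  rewrite sumrB; congr (_ - _); rewrite (bigD1 i)//= eqxx mulr1 big1 ?addr0// => j ji.
  by rewrite eq_sym (negbTE ji) mulr0 scale0r.
have := phic n Mc AMc; rewrite (shift _ M Mc) => [|i j]; last by rewrite mxE.
rewrite (shift _ (map_mx phi M)) => [phile|i j]; last first.
  rewrite !mxE addrC -scaleNr phil// phi1 scaleNr addrC//.
set S := opmx (map_mx phi M) in phile *.
have -> : [<S x, x>] - c * [<x, x>] = [<(S - c *: (1 : bop (hpow K n))) x, x>].
  by rewrite bopB dotBl; congr (_ - _); rewrite -dotZl.
apply: le_trans (cauchy_schwarz _ _) _; rewrite dotxx expr2 mulrA ler_wpM2r//.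
apply: le_trans (opnorm_bound _ _) _; rewrite ler_wpM2r//.
by rewrite -[leRHS]normcR lecR (le_trans phile)// shift_norm_le.
Qed.

End contractive_positive.

(** * Hyperrigidity of the operator algebra *)

Section algebra.
Context (R : realType).

(** Write B q i j and G q i j for the images under phi and pi of the matrix units of the
    q-th block. For w in the range of G r 1 1 and v = G r 0 1 w, the agreement on U(W) gives
    sum_q B q 0 1 w = v and B r 0 1 w - B r' 0 1 w = v, with r' opposite to r. By complete
    positivity the matrices B q are positive, in particular at the vector (v, - w). Summing
    these inequalities with weights 2 at r, 0 at r' and 1 elsewhere, and using that the
    B q 0 0 + B q 1 1 sum to 1, one finds that a sum of nonnegative numbers is 0; this
    determines every B q i j at v and at w. *)
Lemma calU_hyperrigid : algebra_hyperrigid (calU (W32 R)) (mx_over 2 (sumB R)).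
Proof.
split; first exact: cstar_gen_calU.
rewrite mx_over_sumB => K pi pi_hom phi phi_ucc agree.
have onb := @xiU_onb R; have [pil pi1 _ _] := pi_hom; have [phil phi1 _] := phi_ucc.
have cA := blocks_star_closed onb.
have phicp := ucc_completely_positive cA phi_ucc.
pose B p i j := phi (munit (@xiU R) p i j); pose G p i j := pi (munit (@xiU R) p i j).
pose BM p : 'M[bop K]_2 := \matrix_(i, j) B p i j.
have BM0 p : positive_op (opmx (BM p)).
  have := phicp 2 (\matrix_(i, j) munit (@xiU R) p i j).
  have mp : positive_op (opmx (\matrix_(i, j) munit (@xiU R) p i j)) by exact: rk1_mx_pos.
  move=> /(_ _ mp); have -> : map_mx phi (\matrix_(i, j) munit (@xiU R) p i j) = BM p.
    by apply/matrixP => i j; rewrite !mxE.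
  by apply=> i j; rewrite mxE; exact: munit_blocks.
have B00 p : positive_op (B p 0 0) by have := pos2_diag0 (BM0 p); rewrite mxE.
have B11 p : positive_op (B p 1 1) by have := pos2_diag1 (BM0 p); rewrite mxE.
have ker0 p x : B p 0 0 x = 0 -> B p 1 0 x = 0.
  by have := @pos2_ker0 _ _ _ (BM0 p) x; rewrite !mxE.
have ker1 p x : B p 1 1 x = 0 -> B p 0 1 x = 0.
  by have := @pos2_ker1 _ _ _ (BM0 p) x; rewrite !mxE.
have offdiag p x y : [<B p 1 0 x, y>] = [<B p 0 1 y, x>]^*.
  by have := pos2_offdiag (BM0 p) x y; rewrite !mxE.
have affBG a b : \sum_q affine_fun a b q *: B q 0 1 = \sum_q affine_fun a b q *: G q 0 1.
  by rewrite -!(linear_on_tensor onb)//; apply: agree; exact: calU_tensor.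
have sumB01 x : \sum_q B q 0 1 x = \sum_q G q 0 1 x.
  have := affBG 1 (fun=> 0); under eq_bigr do rewrite /affine_fun mulr0 addr0 scale1r.
  under [RHS]eq_bigr do rewrite /affine_fun mulr0 addr0 scale1r.
  by move=> /(congr1 (fun T : bop K => T x)); rewrite !bop_sumE.
have diffB01 q x : B q 0 1 x - B (opposite q) 0 1 x = G q 0 1 x - G (opposite q) 0 1 x.
  rewrite -!bopB -!(sum_axis (fun q => B q 0 1)) -!(sum_axis (fun q => G q 0 1)).
  congr (_ *: _); congr bop_fun; exact: affBG.
have o1 : lift ord0 ord0 = 1 :> 'I_2 by exact/val_inj.
have sumBd x : \sum_q (B q 0 0 x + B q 1 1 x) = x.
  rewrite -[RHS](sum_linear_munit onb x phil phi1); apply: eq_bigr => q _.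
  by rewrite !big_ord_recl big_ord0 addr0 o1.
have GG p i j q k l x : G p i j (G q k l x) = ((p == q) && (j == k))%:R *: G p i l x.
  exact: hom_munit_mul.
have local r w : G r 1 1 w = w -> let v := G r 0 1 w in
    (forall q i, B q i 0 v = (q == r)%:R *: (if i == 0 then v else w)) /\
    (forall q i, B q i 1 v = 0) /\ (forall q i, B q i 0 w = 0) /\
    (forall q i, B q i 1 w = (q == r)%:R *: (if i == 0 then v else w)).
  move=> rw v.
  have Gw q : G q 0 1 w = (q == r)%:R *: v.
    by rewrite /v -[w in LHS]rw GG andbT; have [->//|] := eqVneq q r; rewrite !scale0r.
  have vw : [<v, v>] = [<w, w>].
    rewrite /v (hom_munit_adj onb pi_hom r 0 1) -[pi _ _]/(G r 1 0 _).
    by rewrite GG !eqxx scale1r rw.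
  pose o := opposite r.
  pose c q := [<B q 0 1 w, v>].
  pose d q := [<B q 0 0 v, v>] + [<B q 1 1 w, w>].
  pose e q := [<B q 1 1 v, v>] + [<B q 0 0 w, w>].
  (* t q is the value of the form of B q at the vector (v, - w) *)
  pose t q := d q - c q - (c q)^*.
  have d0 q : 0 <= d q by rewrite addr_ge0 ?B00 ?B11.
  have e0 q : 0 <= e q by rewrite addr_ge0 ?B00 ?B11.
  have tE q : t q = [<opmx (BM q) (vec2 v (- w)), vec2 v (- w)>].
    rewrite opmx2 vec2_dot !mxE !(dotNr, dotDl, linearN, dotNl)/= offdiag.
    by rewrite /t /d /c; ring.
  have t0 q : 0 <= t q by rewrite tE; exact: BM0.
  have sumc : \sum_q c q = [<w, w>].
    rewrite -vw -dot_suml sumB01 (bigD1 r)//= Gw eqxx scale1r big1 ?addr0// => q qr.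
    by rewrite Gw (negbTE qr) scale0r.
  have diffc : c r - c o = [<w, w>].
    by rewrite -vw -dotBl diffB01 !Gw eqxx (negbTE (opposite_neq r)) scale1r scale0r subr0.
  have sumde : \sum_q (d q + e q) = [<w, w>] *+ 2.
    transitivity ([<\sum_q (B q 0 0 v + B q 1 1 v), v>] + [<\sum_q (B q 0 0 w + B q 1 1 w), w>]).
      rewrite !dot_suml -big_split.
      by apply: eq_bigr => q _; rewrite /= !dotDl /d /e; ring.
    by rewrite !sumBd vw mulr2n.
  have key : t r *+ 2 + \sum_(q | (q != r) && (q != o)) t q + d o *+ 2 +
      \sum_(q | (q != r) && (q != o)) d q + (\sum_q e q) *+ 2 = 0.
    move: sumc sumde; rewrite big_split/= (bigD1 r)//= (bigD1 o) ?opposite_neq//=.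
    rewrite (bigD1 r (P := xpredT) (F := d))//= (bigD1 o (F := d)) ?opposite_neq//=.
    set Sc := \sum_(q | _) c q; set Sd := \sum_(q | _) d q; set Se := \sum_q e q.
    move=> sumc sumde.
    have -> : \sum_(q | (q != r) && (q != o)) t q = Sd - Sc - Sc^*.
      by rewrite /t !sumrB -rmorph_sum.
    have c2 : c r *+ 2 + Sc = [<w, w>] *+ 2.
      by rewrite [RHS]mulr2n -{1}diffc -sumc; ring.
    have c2' : (c r)^* *+ 2 + Sc^* = [<w, w>] *+ 2.
      by rewrite -rmorphMn -rmorphD/= c2 rmorphMn/= -dotC.
    transitivity ((d r + (d o + Sd) + Se) *+ 2 - (c r *+ 2 + Sc) - ((c r)^* *+ 2 + Sc^*)).
      by rewrite /t; ring.
    by rewrite sumde c2 c2'; ring.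
  have St0 : 0 <= \sum_(q | (q != r) && (q != o)) t q by exact: sumr_ge0.
  have Sd0 : 0 <= \sum_(q | (q != r) && (q != o)) d q by exact: sumr_ge0.
  have Se0 : 0 <= \sum_q e q by exact: sumr_ge0.
  have split0 (x y : R[i]) : 0 <= x -> 0 <= y -> x + y = 0 -> x = 0 /\ y = 0.
    by move=> x0 y0 /eqP; rewrite paddr_eq0// => /andP[/eqP-> /eqP->].
  have half0 (x : R[i]) : x *+ 2 = 0 -> x = 0 by move=> /eqP; rewrite mulrn_eq0 => /eqP.
  have t20 : 0 <= t r *+ 2 by exact: mulrn_wge0.
  have d20 : 0 <= d o *+ 2 by exact: mulrn_wge0.
  have e20 : 0 <= (\sum_q e q) *+ 2 by exact: mulrn_wge0.
  have [||{}key /half0 eall] := split0 _ _ _ _ key => //.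
    exact: addr_ge0 (addr_ge0 (addr_ge0 t20 St0) d20) Sd0.
  have [||{}key doth] := split0 _ _ _ _ key => //.
    exact: addr_ge0 (addr_ge0 t20 St0) d20.
  have [||{}key /half0 dop] := split0 _ _ _ _ key => //; first exact: addr_ge0.
  have [//|//|/half0 tr _] := split0 _ _ _ _ key.
  have {}eall q : e q = 0.
    by move/eqP: eall; rewrite psumr_eq0// => /allP/(_ q (mem_index_enum _))/eqP.
  have {}doth q : q != r -> d q = 0.
    move=> qr; have [->//|qo] := eqVneq q o.
    move/eqP: doth; rewrite psumr_eq0// => /allP/(_ q (mem_index_enum _)).
    by rewrite qr qo => /eqP.
  have B11v q : B q 1 1 v = 0.
    apply: pos_dot_eq0 => //; have /eqP := eall q.
    by rewrite paddr_eq0 ?B11 ?B00// => /andP[/eqP].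
  have B00w q : B q 0 0 w = 0.
    apply: pos_dot_eq0 => //; have /eqP := eall q.
    by rewrite paddr_eq0 ?B11 ?B00// => /andP[_ /eqP].
  have B00v q : q != r -> B q 0 0 v = 0.
    move=> /doth/eqP dq; apply: pos_dot_eq0 => //; move: dq.
    by rewrite paddr_eq0 ?B11 ?B00// => /andP[/eqP].
  have B11w q : q != r -> B q 1 1 w = 0.
    move=> /doth/eqP dq; apply: pos_dot_eq0 => //; move: dq.
    by rewrite paddr_eq0 ?B11 ?B00// => /andP[_ /eqP].
  have B00rv : B r 0 0 v = v.
    have := sumBd v; rewrite (bigD1 r)//= B11v addr0 big1 ?addr0// => q qr.
    by rewrite B00v// B11v addr0.
  have B11rw : B r 1 1 w = w.
    have := sumBd w; rewrite (bigD1 r)//= B00w add0r big1 ?addr0// => q qr.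
    by rewrite B00w B11w// addr0.
  have : opmx (BM r) (vec2 v (- w)) = 0 by apply: pos_dot_eq0 => //; rewrite -tE.
  have -> : 0 = vec2 0 0 :> hpow K 2 by apply/ffunP => i; rewrite !ffunE; case: ifP.
  rewrite opmx2 !mxE !linearN/= B00rv B11rw => /vec2_inj[/eqP + /eqP].
  rewrite !subr_eq0 => /eqP B01rw /eqP B10rv.
  split; last split; last split; move=> q i; case: (ord2P i) => -> //=.
  - by have [->|qr] := eqVneq q r; rewrite ?scale1r// scale0r B00v.
  - by have [->|qr] := eqVneq q r; rewrite ?scale1r// scale0r ker0// B00v.
  - exact: ker1.
  - exact: ker0.
  - by have [->|qr] := eqVneq q r; rewrite ?scale1r// scale0r ker1// B11w.
  - by have [->|qr] := eqVneq q r; rewrite ?scale1r// scale0r B11w.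
have BG r w : G r 1 1 w = w -> forall q i j,
    B q i j (G r 0 1 w) = G q i j (G r 0 1 w) /\ B q i j w = G q i j w.
  move=> rw q i j; have [Bv0 [Bv1 [Bw0 Bw1]]] := local r w rw.
  have Gw k : G q k 1 w = (q == r)%:R *: (if k == 0 then G r 0 1 w else w).
    rewrite -[w in LHS]rw GG andbT.
    by have [->|] := eqVneq q r; rewrite ?scale0r// !scale1r; case: (ord2P k) => ->; rewrite //= rw.
  have Gv k l : G q k l (G r 0 1 w) = ((q == r) && (l == 0))%:R *: G q k 1 w by rewrite GG.
  case: (ord2P j) => ->; split; rewrite ?Bv0 ?Bv1 ?Bw0 ?Bw1 ?Gv ?eqxx ?andbT ?andbF ?scale0r//.
  - by rewrite Gw scalerA -natrM mulnb andbb.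
  - by rewrite -rw GG andbF scale0r.
(* the vectors v and w of this form span K *)
apply: (linear_on_munit onb phil pil) => p i j; apply: bopP => x.
rewrite -[LHS]/(B p i j x) -[RHS]/(G p i j x).
rewrite -[x](sum_hom_munit onb pi_hom) !linear_sum; apply: eq_bigr => r _.
rewrite !big_ord_recl !big_ord0 !addr0 o1 !linearD -!/(G _ _ _) /=.
have -> : G r ord0 ord0 x = G r 0 1 (G r 1 0 x) by rewrite GG !eqxx scale1r.
congr (_ + _).
  by apply: (BG r (G r 1 0 x) _ p i j).1; rewrite GG !eqxx scale1r.
by apply: (BG r (G r 1 1 x) _ p i j).2; rewrite GG !eqxx scale1r.
Qed.

End algebra.

(** * Affine functions on the octahedron *)

Section affine.
Context (R : realType).
Implicit Types (f g : vertex -> R[i]) (p q : vertex).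

Definition affine f := exists a b, f = affine_fun a b.

Lemma affine_lin a f g : affine f -> affine g -> affine (fun p => a * f p + g p).
Proof.
move=> [u [b ->]] [v [c ->]]; exists (a * u + v), (fun k => a * b k + c k).
by apply/funext => p; rewrite /affine_fun; ring.
Qed.

Lemma affine_cst a : affine (fun=> a).
Proof. by exists a, (fun=> 0); apply/funext => p; rewrite /affine_fun mulr0 addr0. Qed.

Lemma affine_scale a f : affine f -> affine (fun p => a * f p).
Proof.
move=> ff; have := affine_lin a ff (affine_cst 0); congr affine; apply/funext => p.
exact: addr0.
Qed.

Lemma affine_conj f : affine f -> affine (fun p => (f p)^*).
Proof.
move=> [u [b ->]]; exists u^*, (fun k => (b k)^*); apply/funext => p.
by rewrite /affine_fun rmorphD rmorphM/= rmorphXn/= rmorphN rmorph1.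
Qed.

(** The function 1 - (-1)^s x_k, for p = (k, s): it is affine, vanishes at p and takes the
    values 1 and 2 at the other vertices, so that it exposes p. *)
Definition gap p q : R[i] := 1 - (-1) ^+ p.2 * axis R p.1 q.

Lemma affine_gap p : affine (gap p).
Proof.
exists 1, (fun l => - (-1) ^+ p.2 * (l == p.1)%:R); apply/funext => q.
by rewrite /gap axisE /affine_fun eq_sym; ring.
Qed.

Lemma gap_self p : gap p p = 0.
Proof. by rewrite /gap axisE eqxx mul1r -signr_addb addbb expr0 subrr. Qed.

Lemma gap_cases p q : q != p -> gap p q = 1 \/ gap p q = 2.
Proof.
case: p q => [k s] [l t]; rewrite xpair_eqE /gap axisE /=; case: (l == k) => /=; last first.
  by left; rewrite mul0r mulr0 subr0.
by case: s; case: t => //= _; right; rewrite ?expr0 ?expr1; ring.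
Qed.

Lemma gap_ge0 p q : 0 <= gap p q.
Proof.
by have [->|/gap_cases[]->] := eqVneq q p; rewrite ?gap_self ?ler01 ?ler0n.
Qed.

(** There are finitely many vertices, and the gap is at least 1 away from p. *)
Lemma gap_dominates g p : g p = 0 -> exists2 C : R[i], 0 <= C & forall q, `|g q| ^+ 2 <= C * gap p q.
Proof.
move=> gp; pose C : R[i] := \sum_q `|g q| ^+ 2.
have C0 : 0 <= C by apply: sumr_ge0 => q _; exact: exprn_ge0.
exists C => // q; have [->|qp] := eqVneq q p.
  by rewrite gp gap_self normr0 expr0n mulr0.
have gC : `|g q| ^+ 2 <= C.
  by rewrite /C (bigD1 q)//= lerDl; apply: sumr_ge0 => r _; exact: exprn_ge0.
apply: (le_trans gC); case: (gap_cases qp) => ->; first by rewrite mulr1.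
by rewrite -{1}[C]mulr1 ler_wpM2l// ler1n.
Qed.

End affine.

Section mx2_entries.
Context (T : Type) (a b c d : T).

Lemma mx2_00 : mx2 a b c d 0 0 = a. Proof. by rewrite mxE. Qed.
Lemma mx2_01 : mx2 a b c d 0 1 = b. Proof. by rewrite mxE. Qed.
Lemma mx2_10 : mx2 a b c d 1 0 = c. Proof. by rewrite mxE. Qed.
Lemma mx2_11 : mx2 a b c d 1 1 = d. Proof. by rewrite mxE. Qed.

Definition mx2E := (mx2_00, mx2_01, mx2_10, mx2_11).

End mx2_entries.

Section embeddings.
Context (R : realType).

Lemma map_mx_id (T : Type) n (M : 'M[T]_n) : map_mx id M = M.
Proof. by apply/matrixP => i j; rewrite mxE. Qed.

Lemma system_embedding_id (H : hilbert R) (X : set (bop H)) : system_embedding X id.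
Proof. by split=> // n M _; rewrite map_mx_id. Qed.

Lemma algebra_embedding_id (H : hilbert R) (X : set (bop H)) : algebra_embedding X id.
Proof. by split=> // n M _; rewrite map_mx_id. Qed.

End embeddings.

(** * The envelope of the operator system *)

Section system_envelope.
Context (R : realType) (K : hilbert R) (j : bop (ell2 R 6) -> bop K).
Hypothesis jE : system_embedding (W32 R) j.
Implicit Types (f g : vertex -> R[i]) (p q : vertex).

Let t f := tensor (@xiB R) f 1%:M.
Let J f := j (t f).

Let tW f : affine f -> W32 R (t f).
Proof. by move=> [a [b ->]]; exact: W32_tensor. Qed.

Let J_lin a f g : affine f -> affine g -> J (fun q => a * f q + g q) = a *: J f + J g.
Proof.
move=> ff gg; have [jl _ _] := jE; rewrite -jl; [|exact: tW|exact: tW].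
by rewrite /t tensor_lin//; exact: xiB_onb.
Qed.

Let t1 : t (fun=> 1) = 1.
Proof.
rewrite -(blk1 (@xiB_onb R)); congr blk; apply/funext => q; exact: scale1r.
Qed.

Let J1 : J (fun=> 1) = 1.
Proof. by have [_ j1 _] := jE; rewrite /J t1. Qed.

Let J_scale a f : affine f -> J (fun q => a * f q) = a *: J f.
Proof.
move=> ff; have J0 : J (fun=> 0) = 0.
  have := J_lin 1 (affine_cst (0 : R[i])) (affine_cst 0).
  have -> : (fun _ : vertex => 1 * 0 + 0 : R[i]) = fun=> 0 by apply/funext => q; rewrite mul1r addr0.
  by rewrite scale1r -[X in X = _]addr0 => /addrI.
rewrite -[RHS]addr0 -J0 -(J_lin a ff (affine_cst 0)).
by congr J; apply/funext => q; rewrite addr0.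
Qed.

Lemma tensor1_dot f x y : [<t f x, y>] = \sum_q f q * ([<x, xiB R q 0>] * [<y, xiB R q 0>]^*).
Proof.
rewrite /t /tensor blkEx dot_suml; apply: eq_bigr => q _.
rewrite !big_ord1 dotZl !mxE mulr1 mulrA; congr (_ * _ * _).
exact: dotC.
Qed.

(** The 2 x 2 matrix with entries f, g^*, g, 1 is positive at every vertex. A complete order
    embedding keeps it positive: its off-diagonal entries are then adjoint, and evaluating at
    (x, - J g x) gives the inequality. *)
Lemma embedding_schwarz f g : affine f -> affine g -> (forall q, `|g q| ^+ 2 <= f q) ->
  adjoint (J g) (J (fun q => (g q)^*)) /\ forall x, [<J g x, J g x>] <= [<J f x, x>].
Proof.
move=> ff gg gf; have [_ j1 je] := jE.
pose M := mx2 (t f) (t (fun q => (g q)^*)) (t g) 1.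
have MW : mx_in (W32 R) M.
  move=> i k; rewrite mxE; case: ifP => _; case: ifP => _; try exact: tW.
  - by apply: tW; exact: affine_conj.
  - by rewrite -t1; apply: tW; exact: affine_cst.
have M0 : positive_op (opmx M).
  move=> z; have [x [y ->]] := vec2P z; rewrite opmx2 vec2_dot !mx2E.
  have yy : [<(1 : bop (ell2 R 6)) y, y>] = _ := etrans (congr1 (fun T : bop _ => [<T y, y>]) (esym t1)) (tensor1_dot _ _ _).
  rewrite !dotDl !tensor1_dot yy -!big_split; apply: sumr_ge0 => q _; cbv beta.
  set a := [<x, _>]; set b := [<y, _>].
  suff h : 0 <= f q * (a * a^*) + (g q)^* * (b * a^*) + (g q * (a * b^*) + 1 * (b * b^*)).
    exact: h.
  have -> : f q * (a * a^*) + (g q)^* * (b * a^*) + (g q * (a * b^*) + 1 * (b * b^*)) =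
      (f q - `|g q| ^+ 2) * `|a| ^+ 2 + `|g q * a + b| ^+ 2.
    by rewrite !normCK rmorphD rmorphM/=; ring.
  by rewrite addr_ge0 ?mulr_ge0 ?subr_ge0 ?exprn_ge0.
have jM0 : positive_op (opmx (map_mx j M)) by rewrite je.
have adjJ : adjoint (J g) (J (fun q => (g q)^*)).
  by move=> x y; have := pos2_offdiag jM0 x y; rewrite !mxE /= -dotC.
split=> // x; have := jM0 (vec2 x (- J g x)).
rewrite opmx2 vec2_dot !mxE/= j1 linearN/= subrr dot0l addr0 dotBl subr_ge0.
by rewrite -[j (t g) x]/(J g x) -[j (t _) _]/(J _ _) (adjoint_sym adjJ).
Qed.

Let D p := J (gap R p).

Lemma gap_pos p : positive_op (D p).
Proof.
move=> x; apply: le_trans (dotxx_ge0 (J (fun=> 0) x)) _.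
apply: (embedding_schwarz _ _ _).2; [exact: affine_gap|exact: affine_cst|].
by move=> q; rewrite normr0 expr0n gap_ge0.
Qed.

(** At p the function gap - e is negative, and j reflects positivity. *)
Lemma gap_sharp p (e : R) : 0 < e -> ~ positive_op (D p - e%:C *: (1 : bop K)).
Proof.
move=> e0; have -> : D p - e%:C *: (1 : bop K) = J (fun q => - e%:C * 1 + gap R p q).
  by rewrite (J_lin (- e%:C) (affine_cst 1) (affine_gap R p)) J1 scaleNr addrC.
have [_ _ je] := jE; move=> pos.
pose M := \matrix_(i < 1, k < 1) t (fun q => - e%:C * 1 + gap R p q).
have MW : mx_in (W32 R) M.
  by move=> i k; rewrite mxE; apply/tW/affine_lin; [exact: affine_cst|exact: affine_gap].
have : positive_op (opmx M) by rewrite -je// opmx1_pos !mxE.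
rewrite opmx1_pos mxE => /(_ (xiB R p 0)).
rewrite tensor1_dot (bigD1 p)//= big1 => [|q qp]; last first.
  by rewrite (xi_dot (@xiB_onb R)) eq_sym (negbTE qp) mul0r mulr0.
rewrite (xi_dot (@xiB_onb R)) !eqxx gap_self rmorph1 !mulr1 !addr0.
by rewrite conjC1 !mulr1 oppr_ge0 lecR leNgt e0.
Qed.

Let F p := approx_ker (D p).
Let u (p : vertex) (i : 'I_1) (w : K) : K := w.

Let F_proper p : ProperFilter (F p).
Proof. by apply: approx_ker_proper; [exact: gap_pos|exact: gap_sharp]. Qed.

(** Along the approximate kernel of J (gap p), the Schwarz inequality with f a multiple of
    the gap kills J g. *)
Lemma system_act0 p g : affine g -> g p = 0 -> act (F p) (u p) (J g) 0.
Proof.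
move=> gg gp i; have [C C0 gC] := gap_dominates gp.
have FF := F_proper p.
apply: (vanish_sqr_le C0 _ (approx_ker_vanish (@gap_pos p))).
apply: nearW => w; rewrite big1 ?subr0 => [|k _]; last by rewrite mxE scale0r.
have gapC := affine_scale C (affine_gap R p).
rewrite -dotxx (le_trans ((embedding_schwarz gapC gg gC).2 w))// (J_scale C (affine_gap R p)).
by rewrite /= dotZl ler_wpM2l// real_ler_norm// ger0_real// gap_pos.
Qed.

Lemma system_act p f : affine f -> act (F p) (u p) (J f) (f p)%:M.
Proof.
move=> ff; have FF := F_proper p.
have gg : affine (fun q => (- f p) * 1 + f q) by apply: affine_lin => //; exact: affine_cst.
have gp : (fun q => (- f p) * 1 + f q) p = 0 by rewrite mulr1 addNr.
have -> : J f = f p *: (1 : bop K) + J (fun q => (- f p) * 1 + f q).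
  by rewrite (J_lin (- f p) (affine_cst 1) ff) J1 addrA -scalerDl subrr scale0r add0r.
have -> : (f p)%:M = f p *: 1%:M + 0 :> 'M[R[i]]_1 by rewrite scalemx1 addr0.
by apply: act_lin; [exact: act1|exact: system_act0].
Qed.

Lemma sumB_envelope_map : exists pi : bop K -> bop (ell2 R 6),
  [/\ unital_star_hom (cstar_gen (j @` W32 R)) pi,
      pi @` cstar_gen (j @` W32 R) = sumB R &
      forall x, W32 R x -> pi (j x) = x].
Proof.
rewrite sumB_blocks; apply: (blocks_quotient (@xiB_onb R) (F := F) (u := u)).
- exact: F_proper.
- move=> p i; have FF : ProperFilter (approx_ker (D p)) := F_proper p.
  by have := approx_ker_unit (D p); apply: filterS => w; rewrite /u => ->.
- move=> p i k e e0; have FF : ProperFilter (approx_ker (D p)) := F_proper p.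
  have := approx_ker_unit (D p); apply: filterS => w w1.
  by rewrite /u dotxx w1 expr1n (ord1 i) (ord1 k) eqxx subrr normr0 ltW.
- exact: W32_generates.
move=> _ /W32P[a [b ->]]; exists (fun p => (affine_fun a b p)%:M) => // p.
have ff : affine (affine_fun a b) by exists a, b.
have -> : j (blk (xiB R) (fun p => (affine_fun a b p)%:M)) = J (affine_fun a b).
  by congr j; congr blk; apply/funext => q; rewrite scalemx1.
split; first exact: system_act.
exists ((affine_fun a b p)^*)%:M.
have [C C0 fC] : exists2 C : R[i], 0 <= C & forall q, `|affine_fun a b q| ^+ 2 <= C.
  exists (\sum_q `|affine_fun a b q| ^+ 2); first by apply: sumr_ge0 => q _; exact: exprn_ge0.
  by move=> q; rewrite (bigD1 q)//= lerDl; apply: sumr_ge0 => r _; exact: exprn_ge0.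
rewrite (adjE (embedding_schwarz (affine_cst C) ff fC).1).
exact: system_act (affine_conj ff).
Qed.

End system_envelope.

Lemma sumB_envelope (R : realType) :
  is_cstar_envelope (@system_embedding R) (W32 R) id (sumB R).
Proof.
split; [exact: system_embedding_id|by rewrite image_id cstar_gen_W32|].
by move=> K j jE; exact: sumB_envelope_map.
Qed.

(** * The envelope of the operator algebra *)

Section norms.
Context (R : realType) (H : hilbert R).
Implicit Types (T : bop H).

Lemma opnorm_opmx1 (M : 'M[bop H]_1) : opnorm (opmx M) = opnorm (M 0 0).
Proof.
have n1 (z : hpow H 1) : `|z| = `|(z : hpow_sort H 1) 0|.
  by apply/eqP; rewrite -(eqrXn2 (n := 2))// -!dotxx hpow_dotE big_ord1.
have o1 (z : hpow H 1) : (opmx M z : hpow_sort H 1) 0 = M 0 0 ((z : hpow_sort H 1) 0).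
  by rewrite ffunE big_ord1.
apply/eqP; rewrite eq_le; apply/andP; split; apply: opnorm_le; rewrite ?opnorm_ge0// => x.
  by rewrite !n1 o1 opnorm_bound.
by have := opnorm_bound (opmx M) (single x); rewrite !n1 o1 ffunE.
Qed.

Lemma opnorm_sqr_le T (c : R) : 0 <= c -> opnorm T <= c ->
  forall x, [<T x, T x>] <= c%:C ^+ 2 * [<x, x>].
Proof.
move=> c0 Tc x; rewrite -norm_le_sq ?lecR//; apply: le_trans (opnorm_bound _ _) _.
by rewrite ler_wpM2r// lecR.
Qed.

Lemma sqr_opnorm_le T (c : R) : 0 <= c ->
  (forall x, [<T x, T x>] <= c%:C ^+ 2 * [<x, x>]) -> opnorm T <= c.
Proof.
by move=> c0 Tc; apply: opnorm_le => // x; rewrite norm_le_sq ?lecR.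
Qed.

(** Vectors on which T almost attains its norm bound are almost eigenvectors of T^*T: expand
    the square and use that the adjoint has the same bound. *)
Lemma norm_attained T (c : R) : 0 <= c -> opnorm T <= c -> forall x,
  `|adj T (T x) - c%:C ^+ 2 *: x| ^+ 2 <= c%:C ^+ 2 * (c%:C ^+ 2 * [<x, x>] - [<T x, T x>]).
Proof.
move=> c0 Tc x; have cC : (c%:C)^* = c%:C by apply/CrealP; rewrite ger0_real ?lecR.
have T'c : [<adj T (T x), adj T (T x)>] <= c%:C ^+ 2 * [<T x, T x>].
  rewrite -norm_le_sq ?lecR//; apply: adjoint_bound (adjP T) _ _; rewrite ?lecR// => y.
  by rewrite norm_le_sq ?lecR//; exact: opnorm_sqr_le.
rewrite -dotxx dotBl !dotBr !dotZl !dotZr rmorphXn/= cC.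
have e1 : [<adj T (T x), x>] = [<T x, T x>] by exact: dot_adjl.
have e2 : [<x, adj T (T x)>] = [<T x, T x>] by exact: dot_adjr.
rewrite e1 e2 -subr_ge0.
set B := [<adj T (T x), _>] in T'c *; set A := [<T x, T x>] in T'c *.
have -> : c%:C ^+ 2 * (c%:C ^+ 2 * [<x, x>] - A) - (B - c%:C ^+ 2 * A -
    (c%:C ^+ 2 * A - c%:C ^+ 2 * (c%:C ^+ 2 * [<x, x>]))) = c%:C ^+ 2 * A - B by ring.
by rewrite subr_ge0.
Qed.

End norms.

Section algebra_envelope.
Context (R : realType) (K : hilbert R) (j : bop (hpow (ell2 R 6) 2) -> bop K).
Hypothesis jE : algebra_embedding (calU (W32 R)) j.
Implicit Types (f g : vertex -> R[i]) (p q : vertex) (c : R).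

Let t f := tensor (@xiU R) f (delta_mx 0 1).
Let J f := j (t f).

Let tU f : affine f -> calU (W32 R) (t f).
Proof. by move=> [a [b ->]]; exact: calU_tensor. Qed.

Let J_lin a f g : affine f -> affine g -> J (fun q => a * f q + g q) = a *: J f + J g.
Proof.
move=> ff gg; have [jl _ _ _] := jE; rewrite -jl; [|exact: tU|exact: tU].
by rewrite /t tensor_lin//; exact: xiU_onb.
Qed.

Let t0 : t (fun=> 0) = 0.
Proof.
rewrite -(scale0r (t (fun=> 0))) /t (tensor_scale (@xiU_onb R)).
by congr tensor; apply/funext => q; rewrite mul0r.
Qed.

Let U0 : calU (W32 R) 0.
Proof. by rewrite -t0; apply: tU; exact: affine_cst. Qed.

Let j0 : j 0 = 0.
Proof.
have [jl _ _ _] := jE; have := jl 1 0 0 U0 U0.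
by rewrite !scale1r addr0 -[X in X = _]addr0 => /addrI.
Qed.

Let J_scale a f : affine f -> J (fun q => a * f q) = a *: J f.
Proof.
move=> ff; rewrite -[RHS]addr0 -j0 -t0 -/(J _) -(J_lin a ff (affine_cst 0)).
by congr J; apply/funext => q; rewrite addr0.
Qed.

Let J_mul f g : affine f -> affine g -> J f * J g = 0.
Proof.
move=> ff gg; have [_ _ jm _] := jE; rewrite -jm; [|exact: tU|exact: tU].
rewrite /t (tensor_mul (@xiU_onb R)) mul_delta_mx_0// -j0 -t0; congr (j _).
by rewrite /t /tensor; congr blk; apply/funext => q; rewrite scaler0 scale0r.
Qed.

Let norm2 f g c := forall q, `|f q| ^+ 2 + `|g q| ^+ 2 <= c%:C ^+ 2.

(** The column with entries f e_01 and g e_01 has norm at most c at every vertex, and j is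
    isometric on 2 x 2 matrices. *)
Lemma J_column f g c x : affine f -> affine g -> 0 <= c -> norm2 f g c ->
  [<J f x, J f x>] + [<J g x, J g x>] <= c%:C ^+ 2 * [<x, x>].
Proof.
move=> ff gg c0 fgc; have [_ _ _ ji] := jE.
have c20 : 0 <= c%:C ^+ 2 by rewrite exprn_ge0 ?lecR.
pose M := mx2 (t f) 0 (t g) 0.
have MU : mx_in (calU (W32 R)) M.
  by move=> i k; rewrite mxE; case: ifP => _; case: ifP => _; [exact: tU|exact: U0|exact: tU|exact: U0].
have Mc : opnorm (opmx M) <= c.
  apply: sqr_opnorm_le => // z; have [y [y' ->]] := vec2P z.
  rewrite opmx2 !vec2_dot !mx2E [bop_fun 0 _]/(0 : hpow _ 2) !addr0.
  apply: le_trans (tensor_column (@xiU_onb R) 0 1 y c20 fgc) _.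
  by rewrite ler_wpM2l// lerDl dotxx_ge0.
rewrite -(ji 2 M MU) in Mc.
have := opnorm_sqr_le c0 Mc (vec2 x 0).
by rewrite opmx2 !vec2_dot !mxE/= j0 !(dot0l, linear0, addr0).
Qed.

Lemma J_row f g c x y : affine f -> affine g -> 0 <= c -> norm2 f g c ->
  [<J f x + J g y, J f x + J g y>] <= c%:C ^+ 2 * ([<x, x>] + [<y, y>]).
Proof.
move=> ff gg c0 fgc; have [_ _ _ ji] := jE.
have c20 : 0 <= c%:C ^+ 2 by rewrite exprn_ge0 ?lecR.
pose M := mx2 (t f) (t g) 0 0.
have MU : mx_in (calU (W32 R)) M.
  by move=> i k; rewrite mxE; case: ifP => _; case: ifP => _; [exact: tU|exact: tU|exact: U0|exact: U0].
have Mc : opnorm (opmx M) <= c.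
  apply: sqr_opnorm_le => // z; have [z1 [z2 ->]] := vec2P z.
  rewrite opmx2 !vec2_dot !mx2E ![bop_fun 0 _]/(0 : hpow _ 2) addr0 dot0l addr0.
  by rewrite /t; apply: tensor_row; [exact: xiU_onb|exact: c20|exact: fgc].
rewrite -(ji 2 M MU) in Mc.
have := opnorm_sqr_le c0 Mc (vec2 x y).
by rewrite opmx2 !vec2_dot !mxE/= j0 /= !(dot0l, addr0).
Qed.

(** 2 - gap p, equal to 2 at p and of modulus at most 1 at the other vertices. The limit
    representation at p is found where J (peak p) almost attains its norm 2. *)
Let peak p q : R[i] := - 1 * gap R p q + 2.

Let affine_peak p : affine (peak p).
Proof. by apply: affine_lin; [exact: affine_gap|exact: affine_cst]. Qed.

Let four : (2 : R)%:C ^+ 2 = 4 :> R[i].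
Proof. by rewrite -rmorphXn/= -natrX rmorph_nat. Qed.

Let peak_self p : peak p p = 2.
Proof. by rewrite /peak gap_self mulr0 add0r. Qed.

Let peak_norm2 p g : g p = 0 -> (forall q, `|g q| ^+ 2 <= 3) -> norm2 (peak p) g 2.
Proof.
move=> gp g3 q; rewrite four; have [->|qp] := eqVneq q p.
  by rewrite peak_self gp normr0 expr0n addr0 normr_nat -natrX.
have -> : 4 = 1 + 3 :> R[i] by ring.
apply: lerD => //; rewrite /peak mulN1r.
case: (gap_cases R qp) => ->; last by rewrite addNr normr0 expr0n ler01.
by rewrite (_ : - 1 + 2 = 1) ?normr1 ?expr1n//; ring.
Qed.

Let Y p := J (peak p).

(** Positive because J (peak p) has norm at most 2, with spectrum reaching 0 because this
    norm is exactly 2; its approximate kernel consists of the vectors sought. *)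
Let D p : bop K := 4 *: (1 : bop K) - adj (Y p) * Y p.

Let D_dot p x : [<D p x, x>] = 4 * [<x, x>] - [<Y p x, Y p x>].
Proof. by rewrite bopB dotBl /= dotZl dot_adjl. Qed.

Let Y_le p x : [<Y p x, Y p x>] <= 4 * [<x, x>].
Proof.
have g0 q : `|(fun=> 0 : R[i]) q : R[i]| ^+ 2 <= 3 by rewrite normr0 expr0n ler0n.
have := J_column x (affine_peak p) (affine_cst 0) (ler0n _ 2) (peak_norm2 (g := fun=> 0) erefl g0).
by rewrite four; apply: le_trans; rewrite lerDl dotxx_ge0.
Qed.

Lemma defect_pos p : positive_op (D p).
Proof. by move=> x; rewrite D_dot subr_ge0 Y_le. Qed.

Let Y_opnorm p : 2 <= opnorm (Y p).
Proof.
have [_ _ _ ji] := jE.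
pose M := \matrix_(i < 1, k < 1) t (peak p).
have MU : mx_in (calU (W32 R)) M by move=> i k; rewrite mxE; exact: tU.
have := ji 1 M MU; rewrite !opnorm_opmx1 !mxE => ->.
have tx : t (peak p) (@xiU R p 1) = 2 *: @xiU R p 0.
  rewrite /t /tensor (blkE (@xiU_onb R)) (bigD1 0)//= big1 => [|i i0].
    by rewrite addr0 !mxE peak_self mulr1.
  by rewrite !mxE (negbTE i0) mulr0 scale0r.
have := opnorm_bound (t (peak p)) (@xiU R p 1).
rewrite tx normrZ !(norm_xi (@xiU_onb R)) !mulr1 normr_nat -[leLHS](rmorph_nat (real_complex R)).
by rewrite lecR.
Qed.

Lemma defect_sharp p (e : R) : 0 < e -> ~ positive_op (D p - e%:C *: (1 : bop K)).
Proof.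
move=> e0 De; have Ye x : [<Y p x, Y p x>] <= (4 - e%:C) * [<x, x>].
  have := De x; rewrite bopB dotBl D_dot [X in _ - X]dotZl -subr_ge0 => h.
  by rewrite -subr_ge0; apply: le_trans h _; rewrite subr0 mulrBl addrAC lexx.
pose r := Num.sqrt (Num.max (4 - e) 0).
have r2 : r < 2.
  rewrite -[2]ger0_norm// -sqrtr_sqr ltr_sqrt ?exprn_gt0// gt_max exprn_gt0// andbT.
  by rewrite -natrX ltrBlDr ltrDl.
suff : opnorm (Y p) <= r by move=> /(le_trans (Y_opnorm p)); rewrite leNgt r2.
apply: sqr_opnorm_le; first exact: sqrtr_ge0.
move=> x; apply: le_trans (Ye x) _; rewrite ler_wpM2r ?dotxx_ge0//.
rewrite -rmorphXn/= sqr_sqrtr ?le_max ?lexx ?orbT// -(rmorph_nat (real_complex R)) -rmorphB/= lecR.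
by rewrite le_max lexx.
Qed.

Let F p := approx_ker (D p).
(** At p the element peak p e_01 maps the second basis vector to twice the first. *)
Let u p (i : 'I_2) (w : K) : K := if i == 0 then 2^-1 *: Y p w else w.

Let F_proper p : ProperFilter (F p).
Proof. by apply: approx_ker_proper; [exact: defect_pos|exact: defect_sharp]. Qed.

Let YY p : vanish (F p) (fun w => adj (Y p) (Y p w) - 4 *: w).
Proof.
have FF := F_proper p; have Y2 : opnorm (Y p) <= 2.
  by apply: sqr_opnorm_le => // x; rewrite four.
have D0 := approx_ker_vanish (@defect_pos p).
apply: (vanish_sqr_le (ler0n _ 4) _ D0); apply: nearW => w.
have := norm_attained (ler0n R 2) Y2 w; rewrite four -D_dot => /le_trans; apply.
by rewrite ler_wpM2l// real_ler_norm// ger0_real// defect_pos.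
Qed.

(** The column of peak p and g has norm at most 2, and the first entry exhausts it on w, so
    that J g w vanishes; the row gives the same conclusion for the adjoints, after testing
    it on w and on a multiple of h = (J g)^* Y w. *)
Let vanishing p g : affine g -> g p = 0 -> (forall q, `|g q| ^+ 2 <= 3) ->
  vanish (F p) (J g) /\ vanish (F p) (fun w => adj (J g) (Y p w)).
Proof.
move=> gg gp g3; have FF := F_proper p.
have D0 := approx_ker_vanish (@defect_pos p).
have n2 := peak_norm2 gp g3; have yy := affine_peak p.
have dn w : [<D p w, w>] <= `|[<D p w, w>]|.
  by rewrite real_ler_norm// ger0_real// defect_pos.
split.
  apply: (vanish_sqr_le (ler01 : 0 <= 1 :> R[i]) _ D0); apply: nearW => w.
  rewrite mul1r -dotxx (le_trans _ (dn w))// D_dot lerBrDl -four.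
  exact: J_column.
apply: (vanish_sqr_le (ler0n _ 4) _ D0); apply: nearW => w.
rewrite -dotxx (le_trans _ (ler_wpM2l (ler0n _ 4) (dn w)))//.
rewrite D_dot; set h := adj (J g) (Y p w); have hh : [<Y p w, J g h>] = [<h, h>] by rewrite -dot_adjl.
have hh' : [<J g h, Y p w>] = [<h, h>] by rewrite dotC hh -dotC.
(* 1/4 is a coefficient for which the term linear in h wins over the quadratic one *)
have := J_row w (4^-1 *: h) yy gg (ler0n R 2) n2.
rewrite four linearZ/= -/(Y p) !dotDl !dotDr !dotZl !dotZr hh hh'.
have -> : (4^-1)^* = 4^-1 :> R[i] by rewrite fmorphV rmorph_nat.
have := dotxx_ge0 (J g h); set G := [<J g h, _>]; set A := [<Y p w, _>].
move=> G0; rewrite -subr_ge0 => X0; rewrite -subr_ge0.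
have G4 : 0 <= 4^-1 * G by rewrite mulr_ge0.
have := addr_ge0 (mulr_ge0 (ler0n _ 4) X0) G4; congr (0 <= _); by field.
Qed.

(** For J g on u_1 = w, and for its adjoint on u_0 = Y w / 2, this is the previous lemma.
    All products of two elements of the corner e_01 are zero: J g u_0 = 0 because
    J g Y = 0, and the adjoint vanishes on u_1, which is close to Y^* Y w / 4, because
    Y J g = 0. *)
Let algebra_act0 p g : affine g -> g p = 0 -> (forall q, `|g q| ^+ 2 <= 3) ->
  act (F p) (u p) (J g) 0 /\ act (F p) (u p) (adj (J g)) 0.
Proof.
move=> gg gp g3; have FF := F_proper p; have [g0 gY0] := vanishing gg gp g3.
have sum0 (i : 'I_2) w : \sum_k (0 : 'M[R[i]]_2) k i *: u p k w = 0.
  by rewrite big1// => k _; rewrite mxE scale0r.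
have gY w : J g (Y p w) = 0.
  by rewrite -[LHS]/((J g * Y p) w) J_mul//; exact: affine_peak.
split=> i; apply: eq_vanish (fun w => esym (etrans (congr1 _ (congr1 _ (sum0 i w))) (subr0 _))) _.
  rewrite /u; case: (i == 0) => //.
  by apply: eq_vanish (@vanish0 _ _ _ _ _) => w; rewrite linearZ/= gY scaler0.
rewrite /u; case: (i == 0).
  by apply: eq_vanish (vanishZ 2^-1 gY0) => w; rewrite linearZ.
apply: eq_vanish (vanishZ (- 4^-1) (vanish_bop (adj (J g)) (YY p))) => w.
rewrite linearB linearZ/= -[adj (J g) (adj (Y p) _)]/((adj (J g) * adj (Y p)) _) -adj_mul.
rewrite J_mul//.
by rewrite adj_zero [bop_fun 0 _]/(0 : K) sub0r scalerN scaleNr opprK scalerA mulVf ?scale1r// pnatr_eq0.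
Qed.

(** Y u_1 = 2 u_0 by choice of u, and Y^* u_0 tends to 2 u_1 because Y^* Y w is close to
    4 w; Y u_0 and the limit of Y^* u_1 vanish because Y Y = 0. *)
Let act_peak p : act (F p) (u p) (Y p) (2 *: delta_mx 0 1) /\
  act (F p) (u p) (adj (Y p)) (2 *: delta_mx 1 0).
Proof.
have FF := F_proper p; have yy := affine_peak p.
have o1 : lift ord0 ord0 = 1 :> 'I_2 by exact/val_inj.
have Y2 w : Y p (Y p w) = 0 by rewrite -[LHS]/((Y p * Y p) w) J_mul.
split=> i; case: (ord2P i) => ->.
- apply: eq_vanish (@vanish0 _ _ (F p) _ K) => w.
  by rewrite !big_ord_recl big_ord0 !mxE /= !mulr0 !scale0r !addr0 /u /= linearZ/= Y2 scaler0 subr0.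
- apply: eq_vanish (@vanish0 _ _ (F p) _ K) => w.
  rewrite !big_ord_recl big_ord0 !mxE /= mulr1 !mulr0 scale0r !addr0 /u /=.
  by rewrite scalerA mulfV ?pnatr_eq0// scale1r subrr.
- apply: eq_vanish (vanishZ 2^-1 (YY p)) => w.
  rewrite !big_ord_recl big_ord0 !mxE /= o1 mulr1 !mulr0 scale0r addr0 add0r /u /=.
  by rewrite scalerBr scalerA [in RHS]linearZ/=; congr (_ - _ *: _); field.
apply: eq_vanish (vanishZ (- 4^-1) (vanish_bop (adj (Y p)) (YY p))) => w.
rewrite !big_ord_recl big_ord0 !mxE /= !mulr0 !scale0r !addr0 /u /= subr0.
rewrite linearB linearZ/= -[adj (Y p) (adj (Y p) _)]/((adj (Y p) * adj (Y p)) _) -adj_mul.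
by rewrite J_mul// adj_zero [bop_fun 0 _]/(0 : K) sub0r scalerN scaleNr opprK scalerA mulVf ?scale1r// pnatr_eq0.
Qed.

(** Subtracting a multiple of the peak leaves a function vanishing at p, and a scalar brings
    it into the range where the norm estimates apply. *)
Let algebra_act p f : affine f -> act (F p) (u p) (J f) (f p *: delta_mx 0 1) /\
  act (F p) (u p) (adj (J f)) ((f p)^* *: delta_mx 1 0).
Proof.
move=> ff; have FF := F_proper p; have yy := affine_peak p; pose g q := - (f p / 2) * peak p q + f q.
have gg : affine g by exact: affine_lin.
have gp : g p = 0 by rewrite /g peak_self mulNr divfK ?addNr// pnatr_eq0.
pose s := \sum_q `|g q| ^+ 2.
have s0 : 0 <= s by apply: sumr_ge0 => q _; exact: exprn_ge0.
have s1 : 0 < 1 + s by rewrite ltr_wpDr.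
have hh := affine_scale (1 + s)^-1 gg.
have h3 q : `|(1 + s)^-1 * g q| ^+ 2 <= 3.
  have gs : `|g q| ^+ 2 <= s.
    by rewrite /s (bigD1 q)//= lerDl; apply: sumr_ge0 => r _; exact: exprn_ge0.
  rewrite normrM exprMn normfV (gtr0_norm s1) exprVn mulrC ler_pdivrMr ?exprn_gt0//.
  rewrite (le_trans gs)// -subr_ge0 (_ : _ - s = 3 + 5 * s + 3 * s ^+ 2); last by ring.
  by rewrite !addr_ge0// ?mulr_ge0 ?exprn_ge0.
have h0 : (1 + s)^-1 * g p = 0 by rewrite gp mulr0.
have [h1 h2] := algebra_act0 hh h0 h3; have [y1 y2] := act_peak p.
have Jf : J f = (f p / 2) *: Y p + (1 + s) *: J (fun q => (1 + s)^-1 * g q).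
  rewrite (J_scale _ gg) scalerA mulfV ?gt_eqF// scale1r (J_lin _ yy ff).
  by rewrite addrA -scalerDl addrN scale0r add0r.
rewrite Jf adj_lin; split.
  have -> : f p *: delta_mx 0 1 = (f p / 2) *: (2 *: delta_mx 0 1) + (1 + s) *: 0 :> 'M[R[i]]_2.
    by rewrite scaler0 addr0 scalerA divfK// pnatr_eq0.
  by apply: act_lin => //; exact: act_scale.
have -> : (f p)^* *: delta_mx 1 0 =
    (f p / 2)^* *: (2 *: delta_mx 1 0) + ((1 + s)^* *: 0) :> 'M[R[i]]_2.
  rewrite scaler0 addr0 scalerA; congr (_ *: _).
  by rewrite rmorphM fmorphV/= rmorph_nat divfK// pnatr_eq0.
apply: act_lin; first exact: y2.
have -> : adj ((1 + s) *: J (fun q => (1 + s)^-1 * g q)) =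
    (1 + s)^* *: adj (J (fun q => (1 + s)^-1 * g q)).
  by apply: adjE => x y; rewrite /= dotZl dotZr conjCK adjP.
exact: act_scale.
Qed.

Let u_le1 p i : \forall w \near F p, `|u p i w| <= 1.
Proof.
have FF := F_proper p; have FF' : ProperFilter (approx_ker (D p)) := FF.
apply: filterS (approx_ker_unit (D p)) => w w1; rewrite /u; case: (i == 0); last by rewrite w1.
rewrite normrZ normfV normr_nat ler_pdivrMl// mulr1.
have := Y_le p w; rewrite !dotxx w1 expr1n mulr1 -four -rmorphXn/= -natrX rmorph_nat.
by rewrite -[4%:R]/((2 ^ 2)%:R) natrX ler_pXn2r// nnegrE.
Qed.

Let u_gram p i k : vanish (F p) (fun w => [<u p i w, u p k w>] - (i == k)%:R).
Proof.
have FF := F_proper p; have FF' : ProperFilter (approx_ker (D p)) := FF.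
have w1 := approx_ker_unit (D p).
have off : vanish (F p) (fun w => [<2^-1 *: Y p w, w>]).
  have v : vanish (F p) (fun w => [<u p 0 w, - 4^-1 *: (adj (Y p) (Y p w) - 4 *: w)>]).
    by apply: vanish_dotr; [exact: u_le1|apply: vanishZ; exact: YY].
  apply: (eq_vanish _ v) => w; rewrite /u eqxx.
  have yy : [<2^-1 *: Y p w, adj (Y p) (Y p w)>] = 0.
    have YYw : Y p (Y p w) = 0.
      by rewrite -[LHS]/((Y p * Y p) w) J_mul//; exact: affine_peak.
    have -> : [<2^-1 *: Y p w, adj (Y p) (Y p w)>] = [<Y p (2^-1 *: Y p w), Y p w>].
      exact: dot_adjr.
    by rewrite linearZ/= YYw scaler0 dot0l.
  have -> : - 4^-1 *: (adj (Y p) (Y p w) - 4 *: w) = w - 4^-1 *: adj (Y p) (Y p w).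
    by rewrite scalerBr scaleNr scalerA mulNr mulVf ?pnatr_eq0// scaleN1r opprK addrC.
  by rewrite dotBr dotZr yy mulr0 subr0.
have diag0 : vanish (F p) (fun w => [<2^-1 *: Y p w, 2^-1 *: Y p w>] - 1).
  apply: (vanish_le (ler01 : 0 <= 1 :> R[i]) _ (approx_ker_vanish (@defect_pos p))).
  apply: filterS w1 => w w1.
  have -> : [<2^-1 *: Y p w, 2^-1 *: Y p w>] - 1 = - 4^-1 * [<D p w, w>].
    by rewrite D_dot (dotxx w) w1 dotZl dotZr fmorphV rmorph_nat; field.
  by rewrite normrM normrN normfV normr_nat ler_wpM2r// invf_le1 ?ler1n.
case: (ord2P i) => ->; case: (ord2P k) => ->; rewrite /u /=.
- exact: diag0.
- by apply: (eq_vanish _ off) => w; rewrite subr0.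
- move=> e /off; apply: filterS => w.
  by rewrite subr0 dotC norm_conjC.
- move=> e e0; apply: filterS w1 => w w1.
  by rewrite dotxx w1 expr1n subrr normr0 ltW.
Qed.

Lemma calU_envelope_map : exists pi : bop K -> bop (hpow (ell2 R 6) 2),
  [/\ unital_star_hom (cstar_gen (j @` calU (W32 R))) pi,
      pi @` cstar_gen (j @` calU (W32 R)) = mx_over 2 (sumB R) &
      forall x, calU (W32 R) x -> pi (j x) = x].
Proof.
rewrite mx_over_sumB; apply: (blocks_quotient (@xiU_onb R) (F := F) (u := u)).
- exact: F_proper.
- exact: u_le1.
- exact: u_gram.
- exact: calU_generates.
move=> _ /calUP[l [a [b ->]]].
exists (fun p => mx2 l (affine_fun a b p) 0 l) => // p; have FF := F_proper p.
have ff : affine (affine_fun a b) by exists a, b.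
have [_ j1 _ _] := jE.
have U1 : calU (W32 R) 1.
  rewrite -(blk1 (@xiU_onb R)); apply/calUP; exists 1, 0, (fun=> 0); congr blk; apply/funext => q.
  rewrite /affine_fun mulr0 addr0; apply/matrixP => i k; rewrite !mxE.
  by case: i => -[|[|//]] i2; case: k => -[|[|//]] k2.
have Mx q : mx2 l (affine_fun a b q) 0 l = l *: 1%:M + affine_fun a b q *: delta_mx 0 1.
  apply/matrixP => i k; rewrite !mxE.
  by case: i => -[|[|//]] i2; case: k => -[|[|//]] k2; rewrite /= ?(mulr1, mulr0, addr0, add0r).
have -> : blk (xiU R) (fun q => mx2 l (affine_fun a b q) 0 l) =
    l *: (1 : bop (hpow (ell2 R 6) 2)) + t (affine_fun a b).
  rewrite -(blk1 (@xiU_onb R)) (blk_lin (@xiU_onb R)); congr blk; apply/funext => q.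
  exact: Mx.
have [jl _ _ _] := jE; rewrite jl ?j1; [|exact: U1|exact: tU].
have [f1 f2] := algebra_act p ff; split.
  by rewrite Mx; apply: act_lin; [exact: act1|exact: f1].
exists (l^* *: 1%:M + (affine_fun a b p)^* *: delta_mx 1 0); rewrite adj_lin adj_one.
by apply: act_lin; [exact: act1|exact: f2].
Qed.

End algebra_envelope.

Lemma calU_envelope (R : realType) :
  is_cstar_envelope (@algebra_embedding R) (calU (W32 R)) id (mx_over 2 (sumB R)).
Proof.
split; [exact: algebra_embedding_id|by rewrite image_id cstar_gen_calU|].
by move=> K j jE; exact: calU_envelope_map.
Qed.

Theorem theorem6p11 (R : realType) :
  (is_cstar_envelope (@algebra_embedding R) (calU (W32 R)) id (mx_over 2 (sumB R))
   /\ algebra_hyperrigid (calU (W32 R)) (mx_over 2 (sumB R)))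
  /\
  (is_cstar_envelope (@system_embedding R) (W32 R) id (sumB R)
   /\ system_hyperrigid (W32 R) (sumB R)).
Proof.
split; split; [exact: calU_envelope|exact: calU_hyperrigid|exact: sumB_envelope|exact: sumB_hyperrigid].
Qed.
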